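(* Let $\mathcal{W},\mathcal{V}$ be closed subspaces of $L^2(\mathbb{R})$ with $L^2(\mathbb{R})=\mathcal{W}\oplus\mathcal{V}^{\perp}$. Let $\phi,\phi_1\in L^2(\mathbb{R})$ be such that $\{T_k\phi\}_{k\in\mathbb{Z}}$ and $\{T_k\phi_1\}_{k\in\mathbb{Z}}$ are frames for $\mathcal{W}$ and $\mathcal{V}$, respectively. Let $0\le\epsilon<1$. If $\widetilde{\phi}\in\mathcal{V}$ verifies $\widehat{\widetilde{\phi}}=\widetilde{H}\,\widehat{\phi_1}$, where $\widetilde{H}\in\mathcal{C}^{2}_{\mathrm{per}}$ is such that $$\big|\overline{\widetilde{H}}(\gamma)[\widehat{\phi},\widehat{\phi_1}](\gamma)-1\big|\le\epsilon\,\frac{\big|[\widehat{\phi},\widehat{\phi_1}](\gamma)\big|}{\sqrt{\Phi(\gamma)\Phi_1(\gamma)}}$$ for a.e. $\gamma\in N(\Phi)^{c}$, then $\{T_k\phi\}_{k\in\mathbb{Z}}$ and $\{T_k\widetilde{\phi}\}_{k\in\mathbb{Z}}$ are $\epsilon$-approximate oblique dual frames.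
   Context: $T_kf(x)=f(x-k)$ for $k\in\mathbb{Z}$. The Fourier transform is $\widehat{f}(\gamma)=\int_{\mathbb{R}}f(x)e^{-2\pi i x\gamma}\,dx$, extended to a unitary operator of $L^2(\mathbb{R})$. $\mathcal{C}^{p}_{\mathrm{per}}$ is the class of 1-periodic functions on $\mathbb{R}$ whose restriction to $[0,1)$ belongs to $L^p(0,1)$. For $\phi,\psi\in L^2(\mathbb{R})$, the 1-periodic bracket is $[\widehat{\phi},\widehat{\psi}](\gamma)=\sum_{k\in\mathbb{Z}}\widehat{\phi}(\gamma+k)\overline{\widehat{\psi}(\gamma+k)}$ (a.e. defined, complex valued); $\Phi(\gamma)=\sum_{k\in\mathbb{Z}}|\widehat{\phi}(\gamma+k)|^2$, $\Phi_1(\gamma)=\sum_{k\in\mathbb{Z}}|\widehat{\phi_1}(\gamma+k)|^2$, $N(\Phi)=\{\gamma:\Phi(\gamma)=0\}$; $A^c$ is the complement of $A$ in $\mathbb{R}$. (It is known that under the stated hypotheses $N(\Phi_1)=N(\Phi)$ up to null sets, so the denominator is nonzero a.e. on $N(\Phi)^c$.) The direct sum $\mathcal{H}=\mathcal{W}\oplus\mathcal{V}^{\perp}$ ($\mathcal{H}=L^2(\mathbb{R})$; equivalently $\mathcal{H}=\mathcal{V}\oplus\mathcal{W}^{\perp}$) is not assumed orthogonal; $\pi_{\mathcal{W}\mathcal{V}^{\perp}}$ is the oblique projection onto $\mathcal{W}$ along $\mathcal{V}^{\perp}$ and $\pi_{\mathcal{V}\mathcal{W}^{\perp}}$ that onto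 $\mathcal{V}$ along $\mathcal{W}^{\perp}$. A family $\{f_k\}\subset\mathcal{W}$ is a frame for $\mathcal{W}$ if there are $0<\alpha\le\beta<\infty$ with $\alpha\|f\|^2\le\sum_k|\langle f,f_k\rangle|^2\le\beta\|f\|^2$ for all $f\in\mathcal{W}$. For such $\mathcal{F}=\{f_k\}$, $T_{\mathcal{F}}\{c_k\}=\sum_kc_kf_k$ (synthesis operator on $\ell^2$) and $T_{\mathcal{F}}^{*}f=\{\langle f,f_k\rangle\}_k$. Frames $\mathcal{F}$ for $\mathcal{W}$ and $\mathcal{G}$ for $\mathcal{V}$ are $\epsilon$-approximate oblique dual frames if $\|\pi_{\mathcal{W}\mathcal{V}^{\perp}}-T_{\mathcal{F}}T_{\mathcal{G}}^{*}\|\le\epsilon$ or, equivalently, $\|\pi_{\mathcal{V}\mathcal{W}^{\perp}}-T_{\mathcal{G}}T_{\mathcal{F}}^{*}\|\le\epsilon$. *)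

(* Defs.v *)
From HB Require Import structures.
From mathcomp Require Import all_boot all_order all_algebra finmap.
From mathcomp Require Import all_classical all_reals all_analysis.
From mathcomp Require Export complex.

Set Implicit Arguments.
Unset Strict Implicit.
Unset Printing Implicit Defensive.

Import Order.TTheory GRing.Theory Num.Theory.
Import numFieldNormedType.Exports.

Local Open Scope classical_set_scope.
Local Open Scope ring_scope.
Local Open Scope complex_scope.

Section L2.
Context {R : realType}.
Local Notation C := (R[i]).
Local Notation mu := (@lebesgue_measure R).
Implicit Types (f g : R -> C) (W V U : set (R -> C)) (F G : int -> R -> C).

Definition cnorm (z : C) : R := Normc.normc z.

(* Elements of L^p(D) are represented by functions; equality in L^p is equality
   almost everywhere.  Outside D the values of f are irrelevant. *)
Definition Lp (D : set R) (p : \bar R) f : Prop :=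
  [/\ measurable_fun D (fun x => complex.Re (f x)),
      measurable_fun D (fun x => complex.Im (f x)) &
      finite_norm mu p ((fun x => cnorm (f x)) \_ D)].

Definition L1 f : Prop := Lp [set: R] 1%E f.
Definition L2 f : Prop := Lp [set: R] 2%:E f.

(* Extended-valued, so that statements such as "the norm tends to 0" are
   meaningful even for functions that are not known to be in L^2. *)
Definition norm2 f : \bar R := ('N[mu]_2%:E[EFin \o (fun x => cnorm (f x))])%E.

Definition cintegral f : C :=
  (\int[mu]_x complex.Re (f x)) +i* (\int[mu]_x complex.Im (f x)).

Definition inner f g : C := cintegral (fun x => f x * (g x)^*).

Definition L2cvg (u : nat -> R -> C) f : Prop :=
  (fun n => norm2 (u n \- f)) @ \oo --> 0%E.

(* Being closed under limits, a closed subspace is in particular closed under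
   almost everywhere equality. *)
Definition closed_subspace W : Prop :=
  [/\ W `<=` L2,
      W (fun _ => 0),
      (forall f g, W f -> W g -> W (f \+ g)),
      (forall (a : C) f, W f -> W (fun x => a * f x)) &
      (forall (u : nat -> R -> C) f,
         (forall n, W (u n)) -> L2 f -> L2cvg u f -> W f)].

Definition orth V : set (R -> C) :=
  [set f | L2 f /\ forall g, V g -> inner f g = 0].

(* L^2(R) = W (+) U, an algebraic, not necessarily orthogonal, direct sum. *)
Definition direct_sum W U : Prop :=
  (forall f, L2 f -> exists g h, [/\ W g, U h & f = g \+ h]) /\
  (forall f, W f -> U f -> {ae mu, forall x, f x = 0}).

(* A representative of the W-component of f in L^2(R) = W (+) U, which is unique
   up to almost everywhere equality. *)
Definition oblique_proj W U f : R -> C :=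
  xget (fun _ => 0) [set g | W g /\ U (f \- g)].

Definition expi (t : R) : C := cos t +i* sin t.

Definition fourierL1 f : R -> C :=
  fun gamma => cintegral (fun x => f x * expi (- (2 * pi * x * gamma))).

(* The graph of the continuous extension to L^2 of the Fourier integral on the
   dense subspace given by the intersection of L^1 and L^2. *)
Definition is_fourier f g : Prop :=
  L2 g /\ exists u : nat -> R -> C,
    [/\ forall n, L1 (u n) /\ L2 (u n),
        L2cvg u f & L2cvg (fun n => fourierL1 (u n)) g].

(* A representative of the Fourier transform of f in L^2. *)
Definition fourier f : R -> C := xget (fun _ => 0) (is_fourier f).

Definition translate (k : int) f : R -> C := fun x => f (x - k%:~R).

Definition translates f : int -> R -> C := fun k => translate k f.

(* Unordered sums over Z, meaningful for absolutely summable families. *)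
Definition zsumR (a : int -> R) : R :=
  fine (\esum_(k in [set: int]) (Num.max (a k) 0)%:E)
  - fine (\esum_(k in [set: int]) (Num.max (- a k) 0)%:E).

Definition zsum (a : int -> C) : C :=
  zsumR (fun k => complex.Re (a k)) +i* zsumR (fun k => complex.Im (a k)).

(* [f^, g^](gamma), where f and g themselves are given. *)
Definition bracket f g (gamma : R) : C :=
  zsum (fun k => fourier f (gamma + k%:~R) * (fourier g (gamma + k%:~R))^*).

(* Extended-valued: the sum is finite only for almost every gamma. *)
Definition Phi f (gamma : R) : \bar R :=
  \esum_(k in [set: int]) (cnorm (fourier f (gamma + k%:~R)) ^+ 2)%:E.

Definition zeros (P : R -> \bar R) : set R := [set gamma | P gamma = 0%E].

Definition Cper (p : \bar R) (H : R -> C) : Prop :=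
  (forall x, H (x + 1) = H x) /\ Lp `[0, 1[ p H.

Definition is_frame W F : Prop :=
  (forall k, W (F k)) /\
  exists alpha beta : R, [/\ 0 < alpha, alpha <= beta &
    forall f, W f ->
      (alpha%:E * norm2 f ^+ 2
         <= \esum_(k in [set: int]) (cnorm (inner f (F k)) ^+ 2)%:E)%E /\
      (\esum_(k in [set: int]) (cnorm (inner f (F k)) ^+ 2)%:E
         <= beta%:E * norm2 f ^+ 2)%E].

(* g is the sum, unconditionally convergent in L^2, of the series of c k F k. *)
Definition is_synthesis F (c : int -> C) g : Prop :=
  L2 g /\ forall e : R, 0 < e -> exists A : {fset int},
    forall B : {fset int}, {subset A <= B} ->
      (norm2 (g \- (fun x => \sum_(k <- B) c k * F k x))%R <= e%:E)%E.

Definition synthesis F (c : int -> C) : R -> C :=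
  xget (fun _ => 0) (is_synthesis F c).

Definition analysis F f : int -> C := fun k => inner f (F k).

Definition opnorm (T : (R -> C) -> R -> C) : \bar R :=
  ereal_sup [set norm2 (T f) | f in [set f | L2 f /\ (norm2 f <= 1)%E]].

Definition approx_oblique_dual W V (eps : R) F G : Prop :=
  [/\ is_frame W F, is_frame V G &
    (opnorm (fun f => oblique_proj W (orth V) f \- synthesis F (analysis G f))%R
       <= eps%:E)%E].

End L2.

(* Main.v *)
Require Import Defs.
From HB Require Import structures.
From mathcomp Require Import all_boot all_order all_algebra finmap.
From mathcomp Require Import all_classical all_reals all_analysis.
From mathcomp Require Import complex.
From mathcomp Require Import measurable_realfun zify ring lra.
Import Order.TTheory GRing.Theory Num.Theory.
Import numFieldNormedType.Exports.
Set Implicit Arguments.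
Unset Strict Implicit.
Unset Printing Implicit Defensive.
Local Open Scope classical_set_scope.
Local Open Scope ring_scope.
Local Open Scope complex_scope.

(** Write D = [0, 1[, E_k for the k-th character, and p = sum c_k E_k for the symbol
    of the combination sum c_k T_k phi. Plancherel's identity and periodization
    turn inner products of combinations of translates into weighted integrals
    over D: <p phi, q phi1> is the integral of p q^* [phi^, phi1^], and
    |p phi|^2 that of |p|^2 Phi. Density of trigonometric polynomials in L^2(D)
    then converts inequalities valid for all symbols into pointwise ones. The
    frame bounds give that Phi and Phi1 are bounded, and bounded below where they
    do not vanish; the direct sum decomposition and the uniform boundedness
    principle give Phi Phi1 <= C^2 |[phi^, phi1^]|^2. With the hypothesis on H,
    |H|^2 Phi1 is bounded above and below where Phi1 <> 0, so the translates of
    phit form a frame of V. On a combination g = p phi, the synthesis of the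
    analysis of g has symbol p H^* [phi^, phi1^], hence the error is at most eps
    times the L^2(D)-norm of p [phi^, phi1^] / sqrt Phi1. Testing f, of which g is
    the oblique projection, against combinations of translates of phi1 bounds that
    norm by |f|. General f follows by density, finite combinations being dense in
    W by the frame algorithm. *)

(** The translates form frames, not Riesz bases: symbols are not unique, Phi may vanish, and the
    direct sum is algebraic, with no bound on its projection given. Estimates are therefore made on
    finite combinations, whose symbols are trigonometric polynomials, and reach W, V or L^2 with
    errors that tend to 0. Boundedness of the projection enters only as the constant of
    [oblique_dual_norm]. H is arbitrary where Phi1 vanishes; the quantities that receive bounds are
    |H|^2 Phi1 and Z = conj(H) [phi^, phi1^]. By Cauchy-Schwarz the quotient on the right of the
    hypothesis is at most 1, so 1 - eps <= |Z| <= 1 + eps, and eps < 1 yields the lower frame bound.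
    The error estimate is the hypothesis squared and multiplied by Phi: Phi |1 - Z|^2 <= eps^2
    |[phi^, phi1^]|^2 / Phi1. Since x / 0 = 0, these inequalities can be stated almost everywhere on
    D; where Phi = 0 the bracket and Phi1 vanish too, and nothing remains to prove. *)

Local Notation Re := complex.Re.
Local Notation Im := complex.Im.

(** * Square-integrable complex functions *)

Section ComplexIntegral.
Context {R : realType}.
Local Notation C := (R[i]).
Local Notation mu := (@lebesgue_measure R).
Implicit Types (f g h : R -> C) (D : set R).

(* The notation [^*] stands for conjc or for Num.conj depending on the context,
   and lemmas about one do not rewrite the other. *)
Definition cj (z : C) : C := Re z -i* Im z.

Lemma cjE (z : C) : (z^* )%C = cj z. Proof. by case: z. Qed.

(** The squared modulus, as a polynomial in the real and imaginary parts, so that its identities are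
    proved by [ring] without square roots. *)
Definition nsq (z : C) : R := Re z ^+ 2 + Im z ^+ 2.

Lemma ReD (x y : C) : Re (x + y) = Re x + Re y. Proof. by case: x y => [? ?] [? ?]. Qed.
Lemma ImD (x y : C) : Im (x + y) = Im x + Im y. Proof. by case: x y => [? ?] [? ?]. Qed.
Lemma ReN (x : C) : Re (- x) = - Re x. Proof. by case: x. Qed.
Lemma ImN (x : C) : Im (- x) = - Im x. Proof. by case: x. Qed.
Lemma ReM (x y : C) : Re (x * y) = Re x * Re y - Im x * Im y.
Proof. by case: x y => [? ?] [? ?]. Qed.
Lemma ImM (x y : C) : Im (x * y) = Re x * Im y + Im x * Re y.
Proof. by case: x y => [? ?] [? ?]. Qed.
Lemma ReJ (x : C) : Re ((cj x)) = Re x. Proof. by case: x. Qed.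
Lemma ImJ (x : C) : Im ((cj x)) = - Im x. Proof. by case: x. Qed.
Lemma ReR (x : R) : Re (x%:C) = x. Proof. by []. Qed.
Lemma ImR (x : R) : Im (x%:C) = 0. Proof. by []. Qed.
Lemma Re0 : Re (0 : C) = 0. Proof. by []. Qed.
Lemma Im0 : Im (0 : C) = 0. Proof. by []. Qed.

Definition ReImE := (ReD, ImD, ReN, ImN, ReM, ImM, ReJ, ImJ, ReR, ImR, Re0, Im0).

Lemma complex_eq (x y : C) : Re x = Re y -> Im x = Im y -> x = y.
Proof. by case: x y => [a b] [c d] /= -> ->. Qed.

Lemma nsq_ge0 z : 0 <= nsq z.
Proof. by rewrite addr_ge0 ?sqr_ge0. Qed.
Hint Resolve nsq_ge0 : core.

Lemma cnormE z : cnorm z = Num.sqrt (nsq z).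
Proof. by case: z. Qed.

Lemma cnorm_sq z : cnorm z ^+ 2 = nsq z.
Proof. by rewrite cnormE sqr_sqrtr. Qed.

Lemma cnorm_ge0 (z : C) : 0 <= cnorm z.
Proof. by rewrite cnormE sqrtr_ge0. Qed.

Lemma nsqM (x y : C) : nsq (x * y) = nsq x * nsq y.
Proof. by rewrite /nsq !ReImE; ring. Qed.

Lemma nsqJ (x : C) : nsq ((cj x)) = nsq x.
Proof. by rewrite /nsq !ReImE; ring. Qed.

Lemma nsqN (x : C) : nsq (- x) = nsq x.
Proof. by rewrite /nsq !ReImE; ring. Qed.

Lemma nsqR (x : R) : nsq (x%:C) = x ^+ 2.
Proof. by rewrite /nsq !ReImE; ring. Qed.

Lemma nsq0 : nsq 0 = 0.
Proof. by rewrite /nsq !ReImE; ring. Qed.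

Lemma nsq_eq0 (x : C) : nsq x = 0 -> x = 0.
Proof.
move/eqP; rewrite paddr_eq0 ?sqr_ge0// !sqrf_eq0 => /andP[/eqP a /eqP b].
exact: complex_eq.
Qed.

Lemma mulJ_nsq (x : C) : x * (cj x) = (nsq x)%:C.
Proof. by apply: complex_eq; rewrite !ReImE /nsq; ring. Qed.

(** By the parallelogram law the gap between the two sides is |x - y|^2. *)
Lemma nsqD_le (x y : C) : nsq (x + y) <= 2 * nsq x + 2 * nsq y.
Proof.
rewrite -subr_ge0 (_ : _ - _ = nsq (x - y)) //.
by rewrite /nsq !ReImE; ring.
Qed.

Definition cmeas D f :=
  measurable_fun D (fun x => Re (f x)) /\ measurable_fun D (fun x => Im (f x)).

Definition rint D (u : R -> R) := mu.-integrable D (EFin \o u).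

Definition cintble D f := rint D (fun x => Re (f x)) /\ rint D (fun x => Im (f x)).

Definition cint D f : C :=
  (\int[mu]_(x in D) Re (f x)) +i* (\int[mu]_(x in D) Im (f x)).

(** Everything is relative to a set because the same inner product algebra serves the whole line and
    the period [0, 1[. [Lp2P] and [L2P] identify this class with the one of the statement. *)
Definition L2on D f := cmeas D f /\ rint D (fun x => nsq (f x)).

Definition nrm2 D f : R := \int[mu]_(x in D) nsq (f x).

Definition nrm D f : R := Num.sqrt (nrm2 D f).

Definition ip D f g : C := cint D (fun x => f x * (cj (g x))).

Lemma ae_mono (P Q : R -> Prop) : (forall x, P x -> Q x) ->
  {ae mu, forall x, P x} -> {ae mu, forall x, Q x}.
Proof. by move=> PQ; apply: filterS PQ; exact: (ae_filter_ringOfSetsType mu). Qed.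

Lemma ae_mono2 (P Q S : R -> Prop) : (forall x, P x -> S x -> Q x) ->
  {ae mu, forall x, P x} -> {ae mu, forall x, S x} -> {ae mu, forall x, Q x}.
Proof. by move=> PQ; apply: filterS2 PQ; exact: (ae_filter_ringOfSetsType mu). Qed.

Lemma conjM (a b : C) : cj (a * b) = cj a * cj b.
Proof. by rewrite -!cjE; exact: rmorphM. Qed.
Lemma conjD (a b : C) : cj (a + b) = cj a + cj b.
Proof. by rewrite -!cjE; exact: rmorphD. Qed.
Lemma conjN (a : C) : cj (- a) = - cj a.
Proof. by rewrite -!cjE; exact: rmorphN. Qed.
Lemma conjR (a : R) : (cj (a%:C)) = a%:C. Proof. by rewrite -cjE; exact: conjc_real. Qed.
Lemma conjK (a : C) : (cj ((cj a))) = a. Proof. by rewrite -!cjE; exact: conjcK. Qed.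
Lemma conj_sum (I : Type) (s : seq I) (F : I -> C) :
  (cj (\sum_(k <- s) F k)) = \sum_(k <- s) (cj (F k)).
Proof.
by elim: s => [|a s IH]; rewrite ?big_nil ?big_cons ?conjD ?IH//; exact: conjR 0.
Qed.
Lemma realCM (a b : R) : (a * b)%:C = a%:C * b%:C :> C. Proof. exact: rmorphM. Qed.

Section OnD.
Variable D : set R.
Hypothesis mD : measurable D.

Lemma cmeasD f g : cmeas D f -> cmeas D g -> cmeas D (f \+ g).
Proof.
move=> [f1 f2] [g1 g2]; split.
- by under eq_fun do rewrite ReD; exact: measurable_funD.
- by under eq_fun do rewrite ImD; exact: measurable_funD.
Qed.

Lemma cmeasM f g : cmeas D f -> cmeas D g -> cmeas D (fun x => f x * g x).
Proof.
move=> [f1 f2] [g1 g2]; split.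
- by under eq_fun do rewrite ReM; apply: measurable_funB; exact: measurable_funM.
- by under eq_fun do rewrite ImM; apply: measurable_funD; exact: measurable_funM.
Qed.

Lemma cmeasJ f : cmeas D f -> cmeas D (fun x => (cj (f x))).
Proof.
move=> [f1 f2]; split.
- by under eq_fun do rewrite ReJ.
- by under eq_fun do rewrite ImJ; exact: measurable_funN.
Qed.

Lemma cmeas_cst (c : C) : cmeas D (fun=> c).
Proof. by split; apply: measurable_cst. Qed.

Lemma cmeasN f : cmeas D f -> cmeas D (\- f).
Proof.
move=> [f1 f2]; split.
- by under eq_fun do rewrite ReN; exact: measurable_funN.
- by under eq_fun do rewrite ImN; exact: measurable_funN.
Qed.

Lemma cmeasB f g : cmeas D f -> cmeas D g -> cmeas D (f \- g).
Proof. by move=> cf cg; apply: (cmeasD cf (cmeasN cg)). Qed.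

Lemma cmeasR (u : R -> R) : measurable_fun D u -> cmeas D (fun x => (u x)%:C).
Proof. by move=> mu_; split => //; exact: measurable_cst. Qed.

Lemma cmeas_nsq f : cmeas D f -> measurable_fun D (fun x => nsq (f x)).
Proof.
move=> [f1 f2]; apply: measurable_funD; exact: measurable_funX.
Qed.

Lemma measurable_sqrt (u : R -> R) : measurable_fun D u ->
  measurable_fun D (fun x => Num.sqrt (u x)).
Proof.
move=> mu_; have ms : measurable_fun setT (@Num.sqrt R).
  by apply: continuous_measurable_fun; exact: sqrt_continuous.
exact: (measurableT_comp ms mu_).
Qed.

Lemma cmeas_cnorm f : cmeas D f -> measurable_fun D (fun x => cnorm (f x)).
Proof.
by move=> mf; under eq_fun do rewrite cnormE; apply: measurable_sqrt; exact: cmeas_nsq.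
Qed.

Lemma rint_meas u : rint D u -> measurable_fun D u.
Proof. by move=> /measurable_int /measurable_EFinP. Qed.

Lemma rint_le (u v : R -> R) : measurable_fun D u -> (forall x, D x -> `|u x| <= v x) ->
  rint D v -> rint D u.
Proof.
move=> mu_ uv iv; apply: le_integrable iv => //; first exact/measurable_EFinP.
move=> x Dx /=; rewrite lee_fin; apply: (le_trans (uv _ Dx)); exact: ler_norm.
Qed.

Lemma rintD u v : rint D u -> rint D v -> rint D (fun x => u x + v x).
Proof. by move=> iu iv; exact: (integrableD (mu := mu) mD iu iv). Qed.

Lemma rintB u v : rint D u -> rint D v -> rint D (fun x => u x - v x).
Proof. by move=> iu iv; exact: (integrableB (mu := mu) mD iu iv). Qed.

Lemma rintZ c u : rint D u -> rint D (fun x => c * u x).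
Proof. by move=> iu; exact: (integrableZl (mu := mu) mD c iu). Qed.

Lemma cintble_mul f g : L2on D f -> L2on D g ->
  cintble D (fun x => f x * (cj (g x))).
Proof.
move=> [mf nf] [mg ng].
have [m1 m2] := cmeasM mf (cmeasJ mg).
(* Bounds the real part of f times the conjugate of g by |f|^2 + |g|^2; the imaginary part has the
   same shape up to a permutation of the variables and a sign. *)
have key a b c d : `|a * c + b * d| <= (a ^+ 2 + b ^+ 2) + (c ^+ 2 + d ^+ 2) :> R.
  rewrite ler_norml; apply/andP; split.
    by have := sqr_ge0 (a + c); have := sqr_ge0 (b + d); rewrite !sqrrD; have := sqr_ge0 a; have := sqr_ge0 b; have := sqr_ge0 c; have := sqr_ge0 d; lra.
  by have := sqr_ge0 (a - c); have := sqr_ge0 (b - d); rewrite !sqrrB; have := sqr_ge0 a; have := sqr_ge0 b; have := sqr_ge0 c; have := sqr_ge0 d; lra.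
split; (apply: (rint_le _ _ (rintD nf ng)) => //) => x _; rewrite !ReImE /nsq.
- by rewrite mulrN opprK key.
- by rewrite mulrN addrC -mulNr addrC; have := key (- Re (f x)) (Im (f x)) (Im (g x)) (Re (g x)); rewrite sqrrN (addrC (Im (g x) ^+ 2)).
Qed.

Lemma L2on_meas f : L2on D f -> cmeas D f. Proof. by case. Qed.

Lemma L2onD f g : L2on D f -> L2on D g -> L2on D (f \+ g).
Proof.
move=> [mf nf] [mg ng]; split; first exact: cmeasD.
apply: (rint_le _ _ (rintD (rintZ 2 nf) (rintZ 2 ng))).
- by apply: cmeas_nsq; exact: cmeasD.
- by move=> x _; rewrite ger0_norm// nsqD_le.
Qed.

Lemma L2onM_bounded f g (M : R) : cmeas D g ->
  (forall x, D x -> nsq (g x) <= M) ->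
  L2on D f -> L2on D (fun x => g x * f x).
Proof.
move=> mg gM [mf nf]; split; first exact: cmeasM.
apply: (rint_le _ _ (rintZ M nf)).
- by apply: cmeas_nsq; exact: cmeasM.
- by move=> x Dx; rewrite ger0_norm// nsqM ler_wpM2r// gM.
Qed.

Lemma L2onZ c f : L2on D f -> L2on D (fun x => c * f x).
Proof. by apply: (L2onM_bounded (M := nsq c)) => //; exact: cmeas_cst. Qed.

Lemma L2onN f : L2on D f -> L2on D (\- f).
Proof.
move=> [mf nf]; split; first exact: cmeasN.
by under eq_fun do rewrite nsqN.
Qed.

Lemma L2onB f g : L2on D f -> L2on D g -> L2on D (f \- g).
Proof. by move=> lf lg; exact: (L2onD lf (L2onN lg)). Qed.

Lemma L2on0 : L2on D (fun=> 0).
Proof.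
split; first exact: cmeas_cst.
by under eq_fun do rewrite nsq0; exact: integrable0.
Qed.

Lemma L2on_sum (I : Type) (s : seq I) (F : I -> R -> C) :
  (forall k, L2on D (F k)) -> L2on D (fun x => \sum_(k <- s) F k x).
Proof.
move=> LF; elim: s => [|a s IH].
  by under eq_fun do rewrite big_nil; exact: L2on0.
by under eq_fun do rewrite big_cons; exact: (L2onD (LF a) IH).
Qed.

Lemma cintbleD f g : cintble D f -> cintble D g -> cintble D (f \+ g).
Proof.
move=> [f1 f2] [g1 g2]; split.
- by under eq_fun do rewrite ReD; exact: rintD.
- by under eq_fun do rewrite ImD; exact: rintD.
Qed.

Lemma cintbleZ c f : cintble D f -> cintble D (fun x => c * f x).
Proof.
move=> [f1 f2]; split.
- by under eq_fun do rewrite ReM; apply: rintB; exact: rintZ.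
- by under eq_fun do rewrite ImM; apply: rintD; exact: rintZ.
Qed.

Lemma cintble_meas f : cintble D f -> cmeas D f.
Proof. by move=> [f1 f2]; split; exact: rint_meas. Qed.

Lemma cintJ f : cintble D f -> cint D (fun x => (cj (f x))) = (cj (cint D f)).
Proof.
move=> [f1 f2]; rewrite /cint; apply: complex_eq => //=.
by rewrite -[RHS]mulN1r -RintegralZl//; apply: eq_Rintegral => x _; rewrite mulN1r.
Qed.

Lemma cintD f g : cintble D f -> cintble D g ->
  cint D (f \+ g) = cint D f + cint D g.
Proof.
move=> [f1 f2] [g1 g2]; rewrite /cint; apply: complex_eq => /=.
- by under eq_Rintegral do rewrite ReD; rewrite RintegralD.
- by under eq_Rintegral do rewrite ImD; rewrite RintegralD.
Qed.

Lemma cintZ c f : cintble D f -> cint D (fun x => c * f x) = c * cint D f.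
Proof.
move=> [f1 f2]; rewrite [LHS]/cint; apply: complex_eq; rewrite !ReImE /= /cint /=.
- rewrite -!RintegralZl// -RintegralB//=; [|exact: rintZ|exact: rintZ].
  by apply: eq_Rintegral => x _; rewrite ReM.
- rewrite -!RintegralZl// -RintegralD//=; [|exact: rintZ|exact: rintZ].
  by apply: eq_Rintegral => x _; rewrite ImM.
Qed.

Lemma eq_cint f g : {in D, f =1 g} -> cint D f = cint D g.
Proof.
by move=> fg; rewrite /cint; congr Complex; apply: eq_Rintegral => x /fg ->.
Qed.

Lemma ae_eq_Rint (u v : R -> R) : measurable_fun D u -> measurable_fun D v ->
  {ae mu, forall x, D x -> u x = v x} ->
  \int[mu]_(x in D) u x = \int[mu]_(x in D) v x.
Proof.
move=> mu_ mv uv; congr fine; apply: ae_eq_integral => //; try exact/measurable_EFinP.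
by apply: ae_mono uv => x /[apply] ->.
Qed.

Lemma ae_rint (u v : R -> R) : measurable_fun D v ->
  {ae mu, forall x, D x -> u x = v x} -> rint D u -> rint D v.
Proof.
move=> mv uv iu; apply/integrableP; split; first exact/measurable_EFinP.
move: (iu) => /integrableP[m1]; apply: le_lt_trans.
rewrite (@ae_eq_integral _ _ _ mu D (fun x => `|(EFin \o u) x|)%E) //.
- by apply/measurableT_comp => //; exact/measurable_EFinP.
- exact/measurableT_comp.
- by apply: ae_mono uv => x /[apply] /= ->.
Qed.

Lemma ae_eq_cint f g : cmeas D f -> cmeas D g ->
  {ae mu, forall x, D x -> f x = g x} -> cint D f = cint D g.
Proof.
move=> [f1 f2] [g1 g2] fg; rewrite /cint; congr Complex; apply: ae_eq_Rint => //;
  by apply: ae_mono fg => x /[apply] ->.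
Qed.

Lemma ipDl f g h : L2on D f -> L2on D g -> L2on D h ->
  ip D (f \+ g) h = ip D f h + ip D g h.
Proof.
move=> lf lg lh; rewrite -cintD; try exact: cintble_mul.
by apply: eq_cint => x _; rewrite /= mulrDl.
Qed.

Lemma ipZl c f h : L2on D f -> L2on D h ->
  ip D (fun x => c * f x) h = c * ip D f h.
Proof.
move=> lf lh; rewrite -cintZ; last exact: cintble_mul.
by apply: eq_cint => x _; rewrite /= mulrA.
Qed.

Lemma ipC f g : L2on D f -> L2on D g -> ip D g f = (cj (ip D f g)).
Proof.
move=> lf lg; rewrite -cintJ; last exact: cintble_mul.
by apply: eq_cint => x _; rewrite conjM conjK mulrC.
Qed.

Lemma ipDr f g h : L2on D f -> L2on D g -> L2on D h ->
  ip D f (g \+ h) = ip D f g + ip D f h.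
Proof.
move=> lf lg lh; rewrite (@ipC (g \+ h))//; last exact: L2onD.
by rewrite ipDl// conjD -!ipC.
Qed.

Lemma ipZr c f h : L2on D f -> L2on D h ->
  ip D f (fun x => c * h x) = (cj c) * ip D f h.
Proof.
move=> lf lh; rewrite (@ipC (fun x => c * h x))//; last exact: L2onZ.
by rewrite ipZl// conjM -ipC.
Qed.

Lemma ipNl f h : L2on D f -> L2on D h -> ip D (\- f) h = - ip D f h.
Proof.
move=> lf lh; rewrite -mulN1r -ipZl//.
by congr (ip D _ h); apply/funext => x; rewrite mulN1r.
Qed.

Lemma ipNr f h : L2on D f -> L2on D h -> ip D f (\- h) = - ip D f h.
Proof.
by move=> lf lh; rewrite (ipC (L2onN lh) lf) ipNl// conjN -ipC.
Qed.

Lemma ipBl f g h : L2on D f -> L2on D g -> L2on D h ->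
  ip D (f \- g) h = ip D f h - ip D g h.
Proof. by move=> lf lg lh; rewrite -ipNl//; apply: ipDl => //; exact: L2onN. Qed.

Lemma ipBr f g h : L2on D f -> L2on D g -> L2on D h ->
  ip D f (g \- h) = ip D f g - ip D f h.
Proof. by move=> lf lg lh; rewrite -ipNr//; apply: ipDr => //; exact: L2onN. Qed.

Lemma ip0l h : ip D (fun=> 0) h = 0.
Proof.
rewrite /ip /cint; under eq_Rintegral do rewrite mul0r.
under [in X in Complex _ X]eq_Rintegral do rewrite mul0r.
by rewrite /= Rintegral_cst// mul0r.
Qed.

Lemma ip_suml (I : Type) (s : seq I) (F : I -> R -> C) g : L2on D g ->
  (forall k, L2on D (F k)) ->
  ip D (fun x => \sum_(k <- s) F k x) g = \sum_(k <- s) ip D (F k) g.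
Proof.
move=> lg LF; elim: s => [|a s IH].
  by under eq_fun do rewrite big_nil; rewrite big_nil ip0l.
under eq_fun do rewrite big_cons; rewrite big_cons -IH -ipDl//; exact: L2on_sum.
Qed.

Lemma ip_sumr (I : Type) (s : seq I) (F : I -> R -> C) g : L2on D g ->
  (forall k, L2on D (F k)) ->
  ip D g (fun x => \sum_(k <- s) F k x) = \sum_(k <- s) ip D g (F k).
Proof.
move=> lg LF; rewrite ipC ?ip_suml//; last exact: L2on_sum.
by rewrite conj_sum; apply: eq_bigr => k _; rewrite -ipC.
Qed.

Lemma nrm2_ge0 f : 0 <= nrm2 D f.
Proof. by apply: Rintegral_ge0. Qed.
Hint Resolve nrm2_ge0 : core.

Lemma nrm_ge0 f : 0 <= nrm D f.
Proof. exact: sqrtr_ge0. Qed.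
Hint Resolve nrm_ge0 : core.

Lemma nrm_sq f : nrm D f ^+ 2 = nrm2 D f.
Proof. by rewrite sqr_sqrtr. Qed.

Lemma ipff f : ip D f f = (nrm2 D f)%:C.
Proof.
rewrite /ip /cint /nrm2; apply: complex_eq => /=.
- by apply: eq_Rintegral => x _; rewrite mulJ_nsq.
- by under eq_Rintegral do rewrite mulJ_nsq /=; rewrite Rintegral_cst// mul0r.
Qed.

Lemma nrm2E f : nrm2 D f = Re (ip D f f).
Proof. by rewrite ipff. Qed.

Lemma nrm2D f g : L2on D f -> L2on D g ->
  nrm2 D (f \+ g) = nrm2 D f + 2 * Re (ip D f g) + nrm2 D g.
Proof.
move=> lf lg; have lfg := L2onD lf lg.
rewrite !nrm2E ipDl// !ipDr// (ipC lf lg) !ReImE; ring.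
Qed.

Lemma nrm2Z c f : L2on D f -> nrm2 D (fun x => c * f x) = nsq c * nrm2 D f.
Proof.
move=> lf; have lcf := L2onZ c lf.
by rewrite !nrm2E ipZl// ipZr// mulrA mulJ_nsq ipff !ReImE; ring.
Qed.

Lemma nrm2N f : nrm2 D (\- f) = nrm2 D f.
Proof. by apply: eq_Rintegral => x _; rewrite nsqN. Qed.

Lemma nrm2B f g : L2on D f -> L2on D g ->
  nrm2 D (f \- g) = nrm2 D f - 2 * Re (ip D f g) + nrm2 D g.
Proof.
move=> lf lg; rewrite (nrm2D lf (L2onN lg)) ipNr// nrm2N ReN; ring.
Qed.

(** The discriminant argument, isolated because it serves twice: for integrals in [CS2] and, fibre
    by fibre, for the bracket in [zsum_CS]. *)
Lemma CS2_of_quadratic (a c : R) (b : C) : 0 <= a -> 0 <= c ->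
  (forall t : C, 0 <= a + 2 * Re ((cj t) * b) + nsq t * c) -> nsq b <= a * c.
Proof.
move=> a0 c0 H.
have [cz|cn] := eqVneq c 0.
  move: H; rewrite cz => H.
  have [//|] := leP (nsq b) (a * 0); rewrite mulr0 => b0.
  (* With c = 0 the form is affine in t, and this t gives it the value -1. *)
  have := H ((- (a + 1) / (2 * nsq b))%:C * b).
  rewrite conjM conjR -mulrA (mulrC ((cj b))) mulJ_nsq mulr0 addr0 -realCM ReR.
  have -> : 2 * (- (a + 1) / (2 * nsq b) * nsq b) = - (a + 1) by field; rewrite gt_eqF.
  by lra.
have c1 : 0 < c by rewrite lt_def cn.
(* The minimizer of the quadratic form. *)
have := H ((- c^-1)%:C * b).
rewrite conjM conjR -mulrA (mulrC ((cj b))) mulJ_nsq nsqM nsqR -realCM ReR.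
have -> : a + 2 * (- c^-1 * nsq b) + (- c^-1) ^+ 2 * nsq b * c = (a * c - nsq b) / c.
  by field; rewrite gt_eqF.
by rewrite pmulr_lge0 ?invr_gt0// subr_ge0.
Qed.

Lemma CS2 f g : L2on D f -> L2on D g -> nsq (ip D f g) <= nrm2 D f * nrm2 D g.
Proof.
move=> lf lg; apply: CS2_of_quadratic => // t.
have := nrm2_ge0 (f \+ (fun x => t * g x)).
by rewrite nrm2D// ?nrm2Z ?ipZr//; exact: L2onZ.
Qed.

Lemma CS f g : L2on D f -> L2on D g -> cnorm (ip D f g) <= nrm D f * nrm D g.
Proof.
by move=> lf lg; rewrite cnormE -sqrtrM// ler_sqrt ?CS2// mulr_ge0.
Qed.

Lemma Re_le_cnorm (z : C) : Re z <= cnorm z.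
Proof.
rewrite cnormE (le_trans (ler_norm _))// -sqrtr_sqr ler_sqrt ?nsq_ge0//.
by rewrite lerDl sqr_ge0.
Qed.

Lemma nrm_triangle f g : L2on D f -> L2on D g -> nrm D (f \+ g) <= nrm D f + nrm D g.
Proof.
move=> lf lg; rewrite -(@ler_pXn2r _ 2) ?nnegrE ?addr_ge0//.
rewrite nrm_sq nrm2D// sqrrD !nrm_sq lerD2r lerD2l -[leRHS]mulr_natl ler_pM2l ?ltr0n//.
by rewrite (le_trans (Re_le_cnorm _))// CS.
Qed.

Lemma nrmN f : nrm D (\- f) = nrm D f.
Proof. by rewrite /nrm nrm2N. Qed.

Lemma nrmBC f g : nrm D (f \- g) = nrm D (g \- f).
Proof. by rewrite -nrmN; congr nrm; apply/funext => x /=; rewrite opprB. Qed.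

Lemma nrm_triangleB f g h : L2on D f -> L2on D g -> L2on D h ->
  nrm D (f \- h) <= nrm D (f \- g) + nrm D (g \- h).
Proof.
move=> lf lg lh; have := nrm_triangle (L2onB lf lg) (L2onB lg lh).
by apply: le_trans; rewrite le_eqVlt; apply/orP/or_introl/eqP; congr nrm; apply/funext => x /=; rewrite addrA subrK.
Qed.

Lemma nrm_le_add f g : L2on D f -> L2on D g -> nrm D f <= nrm D g + nrm D (f \- g).
Proof.
move=> lf lg; have := nrm_triangle lg (L2onB lf lg).
apply: le_trans; rewrite le_eqVlt; apply/orP/or_introl/eqP; congr nrm; apply/funext => x /=.
by rewrite addrC subrK.
Qed.

Lemma nrmZ c f : L2on D f -> nrm D (fun x => c * f x) = cnorm c * nrm D f.
Proof. by move=> lf; rewrite /nrm nrm2Z// sqrtrM// -cnormE. Qed.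

Lemma ae_eq_nrm2 f g : cmeas D f -> cmeas D g ->
  {ae mu, forall x, D x -> f x = g x} -> nrm2 D f = nrm2 D g.
Proof.
move=> mf mg fg; apply: ae_eq_Rint; try exact: cmeas_nsq.
by apply: ae_mono fg => x /[apply] ->.
Qed.

Lemma ae_L2on f g : cmeas D g -> {ae mu, forall x, D x -> f x = g x} ->
  L2on D f -> L2on D g.
Proof.
move=> mg fg [mf nf]; split => //; apply: ae_rint nf; first exact: cmeas_nsq.
by apply: ae_mono fg => x /[apply] ->.
Qed.

Lemma nrm2_eq0_ae f : L2on D f -> nrm2 D f = 0 -> {ae mu, forall x, D x -> f x = 0}.
Proof.
move=> [mf nf] n0.
have : ae_eq mu D (fun x => (nsq (f x))%:E) (cst 0%E).
  apply/(@ae_eq_integral_abs _ _ _ mu D mD) => //.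
    by apply/measurable_EFinP; exact: cmeas_nsq.
  under eq_integral do rewrite gee0_abs ?lee_fin//.
  rewrite -(fineK (integrable_fin_num (mu := mu) mD nf)).
  by move: n0; rewrite /nrm2 /Rintegral /= => ->.
by apply: ae_mono => x /[apply] [[]] /nsq_eq0.
Qed.

Lemma ae0_nrm2 f : cmeas D f -> {ae mu, forall x, D x -> f x = 0} -> nrm2 D f = 0.
Proof.
move=> mf f0; have z0 : cmeas D (fun=> 0 : C) by split; apply: measurable_cst.
by rewrite (ae_eq_nrm2 mf z0 f0) /nrm2 nsq0 Rintegral_cst// mul0r.
Qed.

Lemma restrict_normE f x :
  (`|(EFin \o (fun x => cnorm (f x)) \_ D) x| `^ 2 = ((EFin \o (fun x => nsq (f x))) \_ D) x)%E.
Proof.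
rewrite /patch /=; case: ifPn => _; rewrite ger0_norm ?cnorm_ge0// ?poweR_EFin.
  by rewrite powR_mulrn ?cnorm_ge0// cnorm_sq.
by rewrite powR0.
Qed.

Lemma Lnorm2_sq f :
  (('N[mu]_2%:E[EFin \o (fun x => cnorm (f x)) \_ D]) `^ 2 = \int[mu]_(x in D) (nsq (f x))%:E)%E.
Proof.
rewrite powR_Lnorm//; under eq_integral do rewrite restrict_normE.
by rewrite [RHS]integral_mkcond.
Qed.

Lemma Lnorm2E f :
  ('N[mu]_2%:E[EFin \o (fun x => cnorm (f x)) \_ D] = (\int[mu]_(x in D) (nsq (f x))%:E) `^ 2^-1)%E.
Proof.
rewrite unlock; under eq_integral do rewrite restrict_normE.
by rewrite [in RHS]integral_mkcond.
Qed.

Lemma Lp2P f : Lp D 2%:E f <-> L2on D f.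
Proof.
have aE x : (`|(EFin \o (fun x => nsq (f x))) x| = (nsq (f x))%:E)%E.
  by rewrite gee0_abs// lee_fin.
split => [[m1 m2 fn]|[[m1 m2] nf]].
  split => //; apply/integrableP; split; first by apply/measurable_EFinP; exact: cmeas_nsq.
  under eq_integral do rewrite aE.
  by rewrite -Lnorm2_sq poweR_lty.
split => //; rewrite /finite_norm Lnorm2E poweR_lty//.
by move/integrableP: nf => [_]; under eq_integral do rewrite aE.
Qed.

Lemma cintble_normP f : cintble D f <->
  cmeas D f /\ rint D (fun x => cnorm (f x)).
Proof.
have leR (z : C) : `|Re z| <= cnorm z.
  by rewrite cnormE -sqrtr_sqr ler_sqrt ?nsq_ge0// lerDl sqr_ge0.
have leI (z : C) : `|Im z| <= cnorm z.
  by rewrite cnormE -sqrtr_sqr ler_sqrt ?nsq_ge0// lerDr sqr_ge0.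
split => [[f1 f2]|[[m1 m2] nf]]; last by split; apply: (rint_le _ _ nf).
have mf : cmeas D f by exact: cintble_meas.
split => //.
apply: (rint_le _ _ (rintD (integrable_norm f1) (integrable_norm f2))) => /=.
  exact: cmeas_cnorm.
move=> x _; rewrite ger0_norm ?cnorm_ge0// -(@ler_pXn2r _ 2) ?nnegrE ?cnorm_ge0 ?addr_ge0//.
rewrite cnorm_sq sqrrD !real_normK ?num_real// lerD2r lerDl.
by rewrite mulrn_wge0// mulr_ge0.
Qed.

End OnD.

Lemma L2P f : L2 f <-> L2on setT f.
Proof. exact: Lp2P. Qed.

Lemma L1P f : L1 f <-> cintble setT f.
Proof.
have E : EFin \o (fun x => cnorm (f x)) \_ setT = EFin \o (fun x => cnorm (f x)).
  by apply/funext => x; rewrite /= patch_setT.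
have aE x : (`|(EFin \o (fun x => cnorm (f x))) x| = (EFin \o (fun x => cnorm (f x))) x)%E.
  by rewrite gee0_abs// lee_fin cnorm_ge0.
rewrite /L1 /Lp /finite_norm Lnorm1 E cintble_normP//.
under eq_integral do rewrite aE.
split => [[m1 m2 fn]|[[m1 m2] /integrableP[_ nf]]].
  split => //; apply/integrableP; split; last by under eq_integral do rewrite aE.
  by apply/measurable_EFinP; exact: cmeas_cnorm.
split => //; apply: le_lt_trans nf; rewrite le_eqVlt; apply/orP; left; apply/eqP.
by apply: eq_integral => x _; rewrite aE.
Qed.

Lemma norm2E f : L2on setT f -> norm2 f = (nrm setT f)%:E.
Proof.
move=> [mf nf]; have mT : measurable [set: R] by [].
have := Lnorm2E setT f; rewrite patch_setT /norm2 => ->.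
rewrite -(fineK (integrable_fin_num (mu := mu) mT nf)) poweR_EFin powR12_sqrt//.
by rewrite fine_ge0// integral_ge0// => x _; rewrite lee_fin.
Qed.

Lemma innerE f g : inner f g = ip setT f g.
Proof. by rewrite /inner /ip; apply: eq_cint => x _; rewrite -cjE. Qed.

End ComplexIntegral.

#[global] Hint Extern 0 (is_true (0 <= nsq _)) => solve [apply: nsq_ge0] : core.
#[global] Hint Extern 0 (is_true (0 <= nrm _ _)) => solve [apply: nrm_ge0] : core.
#[global] Hint Extern 0 (is_true (0 <= nrm2 _ _)) => solve [apply: nrm2_ge0] : core.
#[global] Hint Extern 0 (is_true (0 <= cnorm _)) => solve [apply: cnorm_ge0] : core.

(** * Completeness of L^2 *)

Section Completeness.
Context {R : realType}.
Local Notation C := (R[i]).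
Local Notation mu := (@lebesgue_measure R).
Implicit Types (f g h : R -> C) (D : set R) (u : nat -> R -> C).

(** Meaningful only for functions known to be in [L2on]: the real-valued [nrm] sends an infinite
    integral to 0. *)
Definition cvgL2 D u f := forall e : R, 0 < e ->
  exists N, forall n, (N <= n)%N -> nrm D (u n \- f) <= e.

Definition cauchyL2 D u := forall e : R, 0 < e ->
  exists N, forall n m, (N <= n)%N -> (N <= m)%N -> nrm D (u n \- u m) <= e.

Definition ccvg (z : nat -> C) (l : C) :=
  (fun n => Re (z n)) @ \oo --> Re l /\ (fun n => Im (z n)) @ \oo --> Im l.

Section OnD.
Variable D : set R.
Hypothesis mD : measurable D.

Lemma nrm2_le_ereal f M : cmeas D f ->
  (\int[mu]_(x in D) (nsq (f x))%:E <= M%:E)%E -> L2on D f /\ nrm2 D f <= M.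
Proof.
move=> mf fM; have iF : rint D (fun x => nsq (f x)).
  apply/integrableP; split; first by apply/measurable_EFinP; exact: cmeas_nsq.
  apply: le_lt_trans (ltry M); apply: le_trans fM; rewrite le_eqVlt.
  apply/orP; left; apply/eqP; apply: eq_integral => x _.
  by rewrite [LHS]gee0_abs// lee_fin nsq_ge0.
split => //; rewrite /nrm2 /Rintegral -lee_fin fineK//.
exact: (integrable_fin_num (mu := mu) mD iF).
Qed.

Lemma nrm2_EFin f : L2on D f -> (\int[mu]_(x in D) (nsq (f x))%:E = (nrm2 D f)%:E)%E.
Proof.
by move=> [_ nf]; rewrite /nrm2 /Rintegral fineK//; exact: (integrable_fin_num (mu := mu) mD nf).
Qed.

Lemma L2_fatou u f M : (forall n, L2on D (u n)) -> cmeas D f ->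
  {ae mu, forall x, D x -> ccvg (fun n => u n x) (f x)} ->
  (forall n, nrm2 D (u n) <= M) -> L2on D f /\ nrm2 D f <= M.
Proof.
move=> Lu mf uf uM; apply: nrm2_le_ereal => //.
have mnsq n : measurable_fun D (fun x => (nsq (u n x))%:E).
  by apply/measurable_EFinP; apply: cmeas_nsq => //; exact: L2on_meas.
have := @fatou _ _ _ mu D mD (fun n x => (nsq (u n x))%:E) mnsq
  (fun n x _ => nsq_ge0 (u n x)).
rewrite (@ae_eq_integral _ _ _ mu D (fun x => (nsq (f x))%:E))//; last 3 first.
- have -> : (fun x => limn_einf (fun n => (nsq (u n x))%:E)) =
      (fun x => - limn_esup (fun n => - (nsq (u n x))%:E))%E.
    apply/funext => x; rewrite -limn_einfN; congr limn_einf.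
    by apply/funext => n; rewrite /comp oppeK.
  apply: measurableT_comp => //; apply: measurable_fun_limn_esup => n.
  suff h : measurable_fun D (fun x => (- nsq (u n x))%:E) by exact: h.
  by apply/measurable_EFinP; apply: measurable_funN; apply: cmeas_nsq => //; exact: L2on_meas.
- by apply/measurable_EFinP; exact: cmeas_nsq.
- apply: ae_mono uf => x /[apply] -[c1 c2].
  suff c : (fun n => (nsq (u n x))%:E) @ \oo --> (nsq (f x))%:E.
    by rewrite (cvg_limn_einf_sup c).
  apply: cvg_EFin; first by near=> n.
  by apply: cvgD; apply: cvgM.
move=> /le_trans; apply; rewrite limn_einf_lim.
apply: lime_le; first exact: is_cvg_einfs.
near=> n; apply: (@le_trans _ _ (\int[mu]_(x in D) (nsq (u n x))%:E)%E).
  by apply: ereal_inf_lbound; exists n => /=.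
by rewrite nrm2_EFin// lee_fin.
Unshelve. all: end_near.
Qed.

(** Fatou's lemma, applied in m to u n - u (m + N), carries the Cauchy bound over to u n - f; in
    particular u N - f, and with it f, is in L^2. *)
Lemma L2_cauchy_ae u f : (forall n, L2on D (u n)) -> cmeas D f ->
  {ae mu, forall x, D x -> ccvg (fun n => u n x) (f x)} ->
  cauchyL2 D u -> L2on D f /\ cvgL2 D u f.
Proof.
move=> Lu mf uf cu.
have key e : 0 < e -> exists N, forall n, (N <= n)%N -> L2on D (u n \- f) /\ nrm D (u n \- f) <= e.
  move=> e0; have [N HN] := cu _ e0; exists N => n Nn.
  have [||||L le] := @L2_fatou (fun m => u n \- u (m + N)%N) (u n \- f) (e ^+ 2).
  - by move=> m; exact: L2onB.
  - by apply: cmeasB => //; exact: L2on_meas.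
  - apply: ae_mono uf => x /[apply] -[c1 c2]; split => /=.
    + under eq_fun do rewrite ReD ReN; rewrite ReD ReN.
      by apply: cvgB; [exact: cvg_cst|rewrite (cvg_shiftn N (fun n => Re (u n x)))].
    + under eq_fun do rewrite ImD ImN; rewrite ImD ImN.
      by apply: cvgB; [exact: cvg_cst|rewrite (cvg_shiftn N (fun n => Im (u n x)))].
  - move=> m; rewrite -nrm_sq// ler_pXn2r ?nnegrE ?nrm_ge0 ?(ltW e0)//.
    by apply: HN => //; rewrite leq_addl.
  by split => //; rewrite -(@ler_pXn2r _ 2) ?nnegrE ?nrm_ge0 ?(ltW e0)// nrm_sq.
split; last by move=> e /key [N HN]; exists N => n /HN [].
have [N HN] := key 1 ltr01; have [L _] := HN N (leqnn N).
rewrite (_ : f = u N \- (u N \- f)); first exact: L2onB.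
by apply/funext => x /=; rewrite opprB addrC subrK.
Qed.

Lemma cvg_geo_increments (a : nat -> R) (S : R) :
  (forall n, `|a n.+1 - a n| <= S * 2^-1 ^+ n) -> cvg (a @ \oo).
Proof.
move=> H.
have cs : cvg (series (fun n => a n.+1 - a n) @ \oo).
  apply: normed_cvg; apply: (@series_le_cvg _ _ (geometric S 2^-1)) => //.
  - by move=> n /=.
  - move=> n; rewrite /geometric /=; apply: mulr_ge0; last by rewrite exprn_ge0// invr_ge0.
    by have := H 0%N; rewrite expr0 mulr1; apply: le_trans.
  - apply: is_cvg_geometric_series; rewrite ger0_norm; lra.
have -> : a = (fun n => a 0%N + series (fun n => a n.+1 - a n) n).
  apply/funext => n; rewrite /series /= telescope_sumr//.
  by rewrite addrC subrK.
by apply: is_cvgD => //; exact: is_cvg_cst.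
Qed.

(** The core of Riesz-Fischer: a weighted sum of the squared increments has a finite integral, so it
    is finite almost everywhere, and there the increments decay geometrically. *)
Lemma fast_L2_ae u : (forall n, L2on D (u n)) ->
  (forall n, nrm D (u n.+1 \- u n) <= 3^-1 ^+ n) ->
  exists f, cmeas D f /\ {ae mu, forall x, D x -> ccvg (fun n => u n x) (f x)}.
Proof.
move=> Lu fu.
(* The weight 4^n is strictly between 1 and 9: the integrals are dominated by (4/9)^n, while a
   finite sum S x still forces |u (n+1) x - u n x| <= sqrt (S x) / 2^n. *)
pose d n x := (4 ^+ n * nsq (u n.+1 x - u n x))%:E.
pose S x := (\sum_(0 <= n <oo) d n x)%E.
have md n : measurable_fun D (d n).
  apply/measurable_EFinP; apply: measurable_funM => //.
  by apply: cmeas_nsq => //; apply: cmeasB; exact: L2on_meas.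
have d0 n x : (0 <= d n x)%E by rewrite /d lee_fin mulr_ge0 ?nsq_ge0// exprn_ge0.
have mS : measurable_fun D S.
  by apply: ge0_emeasurable_sum => // n _.
have S0 x : (0 <= S x)%E by apply: nneseries_ge0.
have intS : (\int[mu]_(x in D) S x < +oo)%E.
  rewrite integral_nneseries//.
  apply: (@le_lt_trans _ _ (\sum_(0 <= n <oo) ((4 / 9) ^+ n)%:E)%E).
    apply: lee_nneseries => [n _ _|n _]; first by apply: integral_ge0 => x _; exact: d0.
    rewrite /d; under eq_integral do rewrite EFinM.
    rewrite ge0_integralZl//; last 2 first.
    - by apply/measurable_EFinP; apply: cmeas_nsq => //; apply: cmeasB; exact: L2on_meas.
    - by move=> x _; rewrite lee_fin nsq_ge0.
    rewrite (nrm2_EFin (L2onB mD (Lu n.+1) (Lu n))) -EFinM lee_fin.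
    rewrite expr_div_n ler_pM2l ?exprn_gt0//.
    rewrite -nrm_sq// -[leRHS]invrK -exprVn invrK.
    have -> : (9^-1 : R) = 3^-1 ^+ 2 by field.
    by rewrite exprAC ler_pXn2r ?nnegrE ?exprn_ge0.
  apply: (le_lt_trans _ (ltry 2)); apply: lime_le.
    by apply: is_cvg_nneseries => n _ _; rewrite lee_fin exprn_ge0// divr_ge0.
  near=> n; rewrite sumEFin lee_fin.
  have -> : \sum_(0 <= i < n) (4 / 9) ^+ i = (1 - (4 / 9) ^+ n) * (9 / 5) :> R.
    elim: (n) => [|m IH]; first by rewrite big_geq// expr0 subrr mul0r.
    by rewrite big_nat_recr//= IH exprS; field.
  have : 0 <= (4 / 9) ^+ n :> R by rewrite exprn_ge0// divr_ge0.
  lra.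
have aeS : {ae mu, forall x, D x -> (S x \is a fin_num)}.
  apply: integrable_ae => //; apply/integrableP; split => //.
  apply: le_lt_trans intS; rewrite le_eqVlt; apply/orP; left; apply/eqP.
  by apply: eq_integral => x _; rewrite gee0_abs.
pose G := D `&` [set x | S x \is a fin_num].
have mG : measurable G by exact: emeasurable_fin_num.
have inc x : G x -> exists T : R, forall n, nsq (u n.+1 x - u n x) <= (T * 2^-1 ^+ n) ^+ 2.
  move=> [Dx Sx]; exists (Num.sqrt (fine (S x))) => n.
  rewrite exprMn sqr_sqrtr ?fine_ge0// exprAC.
  have : (d n x <= S x)%E.
    apply: (@le_trans _ _ (\sum_(0 <= i < n.+1) d i x)%E); last exact: nneseries_lim_ge.
    by rewrite big_nat_recr//= leeDr// sume_ge0.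
  rewrite -(fineK Sx) lee_fin => le.
  have -> : (2^-1 ^+ 2 : R) = 4^-1 by field.
  by rewrite exprVn ler_pdivlMr ?exprn_gt0// mulrC.
have cG x : G x -> cvg ((fun n => Re (u n x)) @ \oo) /\ cvg ((fun n => Im (u n x)) @ \oo).
  move=> /inc [T HT].
  have HT' n : nsq (u n.+1 x - u n x) <= (`|T| * 2^-1 ^+ n) ^+ 2.
    by rewrite exprMn real_normK ?num_real// -exprMn.
  split; apply: (@cvg_geo_increments _ `|T|) => n;
    rewrite -?ReN -?ReD -?ImN -?ImD -(@ler_pXn2r _ 2) ?nnegrE ?mulr_ge0 ?exprn_ge0 ?invr_ge0//;
    by apply: le_trans (HT' n); rewrite real_normK ?num_real// ?lerDl ?lerDr sqr_ge0.
(* Setting f to 0 off G makes it the limit of u n times the indicator of G at every point of D,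
   hence measurable. *)
pose f x : C := if x \in G then lim ((fun n => Re (u n x)) @ \oo) +i* lim ((fun n => Im (u n x)) @ \oo) else 0.
exists f; split.
  split.
  - apply: (@measurable_fun_cvg _ _ _ D (fun n x => Re (u n x) * \1_G x)).
    + move=> n; apply: measurable_funM; first by have [[]] := Lu n.
      exact: measurable_indic.
    + move=> x Dx; rewrite /f indicE; case: ifPn => xG /=.
        by under eq_fun do rewrite mulr1; exact: (proj1 (cG _ (set_mem xG))).
      by under eq_fun do rewrite mulr0; exact: cvg_cst.
  - apply: (@measurable_fun_cvg _ _ _ D (fun n x => Im (u n x) * \1_G x)).
    + move=> n; apply: measurable_funM; first by have [[]] := Lu n.
      exact: measurable_indic.
    + move=> x Dx; rewrite /f indicE; case: ifPn => xG /=.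
        by under eq_fun do rewrite mulr1; exact: (proj2 (cG _ (set_mem xG))).
      by under eq_fun do rewrite mulr0; exact: cvg_cst.
apply: ae_mono aeS => x Sx Dx.
have Gx : G x by split => //; exact: Sx.
by rewrite /f mem_set//; have [c1 c2] := cG _ Gx; split.
Unshelve. all: end_near.
Qed.

Lemma L2_complete u : (forall n, L2on D (u n)) -> cauchyL2 D u ->
  exists f, L2on D f /\ cvgL2 D u f.
Proof.
move=> Lu cu.
have e3 k : 0 < 3^-1 ^+ k :> R by rewrite exprn_gt0// invr_gt0.
have [N HN] := choice (fun k => cu _ (e3 k)).
(* Partial sums turn the thresholds N k into nondecreasing indices that still dominate them. *)
pose s k := (\sum_(j < k.+1) N j)%N.
have sN k : (N k <= s k)%N by rewrite /s big_ord_recr/= leq_addl.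
have sS k : (s k <= s k.+1)%N by rewrite /s [leqRHS]big_ord_recr/= leq_addr.
have smono j k : (j <= k)%N -> (s j <= s k)%N.
  elim: k => [|k IH]; first by rewrite leqn0 => /eqP->.
  rewrite leq_eqVlt => /orP[/eqP->//|jk].
  exact: leq_trans (IH jk) (sS k).
have [f [mf uf]] : exists f, cmeas D f /\
    {ae mu, forall x, D x -> ccvg (fun n => u (s n) x) (f x)}.
  apply: fast_L2_ae => // k; apply: HN => //.
  exact: leq_trans (sN k) (sS k).
have small (e : R) : 0 < e -> exists k, 3^-1 ^+ k <= e.
  move=> e0; have : (fun n => 3^-1 ^+ n : R) @ \oo --> (0 : R).
    by apply: cvg_expr; rewrite ger0_norm; lra.
  move/cvgr0_norm_le => /(_ _ e0) [k _ /(_ k (leqnn k))].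
  by rewrite ger0_norm ?(ltW (e3 k))//; exists k.
have cus : cauchyL2 D (fun n => u (s n)).
  move=> e /small [k ke]; exists k => n m kn km.
  apply: le_trans ke; apply: HN; apply: leq_trans (sN k) _; exact: smono.
have [Lf cf] := @L2_cauchy_ae (fun n => u (s n)) f (fun n => Lu _) mf uf cus.
exists f; split => // e e0; have e20 : 0 < e / 2 by rewrite divr_gt0.
have [M HM] := cf _ e20; have [k ke] := small _ e20.
exists (s k) => n sn; pose j := maxn M k.
apply: le_trans (nrm_triangleB mD (Lu n) (Lu (s j)) Lf) _.
rewrite [leRHS](splitr e); apply: lerD; last by apply: HM; rewrite leq_maxl.
apply: le_trans ke; apply: HN; first exact: leq_trans (sN k) sn.
by apply: leq_trans (sN k) _; apply: smono; rewrite leq_maxr.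
Qed.

End OnD.
End Completeness.

(** * Trigonometric polynomials on the unit interval *)

Definition D01 {R : realType} : set R := `[0, 1[%classic.

Section TrigPoly.
Context {R : realType}.
Local Notation C := (R[i]).
Local Notation mu := (@lebesgue_measure R).
Local Notation D := (@D01 R).
Implicit Types (f g h p q : R -> C).

Lemma mD01 : measurable D.
Proof. exact: measurable_itv. Qed.
Hint Extern 0 (measurable D01) => solve [apply: mD01] : core.

Lemma muD01 : mu D = 1%E.
Proof. by rewrite /D01 lebesgue_measure_itv/= lte_fin ltr01 oppr0 adde0. Qed.

Lemma expiD (a b : R) : expi (a + b) = expi a * expi b.
Proof. by apply: complex_eq; rewrite /= ?cosD ?sinD; ring. Qed.

Lemma expi0 : expi 0 = 1 :> C.
Proof. by rewrite /expi cos0 sin0. Qed.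

Lemma cj_expi (a : R) : cj (expi a) = expi (- a).
Proof. by rewrite /cj /expi /= cosN sinN. Qed.

Lemma nsq_expi (a : R) : nsq (expi a) = 1.
Proof. by rewrite /nsq /= cos2Dsin2. Qed.

Lemma expi_2pi_nat (n : nat) : expi (2 * pi * n%:R) = 1 :> C.
Proof.
elim: n => [|n IH]; first by rewrite mulr0 expi0.
rewrite -(natr1 n) mulrDr mulr1 expiD IH mul1r.
by rewrite /expi mulr_natl cos2pi sin2pi.
Qed.

Lemma expi_2pi (n : int) : expi (2 * pi * n%:~R) = 1 :> C.
Proof.
case: n => n; first exact: expi_2pi_nat.
rewrite NegzE mulrNz mulrN -cj_expi expi_2pi_nat.
by apply: complex_eq; rewrite !ReImE //= oppr0.
Qed.

(** The sign is that of translation on the Fourier side: the transform of T_k f is E k times that of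
    f. *)
Definition E (k : int) (x : R) : C := expi (- (2 * pi * k%:~R * x)).

Lemma ED k j x : E (k + j) x = E k x * E j x.
Proof. by rewrite /E -expiD intrD; congr expi; ring. Qed.

Lemma E0 x : E 0 x = 1.
Proof. by rewrite /E mulr0 mul0r oppr0 expi0. Qed.

Lemma cjE_ k x : cj (E k x) = E (- k) x.
Proof. by rewrite /E cj_expi mulrNz; congr expi; ring. Qed.

Lemma nsqE k x : nsq (E k x) = 1.
Proof. exact: nsq_expi. Qed.

Lemma E_per k (n : int) x : E k (x + n%:~R) = E k x.
Proof.
rewrite /E mulrDr opprD expiD -[RHS]mulr1; congr (_ * _).
by rewrite -mulrA -intrM -mulrN -mulrNz expi_2pi.
Qed.

Lemma cmeasE (A : set R) k : cmeas A (E k).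
Proof.
have m : measurable_fun setT (fun x : R => - (2 * pi * k%:~R * x)).
  by apply: measurable_funN; exact: measurable_funM.
have [mc ms] : measurable_fun setT (@cos R) /\ measurable_fun setT (@sin R).
  split; apply: continuous_measurable_fun; [exact: continuous_cos|exact: continuous_sin].
split; apply: (measurable_funS (E := setT)) => //.
- exact: (measurableT_comp mc m).
- exact: (measurableT_comp ms m).
Qed.

(** Inductive, so that closure properties go by induction. The explicit form [tp] may repeat
    frequencies; [trig_uniq] merges them before coefficients are read off. *)
Inductive trig : (R -> C) -> Prop :=
| trig0 : trig (fun=> 0)
| trigS c k p : trig p -> trig (fun x => c * E k x + p x).

Definition tp (s : seq int) (c : int -> C) (x : R) : C := \sum_(k <- s) c k * E k x.

Lemma trig_tp s c : trig (tp s c).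
Proof.
elim: s => [|k s IH].
  by rewrite (_ : tp _ _ = fun=> 0); [exact: trig0|apply/funext => x; rewrite /tp big_nil].
rewrite (_ : tp _ _ = fun x => c k * E k x + tp s c x); first exact: trigS.
by apply/funext => x; rewrite /tp big_cons.
Qed.

Lemma trig_uniq p : trig p -> exists s c, uniq s /\ p = tp s c.
Proof.
elim => [|c k q _ [s [d [us ->]]]].
  by exists [::], (fun=> 0); split => //; apply/funext => x; rewrite /tp big_nil.
have [ks|ks] := boolP (k \in s).
  exists s, (fun j => if j == k then c + d j else d j); split => //.
  apply/funext => x; rewrite /tp !(bigD1_seq k)//= eqxx mulrDl addrA; congr (_ + _).
  by apply: eq_bigr => j /negbTE ->.
exists (k :: s), (fun j => if j == k then c else d j); split; first by rewrite /= ks.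
apply/funext => x; rewrite /tp big_cons eqxx; congr (_ + _).
rewrite big_seq [RHS]big_seq; apply: eq_bigr => j js.
by case: eqP => // jk; move: ks; rewrite -jk js.
Qed.

Lemma trigD p q : trig p -> trig q -> trig (fun x => p x + q x).
Proof.
move=> tp_ tq; elim: tp_ => [|c k p' _ IH].
  by under eq_fun do rewrite add0r.
by under eq_fun do rewrite -addrA; exact: trigS.
Qed.

Lemma trigM p q : trig p -> trig q -> trig (fun x => p x * q x).
Proof.
move=> tp_ tq.
have mono c k r : trig r -> trig (fun x => c * E k x * r x).
  elim => [|d j r' _ IH]; first by under eq_fun do rewrite mulr0; exact: trig0.
  rewrite (_ : (fun x => _) = fun x => (c * d) * E (k + j) x + c * E k x * r' x); first exact: trigS.
  by apply/funext => x; rewrite ED; ring.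
elim: tp_ => [|c k p' _ IH]; first by under eq_fun do rewrite mul0r; exact: trig0.
under eq_fun do rewrite mulrDl.
by apply: trigD => //; exact: mono.
Qed.

Lemma trigE k : trig (E k).
Proof.
rewrite (_ : E k = fun x => 1 * E k x + 0); first exact: trigS trig0.
by apply/funext => x; rewrite mul1r addr0.
Qed.

Lemma trig_cst c : trig (fun=> c).
Proof.
rewrite (_ : (fun=> c) = fun x => c * E 0 x + 0); first exact: trigS trig0.
by apply/funext => x; rewrite E0 mulr1 addr0.
Qed.

Lemma trigZ c p : trig p -> trig (fun x => c * p x).
Proof. exact: (trigM (trig_cst c)). Qed.

Lemma trigB p q : trig p -> trig q -> trig (p \- q).
Proof.
move=> tp_ tq; rewrite (_ : p \- q = fun x => p x + (-1) * q x).
  by apply: trigD => //; exact: trigZ.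
by apply/funext => x; rewrite mulN1r.
Qed.

Lemma trigX p n : trig p -> trig (fun x => p x ^+ n).
Proof.
move=> tp_; elim: n => [|n IH]; first by under eq_fun do rewrite expr0; exact: trig_cst.
by under eq_fun do rewrite exprS; exact: trigM.
Qed.

Lemma trig_meas (A : set R) p : measurable A -> trig p -> cmeas A p.
Proof.
move=> mA; elim => [|c k q _ IH]; first exact: cmeas_cst.
apply: cmeasD => //; apply: cmeasM => //; last exact: cmeasE.
Qed.

Lemma trig_bounded p : trig p -> exists2 M, 0 <= M & forall x, nsq (p x) <= M.
Proof.
elim => [|c k q _ [M M0 IH]]; first by exists 0 => // x; rewrite nsq0.
exists (2 * nsq c + 2 * M); first by rewrite addr_ge0// mulr_ge0.
move=> x; apply: le_trans (nsqD_le _ _) _.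
by rewrite nsqM nsqE mulr1 lerD2l ler_pM2l.
Qed.

Lemma L2on_bounded f (M : R) : cmeas D f -> (forall x, D x -> nsq (f x) <= M) -> L2on D f.
Proof.
move=> mf fM; split => //.
apply: (rint_le mD01 (v := cst M)).
- by apply: cmeas_nsq => //; exact: mD01.
- by move=> x Dx; rewrite ger0_norm// fM.
- apply: measurable_bounded_integrable.
  + exact: mD01.
  + by rewrite /= muD01 ltry.
  + exact: measurable_cst.
  + exact: bounded_cst.
Qed.

Lemma trig_L2 p : trig p -> L2on D p.
Proof.
move=> tp_; have [M _ pM] := trig_bounded tp_.
by apply: (@L2on_bounded _ M) => //; apply: trig_meas tp_; exact: mD01.
Qed.

Lemma E_L2 k : L2on D (E k). Proof. exact/trig_L2/trigE. Qed.

Lemma nrm2_mono f g : cmeas D f -> L2on D g ->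
  {ae mu, forall x, D x -> nsq (f x) <= nsq (g x)} -> L2on D f /\ nrm2 D f <= nrm2 D g.
Proof.
move=> mf Lg H; have [mg ig] := Lg.
apply: nrm2_le_ereal => //; rewrite -nrm2_EFin//.
apply: ae_ge0_le_integral => //.
- by move=> x _; rewrite lee_fin.
- by apply/measurable_EFinP; exact: cmeas_nsq.
- by move=> x _; rewrite lee_fin.
- by apply/measurable_EFinP; exact: cmeas_nsq.
Qed.

Lemma nrm_mono f g : cmeas D f -> L2on D g ->
  {ae mu, forall x, D x -> nsq (f x) <= nsq (g x)} -> nrm D f <= nrm D g.
Proof. by move=> mf Lg H; apply: ler_wsqrtr; exact: (nrm2_mono mf Lg H).2. Qed.

Lemma L2onM_ae v f (M : R) : 0 <= M -> cmeas D v ->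
  {ae mu, forall x, D x -> nsq (v x) <= M} -> L2on D f ->
  L2on D (fun x => v x * f x) /\ nrm D (fun x => v x * f x) <= Num.sqrt M * nrm D f.
Proof.
move=> M0 mv H Lf.
have Lg : L2on D (fun x => (Num.sqrt M)%:C * f x) by exact: L2onZ.
have mf := L2on_meas Lf.
have mvf : cmeas D (fun x => v x * f x) by exact: cmeasM.
have ae : {ae mu, forall x, D x -> nsq (v x * f x) <= nsq ((Num.sqrt M)%:C * f x)}.
  by apply: ae_mono H => x H Dx; rewrite !nsqM nsqR sqr_sqrtr// ler_wpM2r// H.
have [L1 L2_] := nrm2_mono mvf Lg ae; split => //.
have := ler_wsqrtr L2_; rewrite -/(nrm D _) -/(nrm D _) nrmZ//.
by rewrite cnormE nsqR sqr_sqrtr.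
Qed.

Lemma nrm2M_le f g (M : R) : 0 <= M -> L2on D f -> cmeas D g ->
  {ae mu, forall x, D x -> nsq (g x) <= M} ->
  nrm2 D (fun x => g x * f x) <= M * nrm2 D f.
Proof.
move=> M0 Lf mg gM; have [_ h] := L2onM_ae M0 mg gM Lf.
rewrite -!nrm_sq; apply: (@le_trans _ _ ((Num.sqrt M * nrm D f) ^+ 2)).
  by rewrite lerXn2r ?nnegrE ?mulr_ge0 ?sqrtr_ge0.
by rewrite exprMn sqr_sqrtr.
Qed.

Lemma int01_FTC (f F : R -> R) : continuous f -> continuous F ->
  (forall x, derivable F x 1 /\ derive1 F x = f x) ->
  \int[mu]_(x in D) f x = F 1 - F 0.
Proof.
move=> cf cF dF; rewrite Rintegral_itv_bndo_bndc.
  rewrite /Rintegral (@continuous_FTC2 _ f F) ?ltr01//.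
  - exact: continuous_subspaceT.
  - split.
    + by move=> x _; have [] := dF x.
    + by apply: cvg_at_right_filter; exact: cF.
    + by apply: cvg_at_left_filter; exact: cF.
  - by move=> x _; have [] := dF x.
apply: (@integrableS _ _ _ mu `[0, 1]%classic) => //.
  by apply: subset_itvl; rewrite bnd_simp.
apply: continuous_compact_integrable; first exact: segment_compact.
exact: continuous_subspaceT.
Qed.

Lemma int_cos (m : int) : m != 0 -> \int[mu]_(x in D) cos (2 * pi * m%:~R * x) = 0.
Proof.
move=> m0; pose w : R := 2 * pi * m%:~R.
have w0 : w != 0 by rewrite /w !mulf_neq0 ?intr_eq0 ?(gt_eqF (pi_gt0 R)) ?pnatr_eq0.
have cw : continuous (fun x : R => w * x) by move=> x; apply: cvgM => //; exact: cvg_cst.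
rewrite (@int01_FTC _ (fun x => w^-1 * sin (w * x))).
- rewrite mulr0 sin0 mulr0 subr0 mulr1.
  have := expi_2pi m; rewrite /expi -/w => -[_ ->]; exact: mulr0.
- by move=> x; apply: (@continuous_comp _ _ _ (fun x => w * x) cos); [exact: cw|exact: continuous_cos].
- move=> x; apply: cvgM; first exact: cvg_cst.
  by apply: (@continuous_comp _ _ _ (fun x => w * x) sin); [exact: cw|exact: continuous_sin].
- move=> x; have h : is_derive x (1 : R) (fun x => w^-1 * sin (w * x)) (cos (w * x)).
    by apply: is_derive_eq; rewrite /GRing.scale/=; field; exact: w0.
  by split; [exact: ex_derive|rewrite derive1E; exact: derive_val].
Qed.

Lemma int_sin (m : int) : m != 0 -> \int[mu]_(x in D) sin (2 * pi * m%:~R * x) = 0.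
Proof.
move=> m0; pose w : R := 2 * pi * m%:~R.
have w0 : w != 0 by rewrite /w !mulf_neq0 ?intr_eq0 ?(gt_eqF (pi_gt0 R)) ?pnatr_eq0.
have cw : continuous (fun x : R => w * x) by move=> x; apply: cvgM => //; exact: cvg_cst.
rewrite (@int01_FTC _ (fun x => - w^-1 * cos (w * x))).
- rewrite mulr0 cos0 mulr1.
  by have := expi_2pi m; rewrite /expi -/w => -[-> _]; rewrite mulr1 subrr.
- by move=> x; apply: (@continuous_comp _ _ _ (fun x => w * x) sin); [exact: cw|exact: continuous_sin].
- move=> x; apply: cvgM; first exact: cvg_cst.
  by apply: (@continuous_comp _ _ _ (fun x => w * x) cos); [exact: cw|exact: continuous_cos].
- move=> x; have h : is_derive x (1 : R) (fun x => - w^-1 * cos (w * x)) (sin (w * x)).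
    by apply: is_derive_eq; rewrite /GRing.scale/=; field; exact: w0.
  by split; [exact: ex_derive|rewrite derive1E; exact: derive_val].
Qed.

Lemma cint_E (k : int) : cint D (E k) = (k == 0)%:R.
Proof.
have [->|k0] := eqVneq k 0.
  rewrite /cint; apply: complex_eq => /=.
  - transitivity (\int[mu]_(x in D) (1 : R)); first by apply: eq_Rintegral; move=> x _; rewrite /= mulr0 mul0r oppr0 cos0.
    by rewrite Rintegral_cst ?mul1r// [X in fine X]muD01.
  - transitivity (\int[mu]_(x in D) (0 : R)); first by apply: eq_Rintegral; move=> x _; rewrite /= mulr0 mul0r oppr0 sin0.
    by rewrite Rintegral_cst ?mul0r.
rewrite /cint; apply: complex_eq => /=.
- by under eq_Rintegral do rewrite cosN; exact: int_cos.
- under eq_Rintegral do rewrite -mulNr -mulrN -mulrNz.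
  by apply: int_sin; rewrite oppr_eq0.
Qed.

Lemma ipE (k j : int) : ip D (E k) (E j) = (k == j)%:R.
Proof.
rewrite /ip; under [X in cint _ X]eq_fun do rewrite cjE_ -ED.
by rewrite cint_E subr_eq0.
Qed.

Definition coef f (k : int) : C := ip D f (E k).

Lemma tpE s c : tp s c = fun x => \sum_(k <- s) c k * E k x. Proof. by []. Qed.

Lemma cE_L2 (c : int -> C) k : L2on D (fun x => c k * E k x).
Proof. by apply: L2onZ; [exact: mD01|exact: E_L2]. Qed.

Lemma ip_tp f s c : L2on D f -> ip D f (tp s c) = \sum_(k <- s) cj (c k) * coef f k.
Proof.
move=> Lf; rewrite tpE ip_sumr//; last exact: cE_L2.
by apply: eq_bigr => k _; rewrite ipZr//; exact: E_L2.
Qed.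

Lemma coef_tp s c j : uniq s -> j \in s -> coef (tp s c) j = c j.
Proof.
move=> us js; rewrite /coef tpE ip_suml; [|by []|exact: E_L2|exact: cE_L2].
rewrite (bigD1_seq j)//= big1 ?addr0 => [|k kj].
  by rewrite ipZl ?ipE ?eqxx ?mulr1//; exact: E_L2.
by rewrite ipZl ?ipE ?(negbTE kj) ?mulr0//; exact: E_L2.
Qed.

Lemma nrm2_tp s c : uniq s -> nrm2 D (tp s c) = \sum_(k <- s) nsq (c k).
Proof.
move=> us; apply: complexI; rewrite -ipff; last exact: mD01.
rewrite ip_tp; last exact/trig_L2/trig_tp.
rewrite big_seq (eq_bigr (fun k => (nsq (c k))%:C)).
  by rewrite -big_seq raddf_sum.
by move=> k ks; rewrite coef_tp// mulrC mulJ_nsq.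
Qed.

(** Completing the square around the Fourier coefficients: the last sum vanishes exactly for c =
    [coef f] on s. This gives Bessel's inequality and best approximation at once. *)
Lemma nrm2_sub_tp f s c : L2on D f -> uniq s ->
  nrm2 D (f \- tp s c) =
  nrm2 D f - \sum_(k <- s) nsq (coef f k) + \sum_(k <- s) nsq (c k - coef f k).
Proof.
move=> Lf us; rewrite (nrm2B mD01)//; last exact/trig_L2/trig_tp.
rewrite nrm2_tp// ip_tp// -!addrA; congr (_ + _).
rewrite addrC -[RHS]addrC.
have ReS (F : int -> C) : Re (\sum_(k <- s) F k) = \sum_(k <- s) Re (F k).
  by elim: (s) => [|a l IH]; rewrite ?big_nil ?big_cons ?ReD ?IH.
rewrite ReS mulr_sumr -!sumrB; apply: eq_bigr => k _.
by rewrite /nsq !ReImE; ring.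
Qed.

Lemma bessel f s : L2on D f -> uniq s -> \sum_(k <- s) nsq (coef f k) <= nrm2 D f.
Proof.
move=> Lf us; have := nrm2_ge0 D (f \- tp s (coef f)).
rewrite nrm2_sub_tp//; under [X in _ + X]eq_bigr do rewrite subrr nsq0.
by rewrite big1_eq addr0 subr_ge0.
Qed.

(** The L^2(D)-closure of the trigonometric polynomials. Density is proved by placing in it, in
    turn, indicators, simple functions, nonnegative, real and complex functions. *)
Definition trig_cl f := L2on D f /\
  forall e : R, 0 < e -> exists2 p, trig p & nrm D (f \- p) <= e.

Lemma trig_cl_trig p : trig p -> trig_cl p.
Proof.
move=> tp_; split; first exact: trig_L2.
move=> e e0; exists p => //.
rewrite /nrm (@ae0_nrm2 _ D) ?sqrtr0 ?(ltW e0)//.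
  by apply: cmeasB => //; apply: trig_meas.
by apply: aeW => x _ /=; rewrite subrr.
Qed.

Lemma trig_cl_lim f : L2on D f ->
  (forall e : R, 0 < e -> exists2 g, trig_cl g & nrm D (f \- g) <= e) -> trig_cl f.
Proof.
move=> Lf H; split => // e e0; have e2 : 0 < e / 2 by rewrite divr_gt0.
have [g [Lg Hg] fg] := H _ e2; have [p tp_ gp] := Hg _ e2.
exists p => //; apply: le_trans (nrm_triangleB mD01 Lf Lg (trig_L2 tp_)) _.
by rewrite [leRHS](splitr e) lerD.
Qed.

Lemma trig_clD f g : trig_cl f -> trig_cl g -> trig_cl (f \+ g).
Proof.
move=> [Lf Hf] [Lg Hg]; split; first exact: L2onD.
move=> e e0; have e2 : 0 < e / 2 by rewrite divr_gt0.
have [p tp_ fp] := Hf _ e2; have [q tq gq] := Hg _ e2.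
exists (fun x => p x + q x); first exact: trigD.
rewrite (_ : _ \- _ = (f \- p) \+ (g \- q)).
  apply: le_trans (nrm_triangle mD01 _ _) _; last by rewrite [leRHS](splitr e) lerD.
  - by apply: L2onB => //; exact: trig_L2.
  - by apply: L2onB => //; exact: trig_L2.
by apply/funext => x /=; rewrite opprD addrACA.
Qed.

Lemma nrmM_le f g (M : R) : 0 <= M -> L2on D f -> cmeas D g ->
  (forall x, D x -> nsq (g x) <= M ^+ 2) ->
  nrm D (fun x => g x * f x) <= M * nrm D f.
Proof.
move=> M0 Lf mg gM.
rewrite -(@ler_pXn2r _ 2) ?nnegrE ?mulr_ge0// exprMn !nrm_sq//.
by apply: nrm2M_le => //; [exact: sqr_ge0|apply: aeW].
Qed.

Lemma trig_clMtrig f q : trig q -> trig_cl f -> trig_cl (fun x => q x * f x).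
Proof.
move=> tq [Lf Hf]; have [M0 M00 qM0] := trig_bounded tq.
have mq : cmeas D q by exact: trig_meas.
pose M := Num.sqrt M0 + 1.
have M1 : 0 < M by rewrite ltr_wpDl// sqrtr_ge0.
have qM x : D x -> nsq (q x) <= M ^+ 2.
  move=> _; apply: le_trans (qM0 x) _; rewrite -{1}(sqr_sqrtr M00).
  by rewrite ler_pXn2r ?nnegrE ?sqrtr_ge0 ?(ltW M1)// lerDl.
split; first exact: (L2onM_bounded mD01 mq qM Lf).
move=> e e0; have [p tp_ fp] := Hf (e / M) (divr_gt0 e0 M1).
exists (fun x => q x * p x); first exact: trigM.
have -> : (fun x => q x * f x) \- (fun x => q x * p x) = (fun x => q x * (f \- p) x).
  by apply/funext => x /=; rewrite mulrBr.
apply: (@le_trans _ _ (M * (e / M))); last by rewrite mulrC divfK ?gt_eqF.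
apply: le_trans (nrmM_le (ltW M1) _ mq qM) _; first by apply: L2onB => //; exact: trig_L2.
by rewrite ler_pM2l.
Qed.

Lemma trig_clZ c f : trig_cl f -> trig_cl (fun x => c * f x).
Proof. exact: (trig_clMtrig (trig_cst c)). Qed.

Lemma trig_clB f g : trig_cl f -> trig_cl g -> trig_cl (f \- g).
Proof.
move=> cf cg; rewrite (_ : f \- g = f \+ (fun x => (-1) * g x)).
  by apply: trig_clD => //; exact: trig_clZ.
by apply/funext => x /=; rewrite mulN1r.
Qed.

Lemma trig_cl_ae f g : cmeas D g -> {ae mu, forall x, D x -> f x = g x} ->
  trig_cl f -> trig_cl g.
Proof.
move=> mg fg [Lf Hf]; have Lg := ae_L2on mD01 mg fg Lf; split => // e e0.
have [p tp_ fp] := Hf _ e0; exists p => //.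
rewrite /nrm -(@ae_eq_nrm2 _ D mD01 (f \- p)) => //.
- by apply: cmeasB => //; [exact: L2on_meas|exact: trig_meas].
- by apply: cmeasB => //; exact: trig_meas.
- by apply: ae_mono fg => x /[apply] /= ->.
Qed.

Definition ind (A : set R) (x : R) : C := (\1_A x : R)%:C.

Lemma cmeas_ind (A B : set R) : measurable A -> cmeas B (ind A).
Proof. by move=> mA; apply: cmeasR; exact: measurable_indic. Qed.

Lemma nsq_ind_le1 A x : nsq (ind A x) <= 1.
Proof. by rewrite /ind nsqR indicE; case: (_ \in _); rewrite ?expr1n// expr0n. Qed.

Lemma ind_L2 A : measurable A -> L2on D (ind A).
Proof.
by move=> mA; apply: (@L2on_bounded _ 1) => [|x _]; [exact: cmeas_ind|exact: nsq_ind_le1].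
Qed.

Lemma L2_dominated (B : set R) (u : nat -> R -> C) f (h : R -> R) : measurable B ->
  (forall n, L2on B (u n)) -> L2on B f ->
  {ae mu, forall x, B x -> ccvg (fun n => u n x) (f x)} -> rint B h ->
  (forall n x, B x -> nsq (u n x - f x) <= h x) -> cvgL2 B u f.
Proof.
move=> mB Lu Lf uf ih uh.
have m n : measurable_fun B (fun x => (nsq (u n x - f x))%:E).
  by apply/measurable_EFinP; apply: cmeas_nsq => //; apply: cmeasB; exact: L2on_meas.
have [|||_ _] := @dominated_convergence _ _ _ mu B mB
    (fun n x => (nsq (u n x - f x))%:E) (cst 0%E) (EFin \o h) m _ _ ih.
- exact: measurable_cst.
- apply: ae_mono uf => x /[apply] -[c1 c2].
  apply: cvg_EFin; first by near=> n.
  have -> : 0 = (Re (f x) - Re (f x)) * (Re (f x) - Re (f x)) + (Im (f x) - Im (f x)) * (Im (f x) - Im (f x)).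
    by rewrite !subrr; ring.
  rewrite /nsq /comp /=; under eq_fun do rewrite !ReImE.
  by apply: cvgD; apply: cvgM; apply: cvgB => //; exact: cvg_cst.
- by apply: aeW => x n Bx; rewrite gee0_abs ?lee_fin// uh.
rewrite integral0 => c e e0.
move/fine_cvgP: c => [_] /cvgr0Pnorm_le /(_ (e ^+ 2)).
rewrite exprn_gt0// => /(_ isT) [N _ HN].
exists N => n Nn; rewrite -(@ler_pXn2r _ 2) ?nnegrE ?(ltW e0)// nrm_sq//.
have := HN n Nn; rewrite /= ger0_norm//.
by apply: Rintegral_ge0.
Unshelve. all: end_near.
Qed.

Lemma trig_cl_cvg (u : nat -> R -> C) f : L2on D f -> (forall n, trig_cl (u n)) ->
  cvgL2 D u f -> trig_cl f.
Proof.
move=> Lf tu uf; apply: trig_cl_lim => // e /uf [N HN].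
by exists (u N) => //; rewrite nrmBC HN.
Qed.

Lemma rint_cst M : rint D (fun=> M).
Proof.
apply: measurable_bounded_integrable => //.
- by rewrite [X in (X < _)%E]muD01 ltry.
- exact: bounded_cst.
Qed.

Lemma trig_cl_bounded_cvg (u : nat -> R -> C) f M : cmeas D f ->
  (forall n, trig_cl (u n)) ->
  {ae mu, forall x, D x -> ccvg (fun n => u n x) (f x)} ->
  (forall n x, D x -> nsq (u n x) <= M) -> (forall x, D x -> nsq (f x) <= M) ->
  trig_cl f.
Proof.
move=> mf tu uf uM fM; have Lf := L2on_bounded mf fM.
apply: (trig_cl_cvg Lf tu).
apply: (@L2_dominated D u f (fun=> 4 * M)) => //; first by move=> n; have [] := tu n.
  exact: rint_cst.
move=> n x Dx; apply: le_trans (nsqD_le _ _) _; rewrite nsqN.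
have := uM n x Dx; have := fM x Dx; lra.
Qed.

(** These sets form a sigma-algebra; as soon as it contains the rays it contains every measurable
    set. *)
Definition indcl : set (set R) := [set A | measurable A /\ trig_cl (ind A)].

Lemma indclC A : indcl A -> indcl (~` A).
Proof.
move=> [mA cA]; split; first exact: measurableC.
rewrite (_ : ind _ = (fun=> 1) \- ind A).
  by apply: trig_clB => //; exact/trig_cl_trig/trig_cst.
apply/funext => x; rewrite /ind /= !indicE in_setC.
by case: (x \in A) => /=; [rewrite subrr|rewrite subr0].
Qed.

(** If p is close to the indicator of A, then p times the indicator of B is in the closure, by
    [trig_clMtrig], and it is just as close to the product since the second indicator is at most
    1. *)
Lemma indclI A B : indcl A -> indcl B -> indcl (A `&` B).
Proof.
move=> [mA [LA cA]] [mB cB]; split; first exact: measurableI.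
have -> : ind (A `&` B) = (fun x => ind A x * ind B x).
  by apply/funext => x; rewrite /ind !indicE in_setI -realCM -natrM mulnb.
have LAB : L2on D (fun x => ind A x * ind B x).
  apply: (L2onM_bounded mD01 (M := 1)) => [|x _|]; [exact: cmeas_ind|exact: nsq_ind_le1|exact: ind_L2].
apply: trig_cl_lim => // e e0; have [p tp_ Ap] := cA _ e0.
exists (fun x => p x * ind B x); first exact: trig_clMtrig.
rewrite (_ : _ \- _ = (fun x => ind B x * (ind A \- p) x)).
  apply: (@le_trans _ _ (1 * e)); last by rewrite mul1r.
  apply: le_trans (nrmM_le ler01 _ _ _) _.
  - by apply: L2onB => //; exact: trig_L2.
  - exact: cmeas_ind.
  - by move=> x _; rewrite expr1n nsq_ind_le1.
  - by rewrite !mul1r.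
by apply/funext => x /=; rewrite mulrBr; congr (_ - _); exact: mulrC.
Qed.

Lemma indcl_bigcup (F : nat -> set R) : (forall n, indcl (F n)) -> indcl (\bigcup_n F n).
Proof.
move=> iF; have mF : measurable (\bigcup_n F n).
  by apply: bigcupT_measurable => n; have [] := iF n.
split => //; pose G n := \bigcup_(i < n) F i.
have iG n : indcl (G n).
  elim: n => [|n IH].
    have -> : G 0%N = ~` setT by rewrite /G II0 bigcup_set0 setCT.
    apply: indclC; split => //; rewrite (_ : ind setT = fun=> 1).
      exact/trig_cl_trig/trig_cst.
    by apply/funext => x; rewrite /ind indicT.
  have -> : G n.+1 = ~` (~` G n `&` ~` F n).
    rewrite setCI !setCK /G; apply/seteqP; split => x.
      by move=> [i /= ]; rewrite ltnS leq_eqVlt => /orP[/eqP->|ni] Fx; [right|left; exists i].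
    by move=> [[i /= ni Fx]|Fx]; [exists i => //=; exact: ltnW|exists n => /=].
  by apply/indclC/indclI; apply: indclC.
apply: (@trig_cl_bounded_cvg (fun n => ind (G n)) _ 1).
- exact: cmeas_ind.
- by move=> n; have [] := iG n.
- apply: aeW => x _; have [[i _ Fx]|nFx] := pselect ((\bigcup_n F n) x).
    have e n : (i < n)%N -> ind (G n) x = ind (\bigcup_n F n) x.
      move=> ni; rewrite /ind !indicE !mem_set//; last by exists i.
      by exists i.
    by split; apply: cvg_near_cst; exists i.+1 => // n ni; rewrite (e n ni).
  have e n : ind (G n) x = ind (\bigcup_n F n) x.
    rewrite /ind !indicE !memNset// => -[j /= _ Fj]; apply: nFx; exists j => //.
  by split; under eq_fun do rewrite e; exact: cvg_cst.
- by move=> n x _; exact: nsq_ind_le1.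
- by move=> x _; exact: nsq_ind_le1.
Qed.

End TrigPoly.
#[global] Hint Extern 0 (measurable D01) => solve [apply: mD01] : core.

(** * Density of trigonometric polynomials and Parseval's identity *)

Section RealSums.
Context {R : realType}.
Implicit Types (a : int -> R).

Lemma ler_sum_subset (I : eqType) (s t : seq I) (a : I -> R) : uniq s -> uniq t ->
  {subset s <= t} -> (forall k, 0 <= a k) -> \sum_(k <- s) a k <= \sum_(k <- t) a k.
Proof.
move=> us ut st a0.
have pm : perm_eq [seq i <- t | i \in s] s.
  apply: uniq_perm => //; first exact: filter_uniq.
  move=> x; rewrite mem_filter; apply/andP/idP => [[]//|xs].
  by split => //; exact: st.
rewrite (bigID (mem s) _ _ (r := t))/= -[X in _ <= X + _]big_filter (perm_big _ pm).
by rewrite lerDl sumr_ge0.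
Qed.

Lemma esum_le_seq a M : (forall k, 0 <= a k) ->
  (forall s, uniq s -> \sum_(k <- s) a k <= M) ->
  (\esum_(k in [set: int]) (a k)%:E <= M%:E)%E.
Proof.
move=> a0 H; apply: ge_ereal_sup => _ [A [finA _] <-].
rewrite fsbig_finite//= sumEFin lee_fin; apply: H; exact: fset_uniq.
Qed.

Lemma seq_le_esum a s : uniq s ->
  ((\sum_(k <- s) a k)%:E <= \esum_(k in [set: int]) (a k)%:E)%E.
Proof.
move=> us; apply: esum_ge; exists [set` s]; first by split => //; exact: finite_seq.
by rewrite -sumEFin (fsbig_seq _ _ us).
Qed.

Lemma esum_ge_seq a M : 
  (forall e, 0 < e -> exists2 s, uniq s & M - e <= \sum_(k <- s) a k) ->
  (M%:E <= \esum_(k in [set: int]) (a k)%:E)%E.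
Proof.
move=> H; apply/lee_addgt0Pr => e e0; have [s us Hs] := H e e0.
by rewrite -leeBlDr// -EFinB; apply: le_trans (seq_le_esum a us); rewrite lee_fin.
Qed.

End RealSums.

Import HBNNSimple.

Section Density.
Context {R : realType}.
Local Notation C := (R[i]).
Local Notation mu := (@lebesgue_measure R).
Local Notation D := (@D01 R).
Implicit Types (f g h p q : R -> C).

Lemma bernoulli_le (a : R) n : -1 <= a -> 1 + n%:R * a <= (1 + a) ^+ n.
Proof.
move=> a1; elim: n => [|n IH]; first by rewrite mul0r addr0 expr0.
rewrite exprS -natr1; apply: (@le_trans _ _ ((1 + a) * (1 + n%:R * a))).
  have := sqr_ge0 a; have : 0 <= n%:R :> R by [].
  nra.
by rewrite ler_wpM2l//; lra.
Qed.

Lemma bump_small (y : R) : 0 <= y -> y < 2^-1 ->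
  (fun n => (1 - y ^+ n) ^+ (2 ^ n)) @ \oo --> (1 : R).
Proof.
move=> y0 y1.
apply: (@squeeze_cvgr _ _ _ _ (fun n => 1 - (2 * y) ^+ n) (cst 1)); last exact: cvg_cst.
  near=> n; apply/andP; split.
    have := @bernoulli_le (- y ^+ n) (2 ^ n); rewrite lerNr opprK exprn_ile1//; last lra.
    by move=> /(_ isT); rewrite mulrN natrX -exprMn.
  apply: exprn_ile1; last by rewrite gerBl exprn_ge0.
  by rewrite subr_ge0 exprn_ile1//; lra.
rewrite -[X in _ --> X]subr0; apply: cvgB; first exact: cvg_cst.
by apply: cvg_expr; rewrite ger0_norm; lra.
Unshelve. all: end_near.
Qed.

Lemma bump_large (y : R) : 2^-1 < y -> y <= 1 ->
  (fun n => (1 - y ^+ n) ^+ (2 ^ n)) @ \oo --> (0 : R).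
Proof.
move=> y0 y1; have yp : 0 < y by lra.
apply: (@squeeze_cvgr _ _ _ _ (cst 0) (fun n => (2 * y)^-1 ^+ n)); last first.
- apply: cvg_expr; rewrite ger0_norm ?invr_ge0; last lra.
  by rewrite invf_lt1; lra.
- exact: cvg_cst.
near=> n; have yn1 : y ^+ n <= 1 by rewrite exprn_ile1//; lra.
have yn0 : 0 < y ^+ n by rewrite exprn_gt0.
apply/andP; split; first by rewrite exprn_ge0// subr_ge0.
rewrite exprVn -[leRHS]mul1r ler_pdivlMr ?exprn_gt0 ?mulr_gt0//.
(* By Bernoulli (1 + y^n)^(2^n) is at least (2y)^n, and its product with (1 - y^n)^(2^n) is (1 -
   y^(2n))^(2^n) <= 1. *)
apply: (@le_trans _ _ ((1 - y ^+ n) ^+ (2 ^ n) * (1 + y ^+ n) ^+ (2 ^ n))).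
  rewrite ler_wpM2l ?exprn_ge0 ?subr_ge0//.
  apply: le_trans (bernoulli_le (2 ^ n) _); last lra.
  by rewrite exprMn natrX lerDr.
rewrite -exprMn exprn_ile1//.
  by rewrite mulr_ge0 ?subr_ge0// addr_ge0// ltW.
by rewrite -subr_sqr expr1n gerBl sqr_ge0.
Unshelve. all: end_near.
Qed.

(* Brosowski and Deutsch: as n grows, (1 - y ^+ n) ^+ (2 ^ n) tends to 1 where
   y < 1/2 and to 0 where y > 1/2; with y = bump c this approximates the
   indicator of a half-line on [0, 1[ by trigonometric polynomials. *)
Definition bump (c x : R) : R := (1 + sin (pi * x) * sin (pi * (c - x))) / 2.

Lemma bump_ge0 c x : 0 <= bump c x.
Proof.
have := sin_le1 (pi * x); have := sin_geN1 (pi * x).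
have := sin_le1 (pi * (c - x)); have := sin_geN1 (pi * (c - x)).
by rewrite /bump; nra.
Qed.

Lemma bump_le1 c x : bump c x <= 1.
Proof.
have := sin_le1 (pi * x); have := sin_geN1 (pi * x).
have := sin_le1 (pi * (c - x)); have := sin_geN1 (pi * (c - x)).
by rewrite /bump; nra.
Qed.

Lemma bump_gt c x : 0 < x -> x < c -> c < 1 -> 2^-1 < bump c x.
Proof.
move=> x0 xc c1; have := pi_gt0 R => pi0.
have s1 : 0 < sin (pi * x) by apply: sin_gt0_pi; nra.
have s2 : 0 < sin (pi * (c - x)) by apply: sin_gt0_pi; nra.
by rewrite /bump; nra.
Qed.

Lemma bump_lt c x : 0 < c -> c < x -> x < 1 -> bump c x < 2^-1.
Proof.
move=> c0 cx x1; have := pi_gt0 R => pi0.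
have s1 : 0 < sin (pi * x) by apply: sin_gt0_pi; nra.
have s2 : 0 < sin (pi * (x - c)) by apply: sin_gt0_pi; nra.
have e : sin (pi * (c - x)) = - sin (pi * (x - c)).
  by rewrite -sinN; congr sin; ring.
by rewrite /bump e; nra.
Qed.

(** Each sine changes sign under x -> x + 1, but the product is (cos (2 pi x - pi c) - cos (pi c)) /
    2, which has frequencies -1, 0 and 1 only. *)
Lemma trig_bump c : trig (fun x => (bump c x)%:C).
Proof.
pose q x : C := (2^-1 - cos (pi * c) / 4)%:C
  + ((8^-1)%:C * expi (- (pi * c)) * E (-1) x + ((8^-1)%:C * expi (pi * c) * E 1 x + 0)).
rewrite (_ : (fun x => _) = q).
  apply: trigD; first exact: trig_cst.
  by apply: trigS; apply: trigS; exact: trig0.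
apply/funext => x; rewrite /q addr0 -!mulrA.
have -> : expi (- (pi * c)) * E (-1) x = expi (pi * x - pi * (c - x)) :> C.
  by rewrite /E -expiD; congr expi; rewrite mulrN1z; ring.
have -> : expi (pi * c) * E 1 x = expi (- (pi * x - pi * (c - x))) :> C.
  by rewrite /E -expiD; congr expi; rewrite mulr1z; ring.
have e : cos (pi * c) = cos (pi * x + pi * (c - x)) by congr cos; ring.
apply: complex_eq; rewrite !ReImE /= /bump ?cosN ?sinN; last by ring.
by rewrite e cosB cosD; field.
Qed.

Lemma indcl_ray (c : R) : indcl `]-oo, c[%classic.
Proof.
split; first exact: measurable_itv.
have mr : measurable `]-oo, c[%classic by exact: measurable_itv.
have [c0|c0] := leP c 0.
  apply: (@trig_cl_ae _ (fun=> 0)).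
  - exact: cmeas_ind.
  - apply: aeW => x; rewrite /D01 /= in_itv/= => /andP[x0 _].
    rewrite /ind indicE memNset//= in_itv/= => xc.
    by have := lt_le_trans xc c0; rewrite ltNge x0.
  - exact/trig_cl_trig/trig0.
have [c1|c1] := leP 1 c.
  apply: (@trig_cl_ae _ (fun=> 1)).
  - exact: cmeas_ind.
  - apply: aeW => x; rewrite /D01 /= in_itv/= => /andP[_ x1].
    by rewrite /ind indicE mem_set//= in_itv/= (lt_le_trans x1).
  - exact/trig_cl_trig/trig_cst.
(* Tends to 1 on ]0, c[ and to 0 on ]c, 1[. At the points 0 and c, where [bump] is 1/2, no limit is
   claimed; they form a null set. *)
pose q n x := 1 - (1 - (bump c x) ^+ n) ^+ (2 ^ n).
apply: (@trig_cl_bounded_cvg _ (fun n x => (q n x)%:C) _ 1).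
- exact: cmeas_ind.
- move=> n; apply: trig_cl_trig.
  rewrite (_ : (fun x => _) = fun x => 1 - (1 - (bump c x)%:C ^+ n) ^+ (2 ^ n)).
    apply: trigB; first exact: trig_cst.
    apply: trigX; apply: trigB; first exact: trig_cst.
    by apply: trigX; exact: trig_bump.
  by apply/funext => x; rewrite /q rmorphB rmorphXn rmorphB rmorphXn rmorph1.
- have neg : mu.-negligible ([set 0; c]).
    by apply: negligibleU; apply/negligibleP => //; exact: lebesgue_measure_set1.
  apply: negligibleS neg => x /= /not_implyP[]; rewrite /D01/= in_itv/= => /andP[x0 x1] H.
  apply: contrapT => /not_orP[nx0 nxc]; apply: H.
  have xp : 0 < x by rewrite lt_def x0 andbT; apply/eqP.
  have [xc|cx|xc] := ltgtP x c; last by case: nxc.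
    rewrite /ind indicE mem_set /=; last by rewrite in_itv.
    split; last exact: cvg_cst.
    rewrite -[X in _ --> X]subr0; apply: cvgB; first exact: cvg_cst.
    by apply: bump_large; [exact: bump_gt|exact: bump_le1].
  rewrite /ind indicE memNset /=; last by rewrite in_itv/= => /lt_trans /(_ cx); rewrite ltxx.
  split; last exact: cvg_cst.
  rewrite -[X in _ --> X](subrr 1); apply: cvgB; first exact: cvg_cst.
  by apply: bump_small; [exact: bump_ge0|exact: bump_lt].
- move=> n x _; rewrite nsqR expr_le1//.
    by rewrite gerBl exprn_ge0// subr_ge0 exprn_ile1 ?bump_ge0 ?bump_le1.
  rewrite subr_ge0 exprn_ile1//.
    by rewrite subr_ge0 exprn_ile1 ?bump_ge0 ?bump_le1.
  by rewrite gerBl exprn_ge0// bump_ge0.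
- by move=> x _; exact: nsq_ind_le1.
Qed.

Lemma indcl_measurable (A : set R) : measurable A -> indcl A.
Proof.
rewrite -[measurable]/((@ocitv R).-sigma.-measurable) RGenInftyO.measurableE.
apply: smallest_sub; last by move=> _ [c ->]; exact: indcl_ray.
split.
- rewrite -setCT; apply: indclC; split => //.
  by rewrite (_ : ind setT = fun=> 1); [exact/trig_cl_trig/trig_cst|apply/funext => x; rewrite /ind indicT].
- by move=> B /indclC; rewrite setTD.
- exact: indcl_bigcup.
Qed.

Lemma trig_cl_sum (I : Type) (s : seq I) (F : I -> R -> C) :
  (forall i, trig_cl (F i)) -> trig_cl (fun x => \sum_(i <- s) F i x).
Proof.
move=> H; elim: s => [|a s IH].
  by under eq_fun do rewrite big_nil; exact/trig_cl_trig/trig0.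
by under eq_fun do rewrite big_cons; exact: trig_clD.
Qed.

Lemma trig_cl_simple (g : {nnsfun R >-> R}) : trig_cl (fun x => (g x)%:C).
Proof.
pose s := fset_set (range g).
rewrite (_ : (fun x => _) = fun x => \sum_(i < #|` s|) (s`_i)%:C * ind (g @^-1` [set s`_i]) x).
  apply: trig_cl_sum => i; apply: trig_clZ.
  by apply indcl_measurable; exact: measurable_funPTI.
apply/funext => x; rewrite fimfunEord raddf_sum; apply: eq_bigr => i _.
exact: realCM.
Qed.

Lemma trig_cl_ge0 (u : R -> R) : measurable_fun D u -> (forall x, D x -> 0 <= u x) ->
  rint D (fun x => u x ^+ 2) -> trig_cl (fun x => (u x)%:C).
Proof.
move=> mu_ u0 iu.
have mE : measurable_fun D (EFin \o u) by exact/measurable_EFinP.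
pose g n := nnsfun_approx mD01 mE n.
have gu x : D x -> (fun n => g n x) @ \oo --> u x.
  move=> Dx; have := @cvg_nnsfun_approx _ _ _ D mD01 _ mE _ x Dx.
  by move=> /(_ (fun y Dy => u0 y Dy)) /fine_cvgP[].
have gle n x : D x -> g n x <= u x.
  move=> Dx; rewrite -lee_fin /g nnsfun_approxE.
  exact: le_approx.
have Lu : L2on D (fun x => (u x)%:C).
  by split; [exact: cmeasR|under eq_fun do rewrite nsqR].
apply: (trig_cl_cvg (u := fun n x => (g n x)%:C) Lu); first by move=> n; exact: trig_cl_simple.
apply: (@L2_dominated _ D _ _ (fun x => u x ^+ 2)) => //.
- by move=> n; have [] := trig_cl_simple (g n).
- by apply: aeW => x Dx; split; [exact: gu|exact: cvg_cst].
- move=> n x Dx; rewrite -rmorphB nsqR -sqrrN opprB.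
  have := gle n x Dx; have g0 : 0 <= g n x by [].
  by move=> ?; rewrite ler_pXn2r ?nnegrE ?subr_ge0 ?u0// gerBl.
Qed.

Lemma trig_cl_real (u : R -> R) : measurable_fun D u ->
  rint D (fun x => u x ^+ 2) -> trig_cl (fun x => (u x)%:C).
Proof.
move=> mu_ iu.
have H (v : R -> R) : measurable_fun D v -> (forall x, v x ^+ 2 = u x ^+ 2) -> trig_cl (fun x => (Num.max (v x) 0)%:C).
  move=> mv uv; have mm : measurable_fun D (fun x => Num.max (v x) 0).
    by apply: measurable_maxr => //; exact: measurable_cst.
  apply: trig_cl_ge0 => // [x _|]; first by rewrite le_max lexx orbT.
  apply: (rint_le mD01 _ _ iu); first exact: measurable_funX.
  move=> x _; rewrite ger0_norm ?sqr_ge0// -uv.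
  by case: (leP (v x) 0) => // _; rewrite expr0n sqr_ge0.
rewrite (_ : (fun x => _) = (fun x => (Num.max (u x) 0)%:C) \- (fun x => (Num.max (- u x) 0)%:C)).
  apply: trig_clB; first exact: H.
  by apply: H; [exact: measurable_funN|move=> x; rewrite sqrrN].
apply/funext => x /=; rewrite -rmorphB; congr (_ %:C).
by case: (leP (u x) 0); case: (leP (- u x) 0); lra.
Qed.

Lemma trig_cl_L2 f : L2on D f -> trig_cl f.
Proof.
move=> [[m1 m2] nf].
rewrite (_ : f = (fun x => (Re (f x))%:C) \+ (fun x => 'i%C * (Im (f x))%:C)).
  apply: trig_clD; last apply: trig_clZ.
  - apply: trig_cl_real => //; apply: (rint_le mD01 _ _ nf); first exact: measurable_funX.
    by move=> x _; rewrite ger0_norm ?sqr_ge0// lerDl sqr_ge0.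
  - apply: trig_cl_real => //; apply: (rint_le mD01 _ _ nf); first exact: measurable_funX.
    by move=> x _; rewrite ger0_norm ?sqr_ge0// lerDr sqr_ge0.
by apply/funext => x /=; rewrite -complexE.
Qed.

Lemma L2_trig_dense f (e : R) : L2on D f -> 0 < e -> exists2 p, trig p & nrm D (f \- p) <= e.
Proof. by move=> /trig_cl_L2[_]; apply. Qed.

(** The partial Fourier sum over the frequencies of an approximating polynomial does at least as
    well as that polynomial, and adding frequencies only lowers the error. The unordered form
    matches that of [is_synthesis]. *)
Lemma coef_approx f (e : R) : L2on D f -> 0 < e ->
  exists2 s, uniq s & forall t, uniq t -> {subset s <= t} ->
    nrm2 D (f \- tp t (coef f)) <= e.
Proof.
move=> Lf e0; have se : 0 < Num.sqrt e by rewrite sqrtr_gt0.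
have [p tp_ fp] := L2_trig_dense Lf se.
have [s [c [us pE]]] := trig_uniq tp_; exists s => // t ut st.
have : nrm2 D (f \- p) <= e.
  by rewrite -nrm_sq// -(sqr_sqrtr (ltW e0)) ler_pXn2r ?nnegrE ?sqrtr_ge0.
apply: le_trans; rewrite pE !nrm2_sub_tp//.
under [X in _ + X <= _]eq_bigr do rewrite subrr nsq0.
rewrite big1_eq addr0; apply: (@le_trans _ _ (nrm2 D f - \sum_(k <- s) nsq (coef f k))).
  by rewrite lerD2l lerN2; apply: ler_sum_subset.
by rewrite lerDl sumr_ge0.
Qed.

Lemma parseval f : L2on D f ->
  (\esum_(k in [set: int]) (nsq (coef f k))%:E = (nrm2 D f)%:E)%E.
Proof.
move=> Lf; apply/eqP; rewrite eq_le; apply/andP; split.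
  by apply: esum_le_seq => // s us; exact: bessel.
apply: esum_ge_seq => e e0; have [s us Hs] := coef_approx Lf e0.
exists s => //; have := Hs s us (fun x => id); rewrite nrm2_sub_tp//.
under [X in _ + X <= _]eq_bigr do rewrite subrr nsq0.
by rewrite big1_eq addr0 lerBlDr lerBlDl addrC.
Qed.

End Density.

(** * Periodization *)

Section Translation.
Context {R : realType}.
Local Notation C := (R[i]).
Local Notation mu := (@lebesgue_measure R).
Local Notation D := (@D01 R).
Implicit Types (f g h p q : R -> C).

Definition sh (a : R) : measurableTypeR R -> measurableTypeR R := fun x => x + a.

Lemma measurable_shift (a : R) (A : set R) : measurable_fun A (sh a).
Proof. rewrite /sh. by apply: measurable_funD => //; exact: measurable_cst. Qed.

Lemma shift_preimage_itv (a x y : R) :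
  sh a @^-1` `]x, y] = `]x - a, y - a]%classic.
Proof.
by apply/seteqP; split => z; rewrite /sh /= !in_itv/= ltrBlDr lerBrDr.
Qed.

Lemma lebesgue_measure_shift (a : R) (A : set R) : measurable A ->
  pushforward mu (sh a) A = mu A.
Proof.
move=> mA; apply/esym/lebesgue_measure_unique => //=.
  exact: measurable_shift.
move=> _ _ [[x y]] _ <-.
rewrite /pushforward /= shift_preimage_itv !lebesgue_measure_itv/=.
by rewrite !lte_fin ltrD2r -!EFinD opprD opprK addrACA addNr addr0.
Qed.

Lemma ge0_integral_shift (a : R) (A : set R) (f : R -> \bar R) : measurable A ->
  measurable_fun A f -> (forall x, A x -> 0 <= f x)%E ->
  (\int[mu]_(x in sh a @^-1` A) f (x + a)%R = \int[mu]_(x in A) f x)%E.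
Proof.
move=> mA mf f0.
have f0' : {in A, forall y, (0 <= f y)%E} by move=> x /set_mem; exact: f0.
rewrite -[LHS](@ge0_integral_pushforward _ _ (measurableTypeR R) (measurableTypeR R) R (sh a) (@measurable_shift a setT) mu A f mA mf f0').
apply: eq_measure_integral; first exact: measurable_shift.
by move=> mf' B mB BA; exact: (lebesgue_measure_shift a mB).
Qed.

Lemma integral_shift (a : R) (A : set R) (f : R -> \bar R) : measurable A ->
  measurable_fun A f ->
  (\int[mu]_(x in sh a @^-1` A) f (x + a)%R = \int[mu]_(x in A) f x)%E.
Proof.
move=> mA mf; rewrite integralE [RHS]integralE; congr (_ - _)%E.
- transitivity (\int[mu]_(x in sh a @^-1` A) f^\+ (x + a)%R)%E; first by apply: eq_integral => x _; rewrite unlock.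
  by apply: ge0_integral_shift => //; exact: (measurable_funepos mf).
- transitivity (\int[mu]_(x in sh a @^-1` A) f^\- (x + a)%R)%E; first by apply: eq_integral => x _; rewrite unlock.
  by apply: ge0_integral_shift => //; exact: (measurable_funeneg mf).
Qed.

Lemma measurable_fun_shift d (T : measurableType d) (a : R) (f : R -> T) :
  measurable_fun setT f -> measurable_fun setT (fun x : R => f (x + a)).
Proof. by move=> mf; exact: (measurableT_comp mf (@measurable_shift a setT)). Qed.

Lemma cmeas_shift a f : cmeas setT f -> cmeas setT (fun x => f (x + a)).
Proof. by move=> [m1 m2]; split; [exact: (measurable_fun_shift a m1)|exact: (measurable_fun_shift a m2)]. Qed.

Lemma rint_shift a (u : R -> R) : rint setT u -> rint setT (fun x => u (x + a)).
Proof.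
move=> /integrableP[m iu]; apply/integrableP; split.
  exact: (measurable_fun_shift a m).
have := @integral_shift a setT (fun x => `|(EFin \o u) x|)%E measurableT.
rewrite preimage_setT => ->//; exact: measurableT_comp.
Qed.

Lemma Rint_shift a (u : R -> R) : measurable_fun setT u ->
  \int[mu]_x u (x + a) = \int[mu]_x u x.
Proof.
move=> m; rewrite /Rintegral; congr fine.
have := @integral_shift a setT (EFin \o u) measurableT.
by rewrite preimage_setT => ->//; exact/measurable_EFinP.
Qed.

Lemma cint_shift a f : cmeas setT f -> cint setT (fun x => f (x + a)) = cint setT f.
Proof. by move=> [m1 m2]; rewrite /cint !(Rint_shift a (u := fun x => _ (f x))). Qed.

Lemma L2on_shift a f : L2on setT f -> L2on setT (fun x => f (x + a)).
Proof.
by move=> [mf nf]; split; [exact: cmeas_shift|exact: (rint_shift a nf)].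
Qed.

Lemma nrm2_shift a f : cmeas setT f -> nrm2 setT (fun x => f (x + a)) = nrm2 setT f.
Proof.
by move=> mf; apply: (Rint_shift a (u := fun x => nsq (f x))); exact: cmeas_nsq.
Qed.

Lemma ae_shift (a : R) (P : R -> Prop) :
  {ae mu, forall x, P x} -> {ae mu, forall x, P (x + a)}.
Proof.
move=> [N [mN N0 PN]]; exists (sh a @^-1` N); split.
- by rewrite -[X in measurable X]setTI; exact: (@measurable_shift a setT).
- by have := lebesgue_measure_shift a mN; rewrite N0.
- by move=> x /= Px; exact: PN.
Qed.

(** An enumeration of the integers, turning sums over Z into series over nat, to which measurability
    of countable sums and interchange of sum and integral apply. *)
Definition int_of (n : nat) : int := if odd n then Negz n./2 else Posz n./2.

Lemma int_of_bij : set_bij [set: nat] [set: int] int_of.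
Proof.
split => //.
- move=> m n _ _; rewrite /int_of; case: ifPn => om; case: ifPn => on // -[e];
  by rewrite -(odd_double_half m) -(odd_double_half n) ?om ?on ?(negbTE om) ?(negbTE on) e.
- move=> [m|m] _.
    by exists m.*2 => //; rewrite /int_of odd_double half_double.
  by exists m.*2.+1 => //; rewrite /int_of /= odd_double /= uphalf_double.
Qed.

Lemma esum_int (a : int -> \bar R) : (forall k, 0 <= a k)%E ->
  (\esum_(k in [set: int]) a k = \sum_(0 <= n <oo) a (int_of n))%E.
Proof.
by move=> a0; rewrite (@reindex_esum _ _ _ _ _ _ a int_of_bij) nneseries_esumT.
Qed.

Lemma measurable_esum_int (A : set R) (f : int -> R -> \bar R) :
  (forall k, measurable_fun A (f k)) -> (forall k x, A x -> 0 <= f k x)%E ->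
  (forall k x, 0 <= f k x)%E ->
  measurable_fun A (fun x => \esum_(k in [set: int]) f k x)%E.
Proof.
move=> mf _ f0; under eq_fun do rewrite esum_int//.
by apply: ge0_emeasurable_sum => // n _.
Qed.

Definition itvZ (k : int) : set R := `[k%:~R, k%:~R + 1[%classic.

Lemma itvZ_floor k x : itvZ k x <-> Num.floor x = k.
Proof.
rewrite /itvZ /= in_itv/=; split.
  by move=> H; apply/eqP; rewrite floor_eq intrD mulr1z.
by move=> <-; rewrite -[1 in X in _ && X]mulr1z -intrD floor_le floorD1_gt.
Qed.

Lemma bigcup_itvZ : \bigcup_n itvZ (int_of n) = setT.
Proof.
apply/seteqP; split => // x _; have [_ _ /(_ (Num.floor x) I) [n _ e]] := int_of_bij.
by exists n => //; apply/itvZ_floor.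
Qed.

Lemma trivIset_itvZ : trivIset setT (fun n => itvZ (int_of n)).
Proof.
move=> m n _ _ [x [/itvZ_floor e1 /itvZ_floor e2]].
have [_ inj _] := int_of_bij; apply: inj; rewrite ?inE//.
by rewrite -e1 -e2.
Qed.

Lemma itvZ_shift k : sh k%:~R @^-1` (itvZ k) = D.
Proof.
apply/seteqP; split => x; rewrite /sh /itvZ /D01 /= !in_itv/= => /andP[a b]; apply/andP; split; lra.
Qed.

(** The line is cut at the integers, each piece is translated back to D, and sum and integral of
    nonnegative functions are interchanged. *)
Lemma ge0_periodize (f : R -> \bar R) : measurable_fun setT f -> (forall x, 0 <= f x)%E ->
  (\int[mu]_x f x = \int[mu]_(x in D) \esum_(k in [set: int]) f (x + k%:~R)%R)%E.
Proof.
move=> mf f0.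
have mI n : measurable (itvZ (int_of n)) by exact: measurable_itv.
rewrite -bigcup_itvZ ge0_integral_bigcup//; last 2 first.
- by rewrite bigcup_itvZ.
- exact: trivIset_itvZ.
under [in RHS]eq_integral do rewrite esum_int//.
rewrite integral_nneseries//; last first.
  by move=> n; apply: measurable_funTS; exact: measurable_fun_shift.
apply: eq_eseriesr => n _.
rewrite -(@ge0_integral_shift (int_of n)%:~R)//; last exact: measurable_funTS.
by rewrite itvZ_shift.
Qed.

End Translation.

(** * Absolutely summable families over the integers *)

Section Zsum.
Context {R : realType}.
Local Notation C := (R[i]).
Local Notation mu := (@lebesgue_measure R).
Local Notation D := (@D01 R).
Implicit Types (a b : int -> R) (z w : int -> C).

Definition esumZ a : \bar R := (\esum_(k in [set: int]) (a k)%:E)%E.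

Definition rsum a : Prop := (esumZ (fun k => `|a k|%R) < +oo)%E.

Lemma esumZ_ge0 a : (forall k, 0 <= a k) -> (0 <= esumZ a)%E.
Proof. by move=> a0; apply: esum_ge0 => k _; rewrite lee_fin. Qed.

Lemma esumZ_le a b : (forall k, a k <= b k) -> (esumZ a <= esumZ b)%E.
Proof. by move=> ab; apply: le_esum => k _; rewrite lee_fin. Qed.

Lemma esumZD a b : (forall k, 0 <= a k) -> (forall k, 0 <= b k) ->
  (esumZ (fun k => a k + b k)%R = esumZ a + esumZ b)%E.
Proof.
move=> a0 b0; rewrite /esumZ -esumD => [|k _|k _]; rewrite ?lee_fin//.
Qed.

Lemma esumZZ (c : R) a : 0 <= c -> (forall k, 0 <= a k) ->
  (esumZ (fun k => c * a k)%R = c%:E * esumZ a)%E.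
Proof.
move=> c0 a0; rewrite /esumZ !esum_int; last 2 first.
- by move=> k; rewrite lee_fin.
- by move=> k; rewrite lee_fin mulr_ge0.
by rewrite -nneseriesZl => [|n _]; rewrite ?lee_fin//; apply: eq_eseriesr => n _; rewrite EFinM.
Qed.

Lemma esumZ_fin a : (forall k, 0 <= a k) -> (esumZ a < +oo)%E -> esumZ a \is a fin_num.
Proof. by move=> a0 fa; rewrite ge0_fin_numE// esumZ_ge0. Qed.

(** [zsumR] uses positive and negative parts, but any difference of nonnegative summable families
    gives the same value, because P + q = Q + p termwise. Linearity of [zsumR] rests on this. *)
Lemma zsumR_sub (p q : int -> R) : (forall k, 0 <= p k) -> (forall k, 0 <= q k) ->
  (esumZ p < +oo)%E -> (esumZ q < +oo)%E ->
  zsumR (fun k => p k - q k) = fine (esumZ p) - fine (esumZ q).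
Proof.
move=> p0 q0 fp fq; rewrite /zsumR.
set P := fun k => Num.max (p k - q k) 0; set Q := fun k => Num.max (- (p k - q k)) 0.
have P0 k : 0 <= P k by rewrite /P le_max lexx orbT.
have Q0 k : 0 <= Q k by rewrite /Q le_max lexx orbT.
have fP : (esumZ P < +oo)%E.
  apply: le_lt_trans fp; apply: esumZ_le => k.
  by rewrite /P ge_max p0 andbT gerBl.
have fQ : (esumZ Q < +oo)%E.
  apply: le_lt_trans fq; apply: esumZ_le => k.
  by rewrite /Q ge_max q0 andbT opprB gerBl.
have : (esumZ P + esumZ q = esumZ Q + esumZ p)%E.
  rewrite -!esumZD//; apply: eq_esum => k _; congr EFin.
  by rewrite /P /Q; case: (leP (p k - q k) 0); case: (leP (- (p k - q k)) 0); lra.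
rewrite -(fineK (esumZ_fin P0 fP)) -(fineK (esumZ_fin Q0 fQ)) -(fineK (esumZ_fin p0 fp)) -(fineK (esumZ_fin q0 fq)).
move=> [e]; rewrite -/(esumZ P) -/(esumZ Q); lra.
Qed.

Let pos a k := Num.max (a k) 0.
Let neg a k := Num.max (- a k) 0.

Lemma pos_ge0 a k : 0 <= pos a k. Proof. by rewrite /pos le_max lexx orbT. Qed.
Lemma neg_ge0 a k : 0 <= neg a k. Proof. by rewrite /neg le_max lexx orbT. Qed.

Lemma posneg a k : a k = pos a k - neg a k.
Proof. by rewrite /pos /neg; case: (leP (a k) 0); case: (leP (- a k) 0); lra. Qed.

Lemma rsum_pos a : rsum a -> (esumZ (pos a) < +oo)%E.
Proof.
apply: le_lt_trans; apply: esumZ_le => k.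
by rewrite /pos ge_max ler_norm normr_ge0.
Qed.

Lemma rsum_neg a : rsum a -> (esumZ (neg a) < +oo)%E.
Proof.
apply: le_lt_trans; apply: esumZ_le => k.
by rewrite /neg ge_max -normrN ler_norm normr_ge0.
Qed.

Lemma zsumR_posneg a : zsumR a = fine (esumZ (pos a)) - fine (esumZ (neg a)).
Proof. by []. Qed.

Lemma rsumD a b : rsum a -> rsum b -> rsum (fun k => a k + b k).
Proof.
move=> ra rb; rewrite /rsum; apply: (@le_lt_trans _ _ (esumZ (fun k => `|a k|%R) + esumZ (fun k => `|b k|%R))%E).
  by rewrite -esumZD//; apply: esumZ_le => k; exact: ler_normD.
exact: lte_add_pinfty.
Qed.

Lemma rsumZ c a : rsum a -> rsum (fun k => c * a k).
Proof.
move=> ra; rewrite /rsum; under eq_fun do rewrite normrM.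
rewrite esumZZ// -(fineK (esumZ_fin _ ra)) => [|k]; last by [].
by rewrite -EFinM ltry.
Qed.

Lemma zsumRD a b : rsum a -> rsum b -> zsumR (fun k => a k + b k) = zsumR a + zsumR b.
Proof.
move=> ra rb; have pa := rsum_pos ra; have na := rsum_neg ra.
have pb := rsum_pos rb; have nb := rsum_neg rb.
rewrite (_ : (fun k => _) = fun k => (pos a k + pos b k) - (neg a k + neg b k)); last first.
  by apply/funext => k; rewrite (posneg a k) (posneg b k); ring.
have p1 := pos_ge0 a; have p2 := pos_ge0 b; have p3 := neg_ge0 a; have p4 := neg_ge0 b.
rewrite zsumR_sub; first last.
- by rewrite esumZD// lte_add_pinfty.
- by rewrite esumZD// lte_add_pinfty.
- by move=> k; rewrite addr_ge0.
- by move=> k; rewrite addr_ge0.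
rewrite !esumZD// !fineD ?esumZ_fin// !zsumR_posneg; ring.
Qed.

Lemma zsumRZ c a : rsum a -> zsumR (fun k => c * a k) = c * zsumR a.
Proof.
move=> ra; have pa := rsum_pos ra; have na := rsum_neg ra.
have [p0 n0] := (pos_ge0 a, neg_ge0 a).
have fs d b : 0 <= d -> (forall k, 0 <= b k) -> (esumZ b < +oo)%E ->
    (esumZ (fun k => d * b k)%R < +oo)%E /\ fine (esumZ (fun k => d * b k)) = d * fine (esumZ b).
  move=> d0 b0 fb; rewrite esumZZ// -(fineK (esumZ_fin b0 fb)) -EFinM /=; split => //.
  exact: ltry.
have [c0|/ltW c0] := leP 0 c.
  have [f1 e1] := fs c _ c0 p0 pa; have [f2 e2] := fs c _ c0 n0 na.
  rewrite (_ : (fun k => _) = fun k => c * pos a k - c * neg a k); last first.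
    by apply/funext => k; rewrite {1}(posneg a k) mulrBr.
  by rewrite zsumR_sub ?e1 ?e2 ?zsumR_posneg//; [ring|move=> k; exact: mulr_ge0|move=> k; exact: mulr_ge0].
have d0 : 0 <= - c by rewrite oppr_ge0.
have [f1 e1] := fs (- c) _ d0 p0 pa; have [f2 e2] := fs (- c) _ d0 n0 na.
rewrite (_ : (fun k => _) = fun k => (- c) * neg a k - (- c) * pos a k); last first.
  by apply/funext => k; rewrite {1}(posneg a k); ring.
by rewrite zsumR_sub ?e1 ?e2 ?zsumR_posneg//; [ring|move=> k; exact: mulr_ge0|move=> k; exact: mulr_ge0].
Qed.

Lemma zsumR_ge0E a : (forall k, 0 <= a k) -> zsumR a = fine (esumZ a).
Proof.
move=> a0; rewrite /zsumR (_ : (fun k => (Num.max (- a k) 0)%:E) = fun=> 0%E).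
  rewrite [X in _ - fine X]esum1// subr0; congr fine; apply: eq_esum => k _.
  by congr EFin; apply/max_idPl.
by apply/funext => k; congr EFin; apply/max_idPr; rewrite oppr_le0.
Qed.

Lemma zsumR0 : zsumR (fun=> 0) = 0 :> R.
Proof. by rewrite zsumR_ge0E// /esumZ esum1. Qed.

Lemma esumZ_finsupp a s : uniq s -> (forall k, 0 <= a k) ->
  (forall k, k \notin s -> a k = 0) -> esumZ a = (\sum_(k <- s) a k)%:E.
Proof.
move=> us a0 as0; apply/eqP; rewrite eq_le; apply/andP; split; last exact: seq_le_esum.
apply: esum_le_seq => // t ut.
rewrite (bigID (mem s))/= [X in _ + X]big1 ?addr0; last by move=> k /as0.
rewrite -big_filter; apply: ler_sum_subset => //; first exact: filter_uniq.
by move=> k; rewrite mem_filter => /andP[].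
Qed.

Lemma zsumR_finsupp a s : uniq s -> (forall k, k \notin s -> a k = 0) ->
  zsumR a = \sum_(k <- s) a k.
Proof.
move=> us as0; rewrite zsumR_posneg !(esumZ_finsupp us)/=.
- by rewrite -sumrB; apply: eq_bigr => k _; rewrite -posneg.
- exact: neg_ge0.
- by move=> k /as0 e; rewrite /neg e oppr0 maxxx.
- exact: pos_ge0.
- by move=> k /as0 e; rewrite /pos e maxxx.
Qed.

Definition csum z : Prop := rsum (fun k => Re (z k)) /\ rsum (fun k => Im (z k)).

Lemma Re_zsum z : Re (zsum z) = zsumR (fun k => Re (z k)). Proof. by []. Qed.
Lemma Im_zsum z : Im (zsum z) = zsumR (fun k => Im (z k)). Proof. by []. Qed.

Lemma zsumZ c z : csum z -> zsum (fun k => c * z k) = c * zsum z.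
Proof.
move=> [z1 z2]; apply: complex_eq; rewrite ?ReM ?ImM ?Re_zsum ?Im_zsum.
- under eq_fun do rewrite ReM -mulNr.
  by rewrite (zsumRD (rsumZ _ z1) (rsumZ _ z2)) (zsumRZ _ z1) (zsumRZ _ z2) mulNr.
- under eq_fun do rewrite ImM.
  by rewrite (zsumRD (rsumZ _ z2) (rsumZ _ z1)) (zsumRZ _ z1) (zsumRZ _ z2).
Qed.

Lemma zsum_finsupp z s : uniq s -> (forall k, k \notin s -> z k = 0) ->
  zsum z = \sum_(k <- s) z k.
Proof.
move=> us zs.
have ReS (F : int -> C) l : Re (\sum_(k <- l) F k) = \sum_(k <- l) Re (F k).
  by elim: l => [|x l IH]; rewrite ?big_nil ?big_cons ?ReD ?IH.
have ImS (F : int -> C) l : Im (\sum_(k <- l) F k) = \sum_(k <- l) Im (F k).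
  by elim: l => [|x l IH]; rewrite ?big_nil ?big_cons ?ImD ?IH.
apply: complex_eq; rewrite ?ReS ?ImS /=; apply: zsumR_finsupp => // k /zs -> //.
Qed.

Lemma zsum_real a : (forall k, 0 <= a k) -> zsum (fun k => (a k)%:C) = (fine (esumZ a))%:C.
Proof. by move=> a0; rewrite /zsum zsumR_ge0E// zsumR0. Qed.

Lemma csum_mul z w : (esumZ (fun k => nsq (z k)) < +oo)%E ->
  (esumZ (fun k => nsq (w k)) < +oo)%E -> csum (fun k => z k * cj (w k)).
Proof.
move=> fz fw.
have key : (esumZ (fun k => (nsq (z k) + nsq (w k))%R) < +oo)%E.
  by rewrite esumZD// lte_add_pinfty.
have H x y : `|x * y| <= x ^+ 2 / 2 + y ^+ 2 / 2 :> R.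
  have h1 : 0 <= x ^+ 2 + 2 * (x * y) + y ^+ 2 by rewrite (_ : _ + _ = (x + y) ^+ 2) ?sqr_ge0//; ring.
  have h2 : 0 <= x ^+ 2 - 2 * (x * y) + y ^+ 2 by rewrite (_ : _ + _ = (x - y) ^+ 2) ?sqr_ge0//; ring.
  by rewrite ler_norml; apply/andP; split; lra.
split; apply: le_lt_trans key; apply: esumZ_le => k; rewrite !ReImE /nsq.
- rewrite mulrN opprK; apply: le_trans (ler_normD _ _) _.
  by apply: le_trans (lerD (H _ _) (H _ _)) _; have := sqr_ge0 (Re (z k)); have := sqr_ge0 (Im (z k)); have := sqr_ge0 (Re (w k)); have := sqr_ge0 (Im (w k)); lra.
- rewrite mulrN; apply: le_trans (ler_normD _ _) _; rewrite normrN.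
  by apply: le_trans (lerD (H _ _) (H _ _)) _; have := sqr_ge0 (Re (z k)); have := sqr_ge0 (Im (z k)); have := sqr_ge0 (Re (w k)); have := sqr_ge0 (Im (w k)); lra.
Qed.

(* The bracket is a positive semidefinite form, hence Cauchy-Schwarz. *)
Lemma zsum_CS z w : (esumZ (fun k => nsq (z k)) < +oo)%E ->
  (esumZ (fun k => nsq (w k)) < +oo)%E ->
  nsq (zsum (fun k => z k * cj (w k))) <=
  fine (esumZ (fun k => nsq (z k))) * fine (esumZ (fun k => nsq (w k))).
Proof.
move=> fz fw; have cs := csum_mul fz fw.
have rz : rsum (fun k => nsq (z k)).
  by apply: le_lt_trans fz; apply: esumZ_le => k; rewrite ger0_norm.
have rw : rsum (fun k => nsq (w k)).
  by apply: le_lt_trans fw; apply: esumZ_le => k; rewrite ger0_norm.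
apply: CS2_of_quadratic.
- by rewrite fine_ge0// esumZ_ge0.
- by rewrite fine_ge0// esumZ_ge0.
move=> t.
have := zsumR_ge0E (fun k => nsq_ge0 (z k + t * w k)).
have -> : (fun k => nsq (z k + t * w k)) =
    (fun k => nsq (z k) + (2 * Re (cj t * (z k * cj (w k))) + nsq t * nsq (w k))).
  by apply/funext => k; rewrite /nsq !ReImE; ring.
have cst : csum (fun k => cj t * (z k * cj (w k))).
  by have [c1 c2] := cs; split; [under eq_fun do rewrite ReM -mulNr|under eq_fun do rewrite ImM]; apply: rsumD; exact: rsumZ.
have [ct1 _] := cst.
have r1 := rsumZ 2 ct1; have r2 := rsumZ (nsq t) rw.
rewrite (zsumRD rz (rsumD r1 r2)) (zsumRD r1 r2) (zsumRZ 2 ct1) (zsumRZ _ rw).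
rewrite (zsumR_ge0E (fun k => nsq_ge0 (z k))) (zsumR_ge0E (fun k => nsq_ge0 (w k))).
rewrite -Re_zsum -(zsumZ (cj t) cs) /= addrA => ->.
by rewrite fine_ge0// esumZ_ge0// => k; rewrite addrA; have := nsq_ge0 (z k + t * w k); rewrite /nsq !ReImE; nra.
Qed.

End Zsum.

(** * Periodized integrals and the bracket *)

Section Periodization.
Context {R : realType}.
Local Notation C := (R[i]).
Local Notation mu := (@lebesgue_measure R).
Local Notation D := (@D01 R).
Implicit Types (f g h : R -> C).

Lemma ge0_periodizeR (u : R -> R) : (forall x, 0 <= u x) -> rint setT u ->
  [/\ measurable_fun setT (fun x : R => esumZ (fun k => u (x + k%:~R))),
      {ae mu, forall x, D x -> (esumZ (fun k => u (x + k%:~R)%R) < +oo)%E},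
      rint D (fun x => fine (esumZ (fun k => u (x + k%:~R)))) &
      \int[mu]_x u x = \int[mu]_(x in D) fine (esumZ (fun k => u (x + k%:~R)))].
Proof.
move=> u0 iu; have mu_ := rint_meas iu.
pose F (x : R) := esumZ (fun k => u (x + k%:~R)).
have F0 x : (0 <= F x)%E by apply: esumZ_ge0.
have mF : measurable_fun setT F.
  apply: measurable_esum_int => [k|k x _|k x]; rewrite ?lee_fin//.
  by apply/measurable_EFinP; exact: (measurable_fun_shift k%:~R mu_).
have mFD : measurable_fun D F by exact: measurable_funTS.
have eF : (\int[mu]_x (u x)%:E = \int[mu]_(x in D) F x)%E.
  apply: ge0_periodize; first exact/measurable_EFinP.
  by move=> x; rewrite lee_fin.
have iF : mu.-integrable D F.
  apply/integrableP; split => //.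
  under eq_integral do rewrite gee0_abs//.
  by rewrite -eF; exact: integrable_lty iu.
have aF : {ae mu, forall x, D x -> (F x < +oo)%E}.
  have aF0 : {ae mu, forall x, D x -> F x \is a fin_num} by apply: integrable_ae.
  apply: ae_mono aF0 => x H Dx.
  by have := H Dx; rewrite ge0_fin_numE.
have eFF : (\int[mu]_(x in D) F x = \int[mu]_(x in D) (fine (F x))%:E)%E.
  apply: ae_eq_integral => //.
  - by apply/measurable_EFinP; exact: measurableT_comp.
  - by apply: ae_mono aF => x H Dx; rewrite fineK// ge0_fin_numE// H.
split => //.
- apply/integrableP; split; first by apply/measurable_EFinP; exact: measurableT_comp.
  apply: (@le_lt_trans _ _ (\int[mu]_(x in D) (fine (F x))%:E)%E).
    rewrite le_eqVlt; apply/orP; left; apply/eqP; apply: eq_integral => x _.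
    by rewrite [LHS]gee0_abs// lee_fin; apply: fine_ge0; exact: F0.
  by rewrite -eFF -eF; exact: integrable_lty iu.
- by rewrite /Rintegral eF eFF.
Qed.

Lemma periodizeR (u : R -> R) : rint setT u ->
  [/\ {ae mu, forall x, D x -> rsum (fun k => u (x + k%:~R))},
      rint D (fun x => zsumR (fun k => u (x + k%:~R))) &
      \int[mu]_x u x = \int[mu]_(x in D) zsumR (fun k => u (x + k%:~R))].
Proof.
move=> iu; have mu_ := rint_meas iu.
pose p x := Num.max (u x) 0; pose n x := Num.max (- u x) 0.
have p0 x : 0 <= p x by rewrite /p le_max lexx orbT.
have n0 x : 0 <= n x by rewrite /n le_max lexx orbT.
have mp : measurable_fun setT p by apply: measurable_maxr => //; exact: measurable_cst.
have mn : measurable_fun setT n.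
  by apply: measurable_maxr; [exact: measurable_funN|exact: measurable_cst].
have ia : rint setT (fun x => `|u x|) by exact: (integrable_norm iu).
have ip_ : rint setT p.
  apply: (rint_le _ mp _ ia) => // x _; rewrite ger0_norm// /p ge_max ler_norm normr_ge0//.
have in_ : rint setT n.
  apply: (rint_le _ mn _ ia) => // x _; rewrite ger0_norm// /n ge_max -normrN ler_norm normr_ge0//.
have [_ _ ip1 ep] := ge0_periodizeR p0 ip_.
have [_ _ in1 en] := ge0_periodizeR n0 in_.
have [_ aa _ _] := ge0_periodizeR (fun x => normr_ge0 (u x)) ia.
have uE : u = (fun x => p x - n x).
  by apply/funext => x; rewrite /p /n; case: (leP (u x) 0); case: (leP (- u x) 0); lra.
split => //.
- exact: rintB ip1 in1.
- by rewrite {1}uE RintegralB// ep en -RintegralB.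
Qed.

Lemma periodizeC f : cintble setT f ->
  [/\ {ae mu, forall x, D x -> csum (fun k => f (x + k%:~R))},
      cintble D (fun x => zsum (fun k => f (x + k%:~R))) &
      cint setT f = cint D (fun x => zsum (fun k => f (x + k%:~R)))].
Proof.
move=> [i1 i2]; have [a1 c1 e1] := periodizeR i1; have [a2 c2 e2] := periodizeR i2.
split => //; first by apply: ae_mono2 a1 a2 => x r1 r2 Dx; split; [exact: r1|exact: r2].
by rewrite /cint e1 e2.
Qed.

(** [brk] and [PhiE] take functions already on the Fourier side and use [cj] and [nsq]; [bracketE]
    and [Phi_PhiE] relate them to the notions of the statement. *)
Definition brk f g (x : R) : C := zsum (fun k => f (x + k%:~R) * cj (g (x + k%:~R))).

Definition PhiE f (x : R) : \bar R := esumZ (fun k => nsq (f (x + k%:~R))).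

Lemma PhiE_ge0 f x : (0 <= PhiE f x)%E.
Proof. by apply: esumZ_ge0. Qed.

Lemma PhiE_fin f : L2on setT f -> {ae mu, forall x, D x -> (PhiE f x < +oo)%E}.
Proof. by move=> [mf nf]; have [] := ge0_periodizeR (fun x => nsq_ge0 (f x)) nf. Qed.

Lemma PhiE_int f : L2on setT f -> rint D (fun x => fine (PhiE f x)).
Proof. by move=> [mf nf]; have [] := ge0_periodizeR (fun x => nsq_ge0 (f x)) nf. Qed.

Lemma brk_self f x : brk f f x = (fine (PhiE f x))%:C.
Proof. by rewrite /brk; under eq_fun do rewrite mulJ_nsq; rewrite zsum_real. Qed.

Lemma brk_CS f g x : (PhiE f x < +oo)%E -> (PhiE g x < +oo)%E ->
  nsq (brk f g x) <= fine (PhiE f x) * fine (PhiE g x).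
Proof. exact: zsum_CS. Qed.

Lemma brk_int f g : L2on setT f -> L2on setT g -> cintble D (brk f g).
Proof.
by move=> Lf Lg; have [] := periodizeC (cintble_mul measurableT Lf Lg).
Qed.

(** The characters are 1-periodic, so they leave the periodizing sum, at almost every point, where
    the bracket converges absolutely. *)
Lemma ip_brk f g k j : L2on setT f -> L2on setT g ->
  ip setT (fun x => E k x * f x) (fun x => E j x * g x) =
  cint D (fun x => E k x * cj (E j x) * brk f g x).
Proof.
move=> Lf Lg.
have LE h m : L2on setT h -> L2on setT (fun x => E m x * h x).
  by apply: (L2onM_bounded _ (M := 1)) => // [|x _]; [exact: cmeasE|rewrite nsqE].
have [_ _ e] := periodizeC (cintble_mul measurableT (LE _ k Lf) (LE _ j Lg)).
rewrite /ip e.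
have m1 : cmeas D (fun x => zsum (fun n => E k (x + n%:~R) * f (x + n%:~R) * cj (E j (x + n%:~R) * g (x + n%:~R)))).
  apply: cintble_meas.
  by have [] := periodizeC (cintble_mul measurableT (LE _ k Lf) (LE _ j Lg)).
apply: ae_eq_cint => //.
  apply: cmeasM; last by apply: cintble_meas; exact: brk_int.
  by apply: cmeasM; [exact: cmeasE|apply: cmeasJ; exact: cmeasE].
apply: ae_mono2 (PhiE_fin Lf) (PhiE_fin Lg) => x ff fg Dx.
rewrite /brk -zsumZ; last by apply: csum_mul; [exact: ff|exact: fg].
by congr zsum; apply/funext => n; rewrite !E_per conjM; ring.
Qed.

End Periodization.

(** * The Fourier transform on L^2 *)

Section Plancherel.
Context {R : realType}.
Local Notation C := (R[i]).
Local Notation mu := (@lebesgue_measure R).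
Local Notation D := (@D01 R).
Implicit Types (f h u v : R -> C) (g : R).

Lemma Rint_dominated (B : set R) (u : nat -> R -> R) (f h : R -> R) : measurable B ->
  (forall n, measurable_fun B (u n)) -> measurable_fun B f ->
  (forall x, B x -> (fun n => u n x) @ \oo --> f x) -> rint B h ->
  (forall n x, B x -> `|u n x| <= h x) ->
  (fun n => \int[mu]_(x in B) u n x) @ \oo --> \int[mu]_(x in B) f x.
Proof.
move=> mB mu_ mf uf ih uh.
have m n : measurable_fun B (EFin \o u n) by exact/measurable_EFinP.
have mf' : measurable_fun B (EFin \o f) by exact/measurable_EFinP.
have [||if_ _ c] := @dominated_convergence _ _ _ mu B mB
    (fun n => EFin \o u n) (EFin \o f) (EFin \o h) m mf' _ ih _.
- apply: aeW => x Bx; apply: cvg_EFin; first by near=> n.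
  exact: (uf x Bx).
- by apply: aeW => x n Bx; rewrite lee_fin uh.
apply: fine_cvg; rewrite /Rintegral fineK//.
exact: (integrable_fin_num (mu := mu) mB if_).
Unshelve. all: end_near.
Qed.

Lemma cint_dominated (B : set R) (u : nat -> R -> C) f (h : R -> R) : measurable B ->
  (forall n, cmeas B (u n)) -> cmeas B f ->
  (forall x, B x -> ccvg (fun n => u n x) (f x)) -> rint B h ->
  (forall n x, B x -> cnorm (u n x) <= h x) ->
  ccvg (fun n => cint B (u n)) (cint B f).
Proof.
move=> mB mu_ [mf1 mf2] uf ih uh; split; apply: Rint_dominated ih _ => //.
- by move=> n; have [] := mu_ n.
- by move=> x /uf [].
- move=> n x Bx; apply: le_trans (uh n x Bx).
  by rewrite cnormE -sqrtr_sqr ler_sqrt ?nsq_ge0// lerDl sqr_ge0.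
- by move=> n; have [] := mu_ n.
- by move=> x /uf [].
- move=> n x Bx; apply: le_trans (uh n x Bx).
  by rewrite cnormE -sqrtr_sqr ler_sqrt ?nsq_ge0// lerDr sqr_ge0.
Qed.

Lemma ccvg_cst (c : C) : ccvg (fun=> c) c.
Proof. by split; exact: cvg_cst. Qed.

Lemma ccvgM (z w : nat -> C) a b : ccvg z a -> ccvg w b -> ccvg (fun n => z n * w n) (a * b).
Proof.
move=> [z1 z2] [w1 w2]; split.
- by under eq_fun do rewrite ReM; rewrite ReM; apply: cvgB; apply: cvgM.
- by under eq_fun do rewrite ImM; rewrite ImM; apply: cvgD; apply: cvgM.
Qed.

Lemma cnormM (z w : C) : cnorm (z * w) = cnorm z * cnorm w.
Proof. by rewrite !cnormE nsqM sqrtrM. Qed.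

Definition Kf (x g : R) : C := expi (- (2 * pi * x * g)).

Lemma cnorm_Kf x g : cnorm (Kf x g) = 1.
Proof. by rewrite cnormE nsq_expi sqrtr1. Qed.

Lemma cmeas_expi (A : set R) (v : R -> R) : measurable A -> measurable_fun A v -> cmeas A (fun x => expi (v x)).
Proof.
move=> mA mv.
have [mc ms] : measurable_fun setT (@cos R) /\ measurable_fun setT (@sin R).
  split; apply: continuous_measurable_fun; [exact: continuous_cos|exact: continuous_sin].
by split; [exact: (measurableT_comp mc mv)|exact: (measurableT_comp ms mv)].
Qed.

Lemma cmeas_Kf g : cmeas setT (Kf ^~ g).
Proof.
apply: cmeas_expi => //; apply: measurable_funN; apply: measurable_funM => //.
Qed.

Lemma cintble_Kf u g : cintble setT u -> cintble setT (fun x => u x * Kf x g).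
Proof.
move=> /(cintble_normP measurableT) [mu_ iu]; apply/(cintble_normP measurableT); split.
  by apply: cmeasM => //; exact: cmeas_Kf.
by under eq_fun do rewrite cnormM cnorm_Kf mulr1.
Qed.

Lemma fourierL1E u g : fourierL1 u g = cint setT (fun x => u x * Kf x g).
Proof. by []. Qed.

(** Dominated convergence, since the kernel is unimodular. Continuity is used only to obtain
    measurability of the transform. *)
Lemma ft_seq_cts u (g_ : nat -> R) g : cintble setT u -> g_ @ \oo --> g ->
  ccvg (fun n => fourierL1 u (g_ n)) (fourierL1 u g).
Proof.
move=> iu gg; have [mu_ nu] := (cintble_normP measurableT u).1 iu.
apply: (@cint_dominated setT (fun n x => u x * Kf x (g_ n)) _ (fun x => cnorm (u x))) => //.
- by move=> n; apply: cintble_meas; exact: cintble_Kf.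
- by apply: cintble_meas; exact: cintble_Kf.
- move=> x _; apply: ccvgM; first exact: ccvg_cst.
  have c : (fun n => - (2 * pi * x * g_ n)) @ \oo --> - (2 * pi * x * g).
    by apply: cvgN; apply: cvgM => //; exact: cvg_cst.
  split.
  + by apply: (cvg_comp _ _ c); exact: continuous_cos.
  + by apply: (cvg_comp _ _ c); exact: continuous_sin.
- by move=> n x _; rewrite cnormM cnorm_Kf mulr1.
Qed.

Lemma ft_meas u : cintble setT u -> cmeas setT (fourierL1 u).
Proof.
move=> iu; split; apply: continuous_measurable_fun => g; apply/(@cvg_nbhsP _ R^o) => w wg.
- by have [] := ft_seq_cts iu wg.
- by have [] := ft_seq_cts iu wg.
Qed.

Lemma ftD u v : cintble setT u -> cintble setT v ->
  fourierL1 (u \+ v) = fourierL1 u \+ fourierL1 v.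
Proof.
move=> iu iv; apply/funext => g; rewrite /= !fourierL1E -cintD; [|by []|exact: cintble_Kf|exact: cintble_Kf].
by apply: eq_cint => x _; rewrite /= mulrDl.
Qed.

Lemma ftZ c u : cintble setT u -> fourierL1 (fun x => c * u x) = fun g => c * fourierL1 u g.
Proof.
move=> iu; apply/funext => g; rewrite !fourierL1E -cintZ; [|by []|exact: cintble_Kf].
by apply: eq_cint => x _; rewrite /= mulrA.
Qed.

Lemma ftB u v : cintble setT u -> cintble setT v ->
  fourierL1 (u \- v) = fourierL1 u \- fourierL1 v.
Proof.
move=> iu iv; have E (a b : R -> C) : a \- b = a \+ (fun x => (-1) * b x).
  by apply/funext => x; rewrite /= mulN1r.
rewrite (E u v) (E (fourierL1 u)) -ftZ// ftD//; exact: cintbleZ.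
Qed.

Lemma KfD x y g : Kf (x + y) g = Kf x g * Kf y g.
Proof. by rewrite /Kf -expiD; congr expi; ring. Qed.

Lemma Kf_int (k : int) g : Kf k%:~R g = E k g.
Proof. by []. Qed.

Lemma ft_translate (k : int) u : cintble setT u ->
  fourierL1 (translate k u) = fun g => E k g * fourierL1 u g.
Proof.
move=> iu; apply/funext => g; rewrite !fourierL1E.
have iK := cintble_Kf g iu.
rewrite -(@cint_shift _ (k%:~R)); last first.
  apply: cmeasM; last exact: cmeas_Kf.
  by apply: (cmeas_shift (- k%:~R)); exact: cintble_meas.
rewrite -cintZ//; apply: eq_cint => x _.
by rewrite /translate addrK KfD Kf_int; ring.
Qed.

Lemma Kf_shift x (g : R) (k : int) : Kf x (g + k%:~R) = Kf x g * Kf x k%:~R.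
Proof. by rewrite /Kf -expiD; congr expi; ring. Qed.

Lemma Kf_intr x (j k : int) : Kf (x + j%:~R) k%:~R = E k x.
Proof.
rewrite -(E_per k j) /E /Kf; congr expi; ring.
Qed.

(** Bounded measurable functions of bounded support: their periodizing sums have finitely many
    terms, so the Zak transform is a finite sum. *)
Definition bcs u := cmeas setT u /\ exists N : nat, exists M : R, forall x,
  nsq (u x) <= M /\ (`|x| > N%:R -> u x = 0).

Lemma bcsB u v : bcs u -> bcs v -> bcs (u \- v).
Proof.
move=> [mu_ [N [M uM]]] [mv [N' [M' vM]]]; split; first exact: cmeasB.
exists (maxn N N'), (2 * M + 2 * M') => x; have [u1 u2] := uM x; have [v1 v2] := vM x; split.
  by apply: le_trans (nsqD_le _ _) _; rewrite nsqN lerD// ler_pM2l.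
move=> xN; rewrite /= u2 ?v2 ?subrr//; apply: le_lt_trans xN; rewrite ler_nat ?leq_maxl ?leq_maxr//.
Qed.

Lemma bcs_supp u : bcs u -> exists2 s : seq int, uniq s &
  forall x k, D x -> k \notin s -> u (x + k%:~R) = 0.
Proof.
move=> [_ [N [M uM]]].
(* The integers from -(N+1) to N: with 0 <= x < 1, |x + k| <= N leaves no other k. *)
exists [seq (i%:Z - N.+1%:Z) | i <- iota 0 (N.+1 + N.+1)%N].
  rewrite map_inj_uniq ?iota_uniq// => i j /addIr [].
  by [].
move=> x k Dx H; have /andP[x0 x1] : 0 <= x < 1 by move: Dx; rewrite /D01/= in_itv.
apply: (uM _).2.
apply: contrapT => /negP; rewrite -leNgt ler_norml => /andP[h1 h2]; apply: (negP H); apply/mapP.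
have e : (N.+1%:Z)%:~R = N%:R + 1 :> R by rewrite natr1.
have k1 : (- N.+1%:Z <= k)%R.
  rewrite -(ler_int R) mulrNz e; lra.
have k2 : (k < N.+1%:Z)%R.
  rewrite -(ltr_int R) e; lra.
exists (absz (k + N.+1%:Z)).
  by rewrite mem_iota; lia.
lia.
Qed.

Lemma bounded_L2D u : cmeas setT u -> (exists M : R, forall x, nsq (u x) <= M) -> L2on D u.
Proof.
move=> [m1 m2] [M uM]; apply: (@L2on_bounded _ _ M) => //.
by split; exact: measurable_funTS.
Qed.

Lemma bcs_shift_L2D u (a : R) : bcs u -> L2on D (fun x => u (x + a)).
Proof.
move=> [mu_ [N [M uM]]]; apply: bounded_L2D; first exact: cmeas_shift.
by exists M => x; have [] := uM (x + a).
Qed.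

Lemma bcs_nrm2 u s : bcs u -> uniq s ->
  (forall x k, D x -> k \notin s -> u (x + k%:~R) = 0) ->
  (\int[mu]_x (nsq (u x))%:E = (\sum_(j <- s) nrm2 D (fun x => u (x + j%:~R)))%:E)%E.
Proof.
move=> bu us su; have [mu_ _] := bu.
rewrite ge0_periodize; last 2 first.
- by apply/measurable_EFinP; exact: cmeas_nsq.
- by move=> x; rewrite lee_fin.
transitivity (\int[mu]_(x in D) (\sum_(j <- s) (nsq (u (x + j%:~R)%R))%:E))%E.
  apply: eq_integral => x /set_mem Dx; rewrite -/(esumZ (fun k => nsq (u (x + k%:~R)))) (esumZ_finsupp us)//.
    by rewrite -sumEFin.
  by move=> k ks; rewrite su// nsq0.
rewrite ge0_integral_sum//.
- rewrite -sumEFin; apply: eq_bigr => j _; rewrite nrm2_EFin//.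
  exact: bcs_shift_L2D.
- move=> j; apply/measurable_EFinP; apply: cmeas_nsq => //.
  by have [] := bcs_shift_L2D j%:~R bu.
- by move=> j x _; rewrite lee_fin.
Qed.

Lemma bcs_L2 u : bcs u -> L2on setT u.
Proof.
move=> bu; have [s us su] := bcs_supp bu; have [mu_ _] := bu.
have e := bcs_nrm2 bu us su.
have [|//] := @nrm2_le_ereal _ setT measurableT u (\sum_(j <- s) nrm2 D (fun x => u (x + j%:~R))) mu_.
by rewrite e.
Qed.

Lemma bcs_L1 u : bcs u -> cintble setT u.
Proof.
move=> bu; have [mu_ [N [M uM]]] := bu; apply/(cintble_normP measurableT); split => //.
have Lu := bcs_L2 bu.
(* |u| <= |u|^2 + w, where the indicator w of [-N, N] is itself in the class, hence in L^2 by
   [bcs_L2]. *)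
pose w (x : R) : C := (\1_(`[- N%:R, N%:R]%classic) x : R)%:C.
have bw : bcs w.
  split; first by apply: cmeasR; exact: measurable_indic.
  exists N, 1 => x; split; first exact: (nsq_ind_le1 `[- N%:R, N%:R]%classic x).
  move=> xN; rewrite /w indicE memNset//= in_itv/= -ler_norml.
  by apply/negP; rewrite -ltNge.
have [_ nw] := bcs_L2 bw; have [_ nu] := Lu.
apply: (rint_le _ _ _ (rintD measurableT nu nw)) => //; first exact: cmeas_cnorm.
move=> x _; rewrite ger0_norm//.
have [xN|xN] := leP `|x| N%:R.
  have -> : w x = 1 by rewrite /w indicE mem_set//= in_itv/= -ler_norml.
  rewrite -cnorm_sq (_ : nsq 1 = 1); last by rewrite /nsq /=; ring.
  by have := sqr_ge0 (cnorm (u x) - 1); have := cnorm_ge0 (u x); nra.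
by rewrite ((uM x).2 xN) cnormE nsq0 sqrtr0 add0r.
Qed.


(* The values of the transform of u on g + Z are the Fourier coefficients of the
   Zak transform of u, so that Parseval's identity gives Plancherel's. *)
Lemma bcs_ft_coef u s g (k : int) : bcs u -> uniq s ->
  (forall x k, D x -> k \notin s -> u (x + k%:~R) = 0) ->
  fourierL1 u (g + k%:~R) =
  coef (fun x => Kf x g * \sum_(j <- s) E j g * u (x + j%:~R)) (- k).
Proof.
move=> bu us su; rewrite fourierL1E.
have [_ _ ->] := periodizeC (cintble_Kf (g + k%:~R) (bcs_L1 bu)).
rewrite /coef /ip; apply: eq_cint => x /set_mem Dx.
rewrite (zsum_finsupp us); last by move=> n ns; rewrite su// mul0r.
rewrite cjE_ opprK mulr_sumr mulr_suml; apply: eq_bigr => j _.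
rewrite Kf_shift Kf_intr KfD Kf_int; ring.
Qed.

Lemma bcs_Zak_L2 u s g : bcs u ->
  L2on D (fun x => \sum_(j <- s) E j g * u (x + j%:~R)).
Proof.
move=> bu; apply: (@L2on_sum _ D _ _ s (fun j x => E j g * u (x + j%:~R))) => // j.
by apply: L2onZ => //; exact: bcs_shift_L2D.
Qed.

Lemma esumZ_oppr (a : int -> R) : (forall k, 0 <= a k) -> esumZ (fun k => a (- k)) = esumZ a.
Proof.
move=> a0; rewrite /esumZ [RHS](@reindex_esum _ _ _ [set: int] [set: int] -%R)//.
Qed.

Lemma bcs_PhiE_ft u s g : bcs u -> uniq s ->
  (forall x k, D x -> k \notin s -> u (x + k%:~R) = 0) ->
  PhiE (fourierL1 u) g = (nrm2 D (fun x => \sum_(j <- s) E j g * u (x + j%:~R)))%:E.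
Proof.
move=> bu us su; rewrite /PhiE.
under eq_fun do rewrite (bcs_ft_coef _ _ bu us su).
set Z := fun x => _ * _.
rewrite (@esumZ_oppr (fun k => nsq (coef Z k)))//.
have LS := bcs_Zak_L2 s g bu.
have nK x : nsq (Kf x g) = 1 by exact: nsq_expi.
have mK : cmeas D (Kf ^~ g) by have [m1 m2] := cmeas_Kf g; split; exact: measurable_funTS.
have LZ : L2on D Z.
  by apply: (L2onM_bounded _ (M := 1)) => // x _; rewrite nK.
rewrite [LHS]parseval//; congr EFin; apply: eq_Rintegral => x _.
by rewrite /Z nsqM nK mul1r.
Qed.

(** By [bcs_PhiE_ft] the sum of |u^|^2 over g + Z is the squared norm of the Zak transform.
    Expanded, it is a double sum of a j l E_j conj(E_l); integrating over g in D keeps the diagonal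
    only, that is the squared norms of the unit pieces of u. *)
Lemma bcs_plancherel u : bcs u -> L2on setT (fourierL1 u) /\ nrm2 setT (fourierL1 u) = nrm2 setT u.
Proof.
move=> bu; have [s us su] := bcs_supp bu.
have mf := ft_meas (bcs_L1 bu).
pose a j l := ip D (fun x => u (x + j%:~R)) (fun x => u (x + l%:~R)).
have Lj j := bcs_shift_L2D j%:~R bu.
have aE g : (nrm2 D (fun x => \sum_(j <- s) E j g * u (x + j%:~R)))%:C =
    \sum_(j <- s) \sum_(l <- s) a j l * (E j g * cj (E l g)).
  have LF j : L2on D (fun x => E j g * u (x + j%:~R)) by apply: L2onZ.
  rewrite -ipff// (ip_suml mD01 s (bcs_Zak_L2 s g bu) LF); apply: eq_bigr => j _.
  rewrite (ip_sumr mD01 s (LF j) LF); apply: eq_bigr => l _.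
  by rewrite ipZl// ipZr// /a; ring.
pose P g := \sum_(j <- s) \sum_(l <- s) a j l * (E j g * cj (E l g)).
have Lc j l : cintble D (fun g => a j l * (E j g * cj (E l g))).
  by apply: cintbleZ => //; apply: cintble_mul => //; exact: E_L2.
have cints (I : Type) (r : seq I) (F : I -> R -> C) : (forall i, cintble D (F i)) ->
    cintble D (fun x => \sum_(i <- r) F i x) /\ cint D (fun x => \sum_(i <- r) F i x) = \sum_(i <- r) cint D (F i).
  move=> cF; elim: r => [|i r [IH1 IH2]].
    under eq_fun do rewrite big_nil; rewrite big_nil; split.
      by split; exact: integrable0.
    by rewrite /cint; apply: complex_eq => /=; rewrite Rintegral_cst// mul0r.
  under eq_fun do rewrite big_cons; rewrite big_cons -IH2 -cintD//; split => //.
  exact: cintbleD.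
have [cP1 cP2] := cints _ s _ (fun j => (cints _ s _ (Lc j)).1).
have tot : cint D P = (\sum_(j <- s) nrm2 D (fun x => u (x + j%:~R)))%:C.
  rewrite /P cP2 raddf_sum big_seq [RHS]big_seq; apply: eq_bigr => j js.
  rewrite (cints _ s _ (Lc j)).2 (bigD1_seq j)//= big1 ?addr0 => [|l lj].
    rewrite cintZ; last by apply: cintble_mul => //; exact: E_L2.
      by rewrite -/(ip D (E j) (E j)) ipE eqxx mulr1 /a ipff.
    by [].
  rewrite cintZ; last by apply: cintble_mul => //; exact: E_L2.
    by rewrite -/(ip D (E j) (E l)) ipE eq_sym (negbTE lj) mulr0.
  by [].
have iN : rint D (fun g => nrm2 D (fun x => \sum_(j <- s) E j g * u (x + j%:~R))).
  have [r1 _] := cP1; move: r1; congr (rint D _); apply/funext => g.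
  by rewrite -aE.
have eN : \int[mu]_(g in D) nrm2 D (fun x => \sum_(j <- s) E j g * u (x + j%:~R)) =
    \sum_(j <- s) nrm2 D (fun x => u (x + j%:~R)).
  transitivity (Re (cint D P)); last by rewrite tot.
  rewrite /cint /=; apply: eq_Rintegral => g _; by rewrite /P -aE.
have eu := bcs_nrm2 bu us su.
have ef : (\int[mu]_g (nsq (fourierL1 u g))%:E = (\sum_(j <- s) nrm2 D (fun x => u (x + j%:~R)))%:E)%E.
  rewrite ge0_periodize; last 2 first.
  - by apply/measurable_EFinP; exact: cmeas_nsq.
  - by move=> x; rewrite lee_fin.
  transitivity (\int[mu]_(g in D) (nrm2 D (fun x => \sum_(j <- s) E j g * u (x + j%:~R)))%:E)%E.
    by apply: eq_integral => g _; rewrite -(bcs_PhiE_ft g bu us su).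
  rewrite -eN /Rintegral fineK//.
  exact: (integrable_fin_num (mu := mu) mD01 iN).
split; last by rewrite /nrm2 /Rintegral ef eu.
have [|//] := @nrm2_le_ereal _ setT measurableT (fourierL1 u) (\sum_(j <- s) nrm2 D (fun x => u (x + j%:~R))) mf.
by rewrite ef.
Qed.


(** Cutting both the argument and the values keeps the function in [bcs], and at each point the
    truncation is eventually equal to u. *)
Definition trunc u (n : nat) (x : R) : C :=
  ind ([set x | `|x| <= n%:R] `&` [set x | nsq (u x) <= n%:R]) x * u x.

Lemma trunc_cases u n x : trunc u n x = u x \/ trunc u n x = 0.
Proof.
by rewrite /trunc /ind indicE; case: (_ \in _); [left; rewrite mul1r|right; rewrite mul0r].
Qed.

Lemma trunc_bcs u n : cmeas setT u -> bcs (trunc u n).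
Proof.
move=> mu_; have mA : measurable ([set x | `|x| <= n%:R] `&` [set x | nsq (u x) <= n%:R] : set R).
  apply: measurableI.
    rewrite (_ : [set x | _] = `[- n%:R, n%:R]%classic); first exact: measurable_itv.
    by apply/seteqP; split => x; rewrite /= in_itv/= ler_norml.
  rewrite (_ : [set x | _] = setT `&` (fun x => nsq (u x)) @^-1` `]-oo, n%:R]%classic).
    by apply: cmeas_nsq.
  by rewrite setTI; apply/seteqP; split => x; rewrite /= in_itv.
split; first by apply: cmeasM => //; exact: cmeas_ind.
exists n, n%:R => x; rewrite /trunc /ind indicE.
have [/set_mem [/= xn un]|nA] := boolP (x \in _).
  by rewrite mul1r; split => //; rewrite ltNge xn.
by rewrite mul0r nsq0.
Qed.

Lemma trunc_ev u x : exists N, forall n, (N <= n)%N -> trunc u n x = u x.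
Proof.
have [N hN] : exists N : nat, `|x| <= N%:R /\ nsq (u x) <= N%:R.
  exists (maxn (Num.truncn `|x|).+1 (Num.truncn (nsq (u x))).+1); split.
  - by apply: ltW; apply: lt_le_trans (truncnS_gt _) _; rewrite ler_nat leq_maxl.
  - by apply: ltW; apply: lt_le_trans (truncnS_gt _) _; rewrite ler_nat leq_maxr.
exists N => n Nn; rewrite /trunc /ind indicE mem_set ?mul1r//; split => /=.
- by apply: le_trans hN.1 _; rewrite ler_nat.
- by apply: le_trans hN.2 _; rewrite ler_nat.
Qed.

Lemma trunc_ccvg u x : ccvg (fun n => trunc u n x) (u x).
Proof.
have [N H] := trunc_ev u x.
by split; apply: cvg_near_cst; exists N => // n Nn; rewrite (H n Nn).
Qed.

Lemma trunc_cvgL2 u : L2on setT u -> cvgL2 setT (trunc u) u.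
Proof.
move=> Lu; have [mu_ nu] := Lu.
apply: (@L2_dominated _ setT _ _ (fun x => nsq (u x))) => //.
- by move=> n; apply: bcs_L2; exact: trunc_bcs.
- by apply: aeW => x _; exact: trunc_ccvg.
- move=> n x _; case: (trunc_cases u n x) => ->; first by rewrite subrr nsq0.
  by rewrite sub0r nsqN.
Qed.

Lemma ft_trunc_ccvg u g : cintble setT u ->
  ccvg (fun n => fourierL1 (trunc u n) g) (fourierL1 u g).
Proof.
move=> iu; have [mu_ nu] := (cintble_normP measurableT u).1 iu.
apply: (@cint_dominated setT (fun n x => trunc u n x * Kf x g) _ (fun x => cnorm (u x))) => //.
- move=> n; apply: cintble_meas; apply: cintble_Kf; apply: bcs_L1; exact: trunc_bcs.
- by apply: cintble_meas; exact: cintble_Kf.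
- by move=> x _; apply: ccvgM; [exact: trunc_ccvg|exact: ccvg_cst].
- move=> n x _; rewrite cnormM cnorm_Kf mulr1.
  by case: (trunc_cases u n x) => -> //; rewrite cnormE nsq0 sqrtr0.
Qed.

Lemma cvgL2_cauchy (B : set R) (w : nat -> R -> C) f : measurable B ->
  (forall n, L2on B (w n)) -> L2on B f -> cvgL2 B w f -> cauchyL2 B w.
Proof.
move=> mB Lw Lf wf e e0; have e2 : 0 < e / 2 by rewrite divr_gt0.
have [N HN] := wf _ e2; exists N => n m Nn Nm.
apply: le_trans (nrm_triangleB mB (Lw n) Lf (Lw m)) _.
by rewrite [leRHS](splitr e); apply: lerD; [exact: HN|rewrite nrmBC; exact: HN].
Qed.

Lemma cvgL2_nrm (B : set R) (w : nat -> R -> C) f : measurable B ->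
  (forall n, L2on B (w n)) -> L2on B f -> cvgL2 B w f ->
  (fun n => nrm B (w n)) @ \oo --> nrm B f.
Proof.
move=> mB Lw Lf wf; apply/cvgrPdist_le => e e0; have [N HN] := wf _ e0.
exists N => // n Nn; rewrite distrC ler_norml; apply/andP; split.
- have := nrm_le_add mB Lf (Lw n); rewrite nrmBC; have := HN n Nn; lra.
- have := nrm_le_add mB (Lw n) Lf; have := HN n Nn; lra.
Qed.

(** The transforms of the truncations converge pointwise to the transform of u by dominated
    convergence, and are Cauchy in L^2 by the case already treated; [L2_cauchy_ae] identifies the
    two limits. *)
Lemma plancherel u : cintble setT u -> L2on setT u ->
  L2on setT (fourierL1 u) /\ nrm setT (fourierL1 u) = nrm setT u.
Proof.
move=> iu Lu; have [mu_ _] := Lu.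
have bt n := trunc_bcs n mu_.
have Lt n : L2on setT (trunc u n) by exact: bcs_L2.
have Lft n : L2on setT (fourierL1 (trunc u n)) by have [] := bcs_plancherel (bt n).
have nft v : bcs v -> nrm setT (fourierL1 v) = nrm setT v.
  by move=> bv; rewrite /nrm; have [_ ->] := bcs_plancherel bv.
have tu := trunc_cvgL2 Lu.
have ct := cvgL2_cauchy measurableT Lt Lu tu.
have cft : cauchyL2 setT (fun n => fourierL1 (trunc u n)).
  move=> e e0; have [N HN] := ct e e0; exists N => n m Nn Nm.
  by rewrite -ftB ?nft; [exact: HN|exact: bcsB|exact: bcs_L1|exact: bcs_L1].
have ae1 : {ae mu, forall x, setT x -> ccvg (fun n => fourierL1 (trunc u n) x) (fourierL1 u x)}.
  by apply: aeW => x _; exact: ft_trunc_ccvg.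
have [Lf cf] := L2_cauchy_ae measurableT Lft (ft_meas iu) ae1 cft.
split => //.
have c1 := cvgL2_nrm measurableT Lft Lf cf; have c2 := cvgL2_nrm measurableT Lt Lu tu.
have e : (fun n => nrm setT (fourierL1 (trunc u n))) = (fun n => nrm setT (trunc u n)).
  by apply/funext => n; rewrite nft.
by move: c1; rewrite e => c1; exact: cvg_unique c1 c2.
Qed.

(** [is_fourier] with real norms. It remains a relation because the transform is determined only
    almost everywhere: [fourier] is one choice, and [fourierP] is the access to it. *)
Definition isF f h : Prop := L2on setT h /\ exists w : nat -> R -> C,
  [/\ forall n, cintble setT (w n) /\ L2on setT (w n),
      cvgL2 setT w f & cvgL2 setT (fun n => fourierL1 (w n)) h].

Lemma L2cvgP (w : nat -> R -> C) f : (forall n, L2on setT (w n)) -> L2on setT f ->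
  L2cvg w f <-> cvgL2 setT w f.
Proof.
move=> Lw Lf; rewrite /L2cvg.
have E n : norm2 (w n \- f) = (nrm setT (w n \- f))%:E.
  by apply: norm2E; exact: L2onB.
under eq_fun do rewrite E.
split.
- move=> c e e0; move/fine_cvgP: c => [_] /cvgrPdist_le /(_ e e0) [N _ HN].
  by exists N => n Nn; have := HN n Nn; rewrite /= sub0r normrN ger0_norm.
- move=> c; apply: cvg_EFin; first by near=> n.
  apply/cvgrPdist_le => e e0; have [N HN] := c e e0; exists N => // n Nn.
  by rewrite /= sub0r normrN ger0_norm// HN.
Unshelve. all: end_near.
Qed.

Lemma isFP f h : L2on setT f -> is_fourier f h <-> isF f h.
Proof.
move=> Lf; split.
- move=> [/L2P Lh [w [w1 w2 w3]]]; split => //; exists w.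
  have w1' n : cintble setT (w n) /\ L2on setT (w n).
    by have [/L1P a /L2P b] := w1 n.
  split => //.
  + by apply/L2cvgP => // n; have [] := w1' n.
  + apply/L2cvgP => // n; have [a b] := w1' n; by have [] := plancherel a b.
- move=> [Lh [w [w1 w2 w3]]]; split; first exact/L2P.
  exists w; split.
  + by move=> n; have [/L1P a /L2P b] := w1 n.
  + by apply/L2cvgP => // n; have [] := w1 n.
  + by apply/L2cvgP => // n; have [a b] := w1 n; have [] := plancherel a b.
Qed.

Lemma isF_exists f : L2on setT f -> exists h, isF f h.
Proof.
move=> Lf; have [mf _] := Lf.
have bt n := trunc_bcs n mf.
have wt n : cintble setT (trunc f n) /\ L2on setT (trunc f n) by split; [exact: bcs_L1|exact: bcs_L2].
have tf := trunc_cvgL2 Lf.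
have ct := cvgL2_cauchy measurableT (fun n => (wt n).2) Lf tf.
have pl v : bcs v -> L2on setT (fourierL1 v) /\ nrm setT (fourierL1 v) = nrm setT v.
  by move=> bv; apply: plancherel; [exact: bcs_L1|exact: bcs_L2].
have cft : cauchyL2 setT (fun n => fourierL1 (trunc f n)).
  move=> e e0; have [N HN] := ct e e0; exists N => n m Nn Nm.
  by rewrite -ftB ?(pl _ _).2; [exact: HN|exact: bcsB|exact: bcs_L1|exact: bcs_L1].
have [h [Lh ch]] := L2_complete measurableT (fun n => (pl _ (bt n)).1) cft.
by exists h; split => //; exists (trunc f).
Qed.

Lemma isF_nrm f h : L2on setT f -> isF f h -> nrm setT h = nrm setT f.
Proof.
move=> Lf [Lh [w [w1 w2 w3]]].
have c2 := cvgL2_nrm measurableT (fun n => (w1 n).2) Lf w2.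
have c1 := cvgL2_nrm measurableT (fun n => (plancherel (w1 n).1 (w1 n).2).1) Lh w3.
have e : (fun n => nrm setT (fourierL1 (w n))) = (fun n => nrm setT (w n)).
  by apply/funext => n; rewrite (plancherel (w1 n).1 (w1 n).2).2.
by move: c1; rewrite e => c1; exact: cvg_unique c1 c2.
Qed.

Lemma cvgL2_comb (B : set R) (w w' : nat -> R -> C) f f' (c : C) : measurable B ->
  (forall n, L2on B (w n)) -> (forall n, L2on B (w' n)) -> L2on B f -> L2on B f' ->
  cvgL2 B w f -> cvgL2 B w' f' ->
  cvgL2 B (fun n x => w n x + c * w' n x) (fun x => f x + c * f' x).
Proof.
move=> mB Lw Lw' Lf Lf' wf wf' e e0.
have e2 : 0 < e / 2 by rewrite divr_gt0.
have c1 : 0 < cnorm c + 1 by rewrite ltr_wpDl.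
have [N HN] := wf _ e2; have [N' HN'] := wf' _ (divr_gt0 e2 c1).
exists (maxn N N') => n; rewrite geq_max => /andP[Nn Nn'].
rewrite (_ : _ \- _ = (w n \- f) \+ (fun x => c * (w' n \- f') x)); last first.
  by apply/funext => x /=; ring.
have L1 := L2onB mB (Lw n) Lf; have L2 := L2onB mB (Lw' n) Lf'.
apply: le_trans (nrm_triangle mB L1 (L2onZ mB c L2)) _.
rewrite nrmZ// [leRHS](splitr e) lerD ?HN//.
apply: (@le_trans _ _ ((cnorm c + 1) * (e / 2 / (cnorm c + 1)))).
  by apply: ler_pM => //; [rewrite lerDl|exact: HN'].
by rewrite mulrC divfK ?gt_eqF.
Qed.

Lemma isF_comb f f' h h' c : L2on setT f -> L2on setT f' -> isF f h -> isF f' h' ->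
  isF (fun x => f x + c * f' x) (fun x => h x + c * h' x).
Proof.
move=> Lf Lf' [Lh [w [w1 w2 w3]]] [Lh' [w' [w1' w2' w3']]].
split; first by apply: (L2onD measurableT Lh (L2onZ measurableT c Lh')).
exists (fun n x => w n x + c * w' n x); split.
- move=> n; split.
    by apply: (cintbleD measurableT (w1 n).1); apply: cintbleZ => //; exact: (w1' n).1.
  by apply: (L2onD measurableT (w1 n).2); apply: L2onZ => //; exact: (w1' n).2.
- by apply: cvgL2_comb => // n; [exact: (w1 n).2|exact: (w1' n).2].
- have e n : fourierL1 (fun x => w n x + c * w' n x) = fun x => fourierL1 (w n) x + c * fourierL1 (w' n) x.
    rewrite -[LHS]/(fourierL1 (w n \+ (fun x => c * w' n x))) ftD ?ftZ//; [exact: (w1' n).1|exact: (w1 n).1|].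
    by apply: cintbleZ => //; exact: (w1' n).1.
  under eq_fun do rewrite e.
  apply: cvgL2_comb => // n; first exact: (plancherel (w1 n).1 (w1 n).2).1.
  exact: (plancherel (w1' n).1 (w1' n).2).1.
Qed.

Lemma isF_translate f h (k : int) : L2on setT f -> isF f h ->
  isF (translate k f) (fun x => E k x * h x).
Proof.
move=> Lf [Lh [w [w1 w2 w3]]].
have LE v : L2on setT v -> L2on setT (fun x => E k x * v x).
  by apply: (L2onM_bounded _ (M := 1)) => // [|x _]; [exact: cmeasE|rewrite nsqE].
have nE v : nrm setT (fun x => E k x * v x) = nrm setT v.
  by rewrite /nrm; congr Num.sqrt; apply: eq_Rintegral => x _; rewrite nsqM nsqE mul1r.
have nT v : cmeas setT v -> nrm setT (translate k v) = nrm setT v.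
  by move=> mv; rewrite /nrm /translate -mulrNz (nrm2_shift _ mv).
split; first exact: LE.
exists (fun n => translate k (w n)); split.
- move=> n; split.
    by have [[i1 i2] _] := w1 n; split; rewrite /translate; [exact: (rint_shift (- k%:~R) i1)|exact: (rint_shift (- k%:~R) i2)].
  exact: (L2on_shift (- k%:~R) (w1 n).2).
- move=> e e0; have [N HN] := w2 e e0; exists N => n Nn.
  have := HN n Nn; rewrite -nT//; apply: L2on_meas.
  by apply: L2onB => //; exact: (w1 n).2.
- move=> e e0; have [N HN] := w3 e e0; exists N => n Nn.
  rewrite (ft_translate _ (w1 n).1).
  have := HN n Nn; rewrite -nE; congr (_ <= _); congr nrm.
  by apply/funext => x /=; rewrite mulrBr.
Qed.

(* By polarization, since the transform is linear and isometric. *)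
Lemma isF_ip f f' h h' : L2on setT f -> L2on setT f' -> isF f h -> isF f' h' ->
  ip setT h h' = ip setT f f'.
Proof.
move=> Lf Lf' Fh Fh'; have Lh := Fh.1; have Lh' := Fh'.1.
have key c : Re (cj c * ip setT h h') = Re (cj c * ip setT f f').
  have Fc := isF_comb c Lf Lf' Fh Fh'.
  have LZ v := L2onZ measurableT c (f := v).
  have := isF_nrm (L2onD measurableT Lf (LZ _ Lf')) Fc.
  move/(congr1 (fun x => x ^+ 2)); rewrite !nrm_sq.
  rewrite -[X in nrm2 _ X]/(h \+ (fun x => c * h' x)) nrm2D//; last exact: LZ.
  rewrite nrm2D//; last exact: LZ.
  rewrite !ipZr// !nrm2Z// -(nrm_sq _ h) -(nrm_sq _ h') -(nrm_sq _ f) -(nrm_sq _ f').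
  rewrite (isF_nrm Lf Fh) (isF_nrm Lf' Fh'); lra.
(* c = 1 compares the real parts and c = i the imaginary parts. *)
apply: complex_eq.
- by have := key 1; rewrite !ReImE /= !mul1r oppr0 !mul0r !subr0.
- by have := key 'i%C; rewrite !ReImE /= !mul0r !sub0r !mulN1r !opprK.
Qed.

Lemma fourierP f : L2on setT f -> isF f (fourier f).
Proof.
move=> Lf; apply/isFP => //; rewrite /fourier.
have [h /isFP Fh] := isF_exists Lf.
exact: (xgetPex (fun=> 0) (ex_intro _ h (Fh Lf))).
Qed.

Lemma fourier_L2 f : L2on setT f -> L2on setT (fourier f).
Proof. by move=> /fourierP[]. Qed.

Lemma ip_translates f h (k j : int) : L2on setT f -> L2on setT h ->
  ip setT (translate k f) (translate j h) =
  cint D (fun x => E k x * cj (E j x) * brk (fourier f) (fourier h) x).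
Proof.
move=> Lf Lh; have Ff := fourierP Lf; have Fh := fourierP Lh.
have LT v i : L2on setT v -> L2on setT (translate i v).
  by move=> Lv; exact: (L2on_shift (- i%:~R) Lv).
rewrite -(isF_ip (LT _ k Lf) (LT _ j Lh) (isF_translate k Lf Ff) (isF_translate j Lh Fh)).
by apply: ip_brk; exact: fourier_L2.
Qed.

End Plancherel.

(** * Frames in closed subspaces of L^2 *)

Section Sums.
Context {R : realType}.

Lemma esum_adherent (a : int -> R) M e : (forall k, 0 <= a k) -> 0 < e ->
  (M%:E <= \esum_(k in [set: int]) (a k)%:E)%E ->
  exists2 s, uniq s & M - e <= \sum_(k <- s) a k.
Proof.
move=> a0 e0 H.
have : ((M - e)%:E < \esum_(k in [set: int]) (a k)%:E)%E.
  by apply: lt_le_trans H; rewrite lte_fin; lra.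
move=> /ereal_sup_gt[_ [A [finA _] <-]].
rewrite fsbig_finite//= sumEFin lte_fin => /ltW ?.
by exists (finmap.enum_fset (fset_set A)) => //; exact: finmap.fset_uniq.
Qed.

Lemma sum_tail (a : int -> R) S e : (forall k, 0 <= a k) -> 0 < e ->
  (forall s, uniq s -> \sum_(k <- s) a k <= S) ->
  exists2 s, uniq s & forall t, uniq t -> {subset s <= t} ->
    \sum_(k <- t) a k - \sum_(k <- s) a k <= e.
Proof.
move=> a0 e0 H.
have fin : (\esum_(k in [set: int]) (a k)%:E \is a fin_num)%E.
  rewrite ge0_fin_numE; last by apply: esum_ge0 => k _; rewrite lee_fin.
  by apply: le_lt_trans (esum_le_seq a0 H) _; rewrite ltry.
have [|s us Hs] := esum_adherent (M := fine (\esum_(k in [set: int]) (a k)%:E)%E) a0 e0.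
  by rewrite fineK.
exists s => // t ut st.
have := seq_le_esum a ut; rewrite -(fineK fin) lee_fin; lra.
Qed.

Lemma sub_undupl (s t : seq int) : {subset s <= undup (s ++ t)}.
Proof. by move=> x xs; rewrite mem_undup mem_cat xs. Qed.

Lemma sub_undupr (s t : seq int) : {subset t <= undup (s ++ t)}.
Proof. by move=> x xs; rewrite mem_undup mem_cat xs orbT. Qed.

Lemma invS_le (e : R) : 0 < e -> exists N, forall n, (N <= n)%N -> n.+1%:R^-1 <= e.
Proof.
move=> e0; exists (Num.truncn e^-1) => n ne.
rewrite -[leRHS]invrK lef_pV2 ?posrE ?invr_gt0//.
by apply: ltW; apply: lt_le_trans (truncnS_gt _) _; rewrite ler_nat ltnS.
Qed.

Lemma sum_if (V : nmodType) (s t : seq int) (a : int -> V) : uniq s -> uniq t ->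
  {subset s <= t} -> \sum_(k <- t) (if k \in s then a k else 0) = \sum_(k <- s) a k.
Proof.
move=> us ut st; rewrite -big_mkcond -big_filter.
apply: perm_big; apply: uniq_perm => //; first exact: filter_uniq.
by move=> x; rewrite mem_filter; apply/andP/idP => [[]//|xs]; split => //; exact: st.
Qed.

End Sums.

Section Hilbert.
Context {R : realType}.
Local Notation C := (R[i]).
Local Notation mu := (@lebesgue_measure R).
Implicit Types (f g h v : R -> C) (F : int -> R -> C) (c d : int -> C)
  (s t : seq int) (W V : set (R -> C)).

Let mT : @measurable _ (measurableTypeR R) [set: R] := measurableT.

Lemma cnormB (z w : C) : cnorm (z - w) <= cnorm z + cnorm w.
Proof.
have -> : cnorm w = cnorm (- w) by rewrite !cnormE nsqN.
exact: le_normcD.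
Qed.

Lemma nrm0 : nrm setT (fun=> 0 : C) = 0.
Proof. by rewrite /nrm (nrm2E mT) (ip0l mT) sqrtr0. Qed.

Definition comb s c F (x : R) : C := \sum_(k <- s) c k * F k x.

Lemma comb_L2 s c F : (forall k, L2on setT (F k)) -> L2on setT (comb s c F).
Proof.
by move=> L; apply: (L2on_sum mT s (F := fun k x => c k * F k x)) => k; exact: L2onZ.
Qed.

Lemma ip_combl s c F g : (forall k, L2on setT (F k)) -> L2on setT g ->
  ip setT (comb s c F) g = \sum_(k <- s) c k * ip setT (F k) g.
Proof.
move=> L Lg; rewrite /comb (ip_suml mT _ (F := fun k x => c k * F k x))//.
  by apply: eq_bigr => k _; rewrite ipZl.
by move=> k; exact: L2onZ.
Qed.

Lemma ip_combr s c F g : (forall k, L2on setT (F k)) -> L2on setT g ->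
  ip setT g (comb s c F) = \sum_(k <- s) cj (c k) * ip setT g (F k).
Proof.
move=> L Lg; rewrite /comb (ip_sumr mT _ (F := fun k x => c k * F k x))//.
  by apply: eq_bigr => k _; rewrite ipZr.
by move=> k; exact: L2onZ.
Qed.

(** Zero padding brings combinations over different lists to a common list, where they can be added
    and compared. *)
Lemma comb_widen s t c F : uniq s -> uniq t -> {subset s <= t} ->
  comb s c F = comb t (fun k => if k \in s then c k else 0) F.
Proof.
move=> us ut st; apply/funext => x; rewrite /comb -(sum_if _ us ut st).
by apply: eq_bigr => k _; case: ifP => // _; rewrite mul0r.
Qed.

Lemma combB t c d F : comb t c F \- comb t d F = comb t (fun k => c k - d k) F.
Proof.
apply/funext => x; rewrite /comb /= -sumrB; apply: eq_bigr => k _.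
by rewrite mulrBl.
Qed.

Lemma combD_ex s t c d F : uniq s -> uniq t ->
  exists2 u, uniq u & exists e, comb s c F \+ comb t d F = comb u e F.
Proof.
move=> us ut; exists (undup (s ++ t)); first exact: undup_uniq.
exists (fun k => (if k \in s then c k else 0) + (if k \in t then d k else 0)).
have ss := @sub_undupl s t; have st := @sub_undupr s t.
rewrite (comb_widen c F us (undup_uniq _) ss) (comb_widen d F ut (undup_uniq _) st).
by apply/funext => x; rewrite /comb /= -big_split/=; apply: eq_bigr => k _; rewrite mulrDl.
Qed.

Section Subspace.
Variable W : set (R -> C).
Hypothesis clW : closed_subspace W.

Lemma subsp_L2 f : W f -> L2on setT f.
Proof. by have [h _ _ _ _] := clW; move=> /h /L2P. Qed.

Lemma subspB f g : W f -> W g -> W (f \- g).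
Proof.
have [_ _ hD hZ _] := clW; move=> Wf Wg.
have -> : f \- g = f \+ (fun x => -1 * g x) by apply/funext => x /=; rewrite mulN1r.
by apply: hD => //; exact: hZ.
Qed.

Lemma subsp_comb F s c : (forall k, W (F k)) -> W (comb s c F).
Proof.
have [_ h0 hD hZ _] := clW; move=> WF; elim: s => [|k s IH].
  have -> // : comb [::] c F = fun=> 0 by apply/funext => x; rewrite /comb big_nil.
have -> : comb (k :: s) c F = (fun x => c k * F k x) \+ comb s c F.
  by apply/funext => x; rewrite /comb big_cons.
by apply: hD => //; exact: hZ.
Qed.

Lemma subsp_approx f : L2on setT f ->
  (forall e : R, 0 < e -> exists2 g, W g & nrm setT (g \- f) <= e) -> W f.
Proof.
move=> Lf H.
have [u Hu] : exists u : nat -> R -> C, forall n, W (u n) /\ nrm setT (u n \- f) <= n.+1%:R^-1.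
  have /choice[u Hu] : forall n : nat, exists g, W g /\ nrm setT (g \- f) <= n.+1%:R^-1.
    by move=> n; have [|g Wg Hg] := H n.+1%:R^-1; [rewrite invr_gt0|exists g].
  by exists u.
have [_ _ _ _ hl] := clW; apply: (hl u f); [by move=> n; exact: (Hu n).1|exact/L2P|].
apply/L2cvgP => //; first by move=> n; exact: (subsp_L2 (Hu n).1).
by move=> e /invS_le[N HN]; exists N => n /HN; exact: le_trans (Hu n).2.
Qed.

End Subspace.

(** * Bessel bounds and synthesis *)

Section Bessel.
Variable F : int -> R -> C.
Hypothesis LF : forall k, L2on setT (F k).

(** For g the combination, |g|^2 is the sum of Re (conj(c k) <g, F k>). The weighted inequality 2
    |xy| <= b |x|^2 + |y|^2 / b and the Bessel bound give 2 |g|^2 <= b sum |c k|^2 + |g|^2. Bessel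
    is required at g alone, so a bound on a subspace suffices. *)
Lemma synth_le_of_bessel s c (b : R) : 0 < b -> uniq s ->
  \sum_(k <- s) nsq (ip setT (comb s c F) (F k)) <= b * nrm2 setT (comb s c F) ->
  nrm2 setT (comb s c F) <= b * \sum_(k <- s) nsq (c k).
Proof.
move=> b0 us; set g := comb s c F; move=> H.
have Lg : L2on setT g by exact: comb_L2.
have e : nrm2 setT g = \sum_(k <- s) Re (cj (c k) * ip setT g (F k)).
  transitivity (Re (ip setT g (comb s c F))); first by rewrite nrm2E.
  rewrite ip_combr//.
  by elim: (s) => [|k r IH]; rewrite ?big_nil// !big_cons ReD IH.
have amgm (x y : C) : 2 * Re (cj x * y) <= b * nsq x + b^-1 * nsq y.
  rewrite ReM ReJ ImJ /nsq.
  have bb : b * b^-1 = 1 by rewrite divff// gt_eqF.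
  have bi : 0 < b^-1 by rewrite invr_gt0.
  have h1 := mulr_ge0 (ltW bi) (sqr_ge0 (b * Re x - Re y)).
  have h2 := mulr_ge0 (ltW bi) (sqr_ge0 (b * Im x - Im y)).
  have k1 : b^-1 * (b * Re x - Re y) ^+ 2 = (b * b^-1) * (b * Re x ^+ 2) - 2 * (b * b^-1) * (Re x * Re y) + b^-1 * Re y ^+ 2 by ring.
  have k2 : b^-1 * (b * Im x - Im y) ^+ 2 = (b * b^-1) * (b * Im x ^+ 2) - 2 * (b * b^-1) * (Im x * Im y) + b^-1 * Im y ^+ 2 by ring.
  rewrite k1 bb in h1; rewrite k2 bb in h2; nra.
have h : 2 * nrm2 setT g <= b * (\sum_(k <- s) nsq (c k)) + b^-1 * \sum_(k <- s) nsq (ip setT g (F k)).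
  rewrite e !mulr_sumr -big_split; apply: ler_sum => k _. exact: (amgm (c k) (ip setT g (F k))).
have : b^-1 * \sum_(k <- s) nsq (ip setT g (F k)) <= nrm2 setT g.
  by rewrite mulrC ler_pdivrMr// mulrC.
lra.
Qed.

(** The converse direction, for every f in L^2: testing f against the combination with coefficients
    <f, F k> gives S^2 <= |f|^2 M S, with S the sum to be bounded. *)
Lemma bessel_of_synth_le (M : R) : 0 <= M ->
  (forall s c, uniq s -> nrm2 setT (comb s c F) <= M * \sum_(k <- s) nsq (c k)) ->
  forall f s, L2on setT f -> uniq s ->
    \sum_(k <- s) nsq (ip setT f (F k)) <= M * nrm2 setT f.
Proof.
move=> M0 H f s Lf us.
set S := \sum_(k <- s) _.
have S0 : 0 <= S by exact: sumr_ge0.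
have Lg := comb_L2 s (fun k => ip setT f (F k)) LF.
have e : ip setT f (comb s (fun k => ip setT f (F k)) F) = S%:C.
  rewrite ip_combr// /S; elim: (s) => [|k r IH]; rewrite ?big_nil// !big_cons IH rmorphD/=.
  by rewrite mulrC mulJ_nsq.
have := CS2 mT Lf Lg; rewrite e nsqR => h1.
have h2 := H s (fun k => ip setT f (F k)) us; rewrite -/S in h2.
have h3 : S ^+ 2 <= (M * nrm2 setT f) * S.
  by apply: le_trans h1 _; rewrite -mulrA mulrCA; exact: ler_wpM2l.
move: S0; rewrite le_eqVlt => /orP[/eqP <-|S0]; first by rewrite mulr_ge0.
by rewrite -(ler_pM2r S0) -expr2.
Qed.

(** Replaces finite sets by duplicate-free lists and the extended norm by the real one. *)
Lemma synthesisP c h : is_synthesis F c h <-> L2on setT h /\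
  forall e : R, 0 < e -> exists2 s, uniq s & forall t, uniq t -> {subset s <= t} ->
    nrm setT (h \- comb t c F) <= e.
Proof.
split.
- move=> [/L2P Lh H]; split => // e e0; have [A HA] := H e e0.
  exists (finmap.enum_fset A); first exact: finmap.fset_uniq.
  move=> t ut At.
  pose B := finmap.seq_fset tt t.
  have AB : {subset A <= B} by move=> k kA; rewrite finmap.seq_fsetE; exact: At.
  have := HA B AB.
  have -> : (fun x => \sum_(k <- B) c k * F k x) = comb t c F.
    apply/funext => x; apply: perm_big.
    apply: uniq_perm; [exact: finmap.fset_uniq|by []|].
    by move=> k; rewrite finmap.seq_fsetE.
  by rewrite norm2E ?lee_fin//; apply: L2onB => //; exact: comb_L2.
- move=> [Lh H]; split; first exact/L2P.
  move=> e e0; have [s us Hs] := H e e0.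
  exists (finmap.seq_fset tt s) => B sB.
  rewrite norm2E ?lee_fin.
    apply: (Hs (finmap.enum_fset B)); first exact: finmap.fset_uniq.
    by move=> k ks; apply: sB; rewrite finmap.seq_fsetE.
  by apply: L2onB => //; exact: (comb_L2 B c LF).
Qed.

Lemma synthesis_exists c (M S : R) : 0 <= M ->
  (forall s d, uniq s -> nrm2 setT (comb s d F) <= M * \sum_(k <- s) nsq (d k)) ->
  (forall s, uniq s -> \sum_(k <- s) nsq (c k) <= S) -> exists h, is_synthesis F c h.
Proof.
move=> M0 HM HS.
have tail e : 0 < e -> exists2 s, uniq s & forall t, uniq t -> {subset s <= t} ->
    nrm setT (comb t c F \- comb s c F) <= e.
  move=> e0; have e2 : 0 < e ^+ 2 / (M + 1) by rewrite divr_gt0 ?exprn_gt0//; lra.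
  have [s us Hs] := sum_tail (fun k => nsq_ge0 (c k)) e2 HS.
  exists s => // t ut st; rewrite (comb_widen c F us ut st) combB.
  have h1 := HM t (fun k => c k - (if k \in s then c k else 0)) ut.
  have e1 : \sum_(k <- t) nsq (c k - (if k \in s then c k else 0)) =
      \sum_(k <- t) nsq (c k) - \sum_(k <- s) nsq (c k).
    rewrite -(sum_if (fun k => nsq (c k)) us ut st) -sumrB; apply: eq_bigr => k _.
    by case: ifP => _; rewrite ?subrr ?nsq0 ?subr0.
  rewrite e1 in h1; have h2 := Hs t ut st.
  rewrite -(@ler_pXn2r _ 2) ?nnegrE//; last exact: ltW.
  rewrite nrm_sq; apply: le_trans h1 _.
  apply: (@le_trans _ _ ((M + 1) * (e ^+ 2 / (M + 1)))); last first.
    by rewrite mulrCA divff ?mulr1//; apply: lt0r_neq0; lra.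
  apply: ler_pM => //; last lra.
  by rewrite -e1; apply: sumr_ge0.
have /choice[s_ Hs] : forall n : nat, exists s, uniq s /\ forall t, uniq t -> {subset s <= t} ->
    nrm setT (comb t c F \- comb s c F) <= n.+1%:R^-1.
  by move=> n; have [|s us Hs] := tail n.+1%:R^-1; [rewrite invr_gt0|exists s].
have Lc t : L2on setT (comb t c F) by exact: comb_L2.
have [|h [Lh ch]] := L2_complete mT (fun n => Lc (s_ n)).
  move=> e e0; have [|N HN] := @invS_le R (e / 2); first lra.
  exists N => n m Nn Nm.
  pose u := undup (s_ n ++ s_ m).
  have h1 := (Hs n).2 u (undup_uniq _); have h2 := (Hs m).2 u (undup_uniq _).
  have {}h1 : nrm setT (comb u c F \- comb (s_ n) c F) <= n.+1%:R^-1.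
    exact: h1 (@sub_undupl _ _).
  have {}h2 : nrm setT (comb u c F \- comb (s_ m) c F) <= m.+1%:R^-1.
    exact: h2 (@sub_undupr _ _).
  have : nrm setT (comb (s_ n) c F \- comb (s_ m) c F) <=
      nrm setT (comb (s_ n) c F \- comb u c F) + nrm setT (comb u c F \- comb (s_ m) c F).
    exact: nrm_triangleB.
  rewrite [nrm _ (comb (s_ n) c F \- comb u c F)]nrmBC.
  have := le_trans h1 (HN n Nn); have := le_trans h2 (HN m Nm); lra.
exists h; apply/synthesisP; split => // e e0.
have [|N HN] := @invS_le R (e / 2); first lra.
have [|N' HN'] := ch (e / 2); first lra.
pose n := maxn N N'; exists (s_ n) => [|t ut st]; first exact: (Hs n).1.
have h1 := (Hs n).2 t ut st; have {}h1 := le_trans h1 (HN n (leq_maxl _ _)); have h3 := HN' n (leq_maxr _ _).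
have : nrm setT (h \- comb t c F) <=
    nrm setT (h \- comb (s_ n) c F) + nrm setT (comb (s_ n) c F \- comb t c F).
  exact: nrm_triangleB.
rewrite [X in _ <= X + _]nrmBC [X in _ <= _ + X]nrmBC; lra.
Qed.

End Bessel.

(** * Frame inequalities over finite sums, and the frame algorithm *)

Section Frame.
Variables (W : set (R -> C)) (F : int -> R -> C).
Hypothesis clW : closed_subspace W.

Definition bessel_on (b : R) := forall f s, W f -> uniq s ->
  \sum_(k <- s) nsq (ip setT f (F k)) <= b * nrm2 setT f.
(** Finite partial sums only approach the full frame sum, hence the arbitrary loss e; together with
    [bessel_on] this is equivalent to the extended inequalities of [is_frame], by [frameP] and
    [frameI]. *)
Definition lower_on (a : R) := forall f (e : R), W f -> 0 < e ->
  exists2 s, uniq s & a * nrm2 setT f - e <= \sum_(k <- s) nsq (ip setT f (F k)).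

Lemma frameP : is_frame W F -> (forall k, W (F k)) /\
  exists a b : R, [/\ 0 < a, 0 < b, bessel_on b & lower_on a].
Proof.
move=> [WF [a [b [a0 ab H]]]]; split => //; exists a, b; split => //; first exact: lt_le_trans ab.
- move=> f s Wf us; have [_] := H f Wf.
  rewrite norm2E; last exact: subsp_L2 Wf.
  under eq_esum do rewrite innerE cnorm_sq.
  rewrite -EFin_expe nrm_sq -EFinM => h.
  by have := le_trans (seq_le_esum _ us) h; rewrite lee_fin.
- move=> f e Wf e0; have [+ _] := H f Wf.
  rewrite norm2E; last exact: subsp_L2 Wf.
  under eq_esum do rewrite innerE cnorm_sq.
  rewrite -EFin_expe nrm_sq -EFinM => h.
  exact: esum_adherent.
Qed.

Lemma frameI (a b : R) : (forall k, W (F k)) -> 0 < a -> bessel_on b -> lower_on a ->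
  is_frame W F.
Proof.
move=> WF a0 hb ha; split => //; exists a, (Num.max a b); split => //.
  by rewrite le_max lexx.
move=> f Wf; rewrite norm2E; last exact: subsp_L2 Wf.
under eq_esum do rewrite innerE cnorm_sq.
rewrite -EFin_expe nrm_sq -!EFinM; split.
- by apply: esum_ge_seq => e e0; exact: ha.
- apply: esum_le_seq => // s us; apply: le_trans (hb f s Wf us) _.
  by apply: ler_wpM2r => //; rewrite le_max lexx orbT.
Qed.

Hypothesis WF : forall k, W (F k).
Variables a b : R.
Hypotheses (a0 : 0 < a) (b0 : 0 < b) (hb : bessel_on b) (ha : lower_on a).

Lemma frame_synth_le s c : uniq s ->
  nrm2 setT (comb s c F) <= b * \sum_(k <- s) nsq (c k).
Proof.
move=> us; apply: synth_le_of_bessel => //; first by move=> k; exact: (subsp_L2 clW).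
by apply: hb => //; exact: subsp_comb.
Qed.

(* One step of the frame algorithm, with a finite part of the frame expansion. *)
Lemma frame_contract h : W h -> exists2 s, uniq s & exists c,
  nrm2 setT (h \- comb s c F) <= (1 - a / (2 * b)) * nrm2 setT h.
Proof.
move=> Wh; have LF k : L2on setT (F k) by exact: (subsp_L2 clW).
have Lh : L2on setT h by exact: (subsp_L2 clW).
have [|hpos] := leP (nrm2 setT h) 0.
  move=> h0; exists [::] => //; exists (fun=> 0).
  have -> : h \- comb [::] (fun=> 0) F = h by apply/funext => x; rewrite /comb /= big_nil subr0.
  have -> : nrm2 setT h = 0 by apply/eqP; rewrite eq_le h0 nrm2_ge0.
  by rewrite mulr0.
have [|s us Hs] := ha Wh (e := a / 2 * nrm2 setT h).
  by rewrite mulr_gt0// divr_gt0.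
(* With S the finite frame sum, at least (a/2) |h|^2, the combination g satisfies <h, g> = S / b and
   |g|^2 <= S / b, so |h - g|^2 <= |h|^2 - S / b. *)
exists s => //; exists (fun k => b^-1%:C * ip setT h (F k)).
set c := (fun k => b^-1%:C * _).
have Lc : L2on setT (comb s c F) by exact: comb_L2.
set S := \sum_(k <- s) _ in Hs.
have e1 : ip setT h (comb s c F) = (b^-1 * S)%:C.
  rewrite ip_combr// /S; elim: (s) => [|k r IH]; rewrite ?big_nil ?mulr0// !big_cons IH.
  rewrite mulrDr rmorphD/=; congr (_ + _).
  by rewrite /c conjM conjR -mulrA [_ * ip _ _ _]mulrC mulJ_nsq -realCM.
have e2 : \sum_(k <- s) nsq (c k) = b^-1 ^+ 2 * S.
  by rewrite /S mulr_sumr; apply: eq_bigr => k _; rewrite nsqM nsqR.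
have := frame_synth_le c us; rewrite e2.
rewrite nrm2B// e1 ReR => h1.
have bb : b * b^-1 = 1 by rewrite divff// gt_eqF.
have k1 : b * (b^-1 ^+ 2 * S) = (b * b^-1) * (b^-1 * S) by ring.
rewrite k1 bb mul1r in h1.
have k2 : a / (2 * b) = b^-1 * (a / 2) by rewrite invfM; ring.
have k3 : b^-1 * (a / 2 * nrm2 setT h) <= b^-1 * S.
  by rewrite ler_pM2l ?invr_gt0//; lra.
rewrite k2 mulrBl mul1r -mulrA; lra.
Qed.

Lemma frame_dense h (e : R) : W h -> 0 < e ->
  exists2 s, uniq s & exists c, nrm setT (h \- comb s c F) <= e.
Proof.
move=> Wh e0; have LF k : L2on setT (F k) by exact: (subsp_L2 clW).
pose q := Num.max 0 (1 - a / (2 * b)).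
have ab : 0 < a / (2 * b) by rewrite divr_gt0// mulr_gt0.
have q0 : 0 <= q by rewrite le_max lexx.
have q1 : `|q| < 1 by rewrite ger0_norm// gt_max ltr01/=; lra.
have step n : exists2 s, uniq s & exists c,
    nrm2 setT (h \- comb s c F) <= q ^+ n * nrm2 setT h.
  elim: n => [|n [s us [c IH]]].
    exists [::] => //; exists (fun=> 0); rewrite expr0 mul1r.
    by have -> // : h \- comb [::] (fun=> 0) F = h by apply/funext => x; rewrite /comb /= big_nil subr0.
  have Wr : W (h \- comb s c F) by apply: subspB => //; exact: subsp_comb.
  have [t ut [d Hd]] := frame_contract Wr.
  have [u uu [w Hw]] := combD_ex c d F us ut.
  exists u => //; exists w; rewrite -Hw.
  have -> : h \- (comb s c F \+ comb t d F) = (h \- comb s c F) \- comb t d F.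
    by apply/funext => x /=; ring.
  apply: le_trans Hd _; rewrite exprS -mulrA.
  apply: (@le_trans _ _ (q * nrm2 setT (h \- comb s c F))).
    by apply: ler_wpM2r => //; rewrite le_max lexx orbT.
  exact: ler_wpM2l.
have /cvgrPdist_le := cvg_expr q1.
pose K := nrm2 setT h + 1.
have K0 : 0 < K by rewrite /K; have := nrm2_ge0 setT h; lra.
have eK : 0 < e ^+ 2 / K by rewrite divr_gt0// exprn_gt0.
move=> /(_ _ eK)[n _ /(_ n (leqnn n))]; rewrite /= sub0r normrN ger0_norm ?exprn_ge0// => qn.
have [s us [c Hc]] := step n; exists s => //; exists c.
rewrite -(@ler_pXn2r _ 2) ?nnegrE//; last exact: ltW.
rewrite nrm_sq; apply: le_trans Hc _.
apply: (@le_trans _ _ ((e ^+ 2 / K) * K)); last by rewrite divfK// gt_eqF.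
by apply: ler_pM => //; [exact: exprn_ge0|rewrite /K; lra].
Qed.

End Frame.

(** * A uniform bound drawn from an algebraic direct sum *)

Section UniformBound.
Variables (W V : set (R -> C)).
Hypotheses (clW : closed_subspace W) (clV : closed_subspace V).
Hypothesis WV : direct_sum W (orth V).

(** The component in [orth V] pairs to 0 with V, so the component in W has the same inner products
    with V as f. Later estimates know the oblique projection only through this property. *)
Lemma direct_ip f : L2on setT f -> exists2 g, W g & 
  forall v, V v -> ip setT f v = ip setT g v.
Proof.
move=> /L2P Lf; have [g [h [Wg [Lh Oh] ->]]] := WV.1 f Lf; exists g => // v Vv.
have := Oh v Vv; rewrite innerE ipDl// => [->|||]; rewrite ?addr0//; last exact: (subsp_L2 clV).
- exact: (subsp_L2 clW).
- exact/L2P.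
Qed.

(* Sokal's proof of the uniform boundedness principle: the partial sums
   x (n + 1) = x n +- u n / 12 ^ n, with the sign making |<x (n + 1), u n>| at
   least (4 / 3) ^ n, converge to a vector on which the u n are unbounded. *)
Lemma sokal (u : nat -> R -> C) : (forall n, L2on setT (u n)) ->
  (forall n, nrm setT (u n) = 4 ^+ n) ->
  (forall f, L2on setT f -> exists K : R, forall n, cnorm (ip setT f (u n)) <= K) -> False.
Proof.
move=> Lu nu H.
pose y n x : C := (12%:R^-1 ^+ n)%:C * u n x.
have Ly n : L2on setT (y n) by exact: L2onZ.
have p3 n : 0 < 3^-1 ^+ n :> R by rewrite exprn_gt0.
have p4 n : 0 < 4 ^+ n :> R by rewrite exprn_gt0.
have p12 n : 0 < 12%:R^-1 ^+ n :> R by rewrite exprn_gt0.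
have k12 n : 12%:R^-1 ^+ n * 4 ^+ n = 3^-1 ^+ n :> R.
  by rewrite -exprMn; congr (_ ^+ _); lra.
have ny n : nrm setT (y n) = 3^-1 ^+ n.
  by rewrite nrmZ// nu cnormE nsqR sqrtr_sqr ger0_norm ?ltW.
pose fix_ := fix x n := if n is m.+1 then
  (if 3^-1 ^+ m * 4 ^+ m <= cnorm (ip setT (x m \+ y m) (u m)) then x m \+ y m else x m \- y m)
  else (fun=> 0 : C).
pose x : nat -> R -> C := fix_.
have xS n : x n.+1 = if 3^-1 ^+ n * 4 ^+ n <= cnorm (ip setT (x n \+ y n) (u n))
  then x n \+ y n else x n \- y n by [].
have Lx n : L2on setT (x n).
  elim: n => [|n IH]; first exact: L2on0.
  by rewrite xS; case: ifP => _; [exact: L2onD|exact: L2onB].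
have dx n : nrm setT (x n.+1 \- x n) = 3^-1 ^+ n.
  rewrite xS -ny; case: ifP => _.
    by congr nrm; apply/funext => z /=; ring.
  by rewrite -nrmN; congr nrm; apply/funext => z /=; ring.
have big n : 3^-1 ^+ n * 4 ^+ n <= cnorm (ip setT (x n.+1) (u n)).
  rewrite xS; case: ifP => // /negbT; rewrite -ltNge => h.
  have e1 : ip setT (x n \- y n) (u n) = ip setT (x n \+ y n) (u n) - 2%:R * ip setT (y n) (u n).
    by rewrite ipBl// ipDl//; ring.
  have e2 : cnorm (ip setT (y n) (u n)) = 3^-1 ^+ n * 4 ^+ n.
    rewrite ipZl// ipff// cnormM !cnormE !nsqR !sqrtr_sqr -nrm_sq nu !ger0_norm ?ltW// ?exprn_gt0//.
    by rewrite expr2 mulrA k12.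
  (* The two candidate inner products differ by 2 <y n, u n>, so if the one with the plus sign is
     too small, the other is large enough. *)
  have t (z w : C) : 2 * cnorm w <= cnorm z + cnorm (z - 2%:R * w).
    have -> : 2 * cnorm w = cnorm (z - (z - 2%:R * w)).
      have -> : z - (z - 2%:R * w) = (2 : R)%:C * w by rewrite rmorphMn/= rmorph1; ring.
      by rewrite cnormM [cnorm (2%:C)]cnormE nsqR sqrtr_sqr ger0_norm.
    exact: cnormB.
  have := t (ip setT (x n \+ y n) (u n)) (ip setT (y n) (u n)).
  rewrite e1 e2; lra.
(* Geometric sum of steps of norm 3^-n; 3/2 is 1 / (1 - 1/3). *)
have dist n k : nrm setT (x (n + k)%N \- x n) <= 3 / 2 * (3^-1 ^+ n - 3^-1 ^+ (n + k)).
  elim: k => [|k IH].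
    rewrite addn0 subrr mulr0.
    have -> : x n \- x n = fun=> 0 by apply/funext => z /=; rewrite subrr.
    by rewrite nrm0.
  have := nrm_triangleB mT (Lx (n + k.+1)%N) (Lx (n + k)%N) (Lx n).
  rewrite addnS dx exprS; lra.
have small e : 0 < e -> exists N, forall n, (N <= n)%N -> 3 / 2 * 3^-1 ^+ n <= e :> R.
  move=> e0; have : `|3^-1 : R| < 1 by rewrite ger0_norm//; lra.
  move=> /cvg_expr /cvgrPdist_le /(_ (e / 2)) []; first lra.
  move=> N _ HN; exists N => n /HN /=; rewrite sub0r normrN ger0_norm; last exact: ltW.
  by have := p3 n; move: (3^-1 ^+ n) => w; lra.
have [|z [Lz cz]] := L2_complete mT Lx.
  move=> e e0; have [|N HN] := small (e / 2); first lra.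
  exists N => n m Nn Nm.
  have h1 := dist N (n - N)%N; have h2 := dist N (m - N)%N.
  rewrite subnKC// in h1; rewrite subnKC// in h2.
  have h3 := HN N (leqnn N).
  have := nrm_triangleB mT (Lx n) (Lx N) (Lx m); rewrite [nrm _ (x N \- _)]nrmBC.
  have := p3 n; have := p3 m; lra.
have dz n : nrm setT (z \- x n) <= 3 / 2 * 3^-1 ^+ n.
  apply/ler_addgt0Pr => e e0; have [N HN] := cz e e0.
  have h1 := HN (maxn N n) (leq_maxl _ _).
  have h2 := dist n (maxn N n - n)%N; rewrite subnKC ?leq_maxr// in h2.
  have := nrm_triangleB mT Lz (Lx (maxn N n)) (Lx n); rewrite [nrm _ (z \- x (maxn N n))]nrmBC.
  have := p3 (maxn N n); lra.
have [K HK] := H z Lz.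
(* The distance from z to x (n+1) is at most (3/2) 3^-(n+1) = 3^-n / 2, so passing to the limit
   costs at most half of (4/3)^n. *)
have zl n : 2^-1 * (4 / 3) ^+ n <= cnorm (ip setT z (u n)).
  have h1 := big n.
  have h2 : cnorm (ip setT (z \- x n.+1) (u n)) <= 2^-1 * (3^-1 ^+ n * 4 ^+ n).
    apply: le_trans (CS mT (L2onB mT Lz (Lx _)) (Lu n)) _; rewrite nu mulrA.
    apply: ler_wpM2r; first exact: ltW.
    by have := dz n.+1; rewrite exprS; lra.
  have e1 : ip setT (x n.+1) (u n) = ip setT z (u n) - ip setT (z \- x n.+1) (u n).
    by rewrite ipBl//; ring.
  have h3 : cnorm (ip setT (x n.+1) (u n)) <= cnorm (ip setT z (u n)) + cnorm (ip setT (z \- x n.+1) (u n)).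
    by rewrite e1; exact: cnormB.
  have e2 : (4 / 3) ^+ n = 3^-1 ^+ n * 4 ^+ n :> R by rewrite -exprMn mulrC.
  rewrite e2; lra.
have gr n : 1 + n%:R * 3^-1 <= (4 / 3) ^+ n :> R.
  have -> : 4 / 3 = 1 + 3^-1 :> R by lra.
  by apply: bernoulli_le; lra.
(* Then n + 1 > 6 K, so (1 + n/3) / 2 already exceeds K. *)
pose n := Num.truncn (6 * K).
have := truncnS_gt (6 * K); rewrite -/n => hn.
have := gr n; have := zl n; have := HK n; rewrite -natr1 in hn; lra.
Qed.

(* The functionals <., v> are controlled on all of L^2 by their values on W, since
   V is orthogonal to the other summand; so they are pointwise bounded. *)
Lemma oblique_dual_norm : exists2 c : R, 0 < c & forall v (t : R), V v -> 0 <= t ->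
  (forall g, W g -> cnorm (ip setT g v) <= t * nrm setT g) -> nrm setT v <= c * t.
Proof.
apply: contrapT => nex.
(* A vector violating the bound with constant 4^n, rescaled to norm 4^n, acts on W with functional
   norm at most 1. *)
have /choice[u Hu] : forall n : nat, exists u, [/\ V u, nrm setT u = 4 ^+ n &
    forall g, W g -> cnorm (ip setT g u) <= nrm setT g].
  move=> n; apply: contrapT => nu; apply: nex; exists (4 ^+ n); first by rewrite exprn_gt0.
  move=> v t Vv t0 H; rewrite leNgt; apply/negP => lt; apply: nu.
  have p4 : 0 < 4 ^+ n :> R by rewrite exprn_gt0.
  have v0 : 0 < nrm setT v by apply: le_lt_trans lt; rewrite mulr_ge0// ltW.
  pose r := 4 ^+ n / nrm setT v.
  have r0 : 0 < r by rewrite divr_gt0.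
  have Lv : L2on setT v by exact: (subsp_L2 clV).
  have cr : cnorm r%:C = r by rewrite cnormE nsqR sqrtr_sqr ger0_norm ?ltW.
  exists (fun x => r%:C * v x); split.
  - by have [_ _ _ hZ _] := clV; exact: hZ.
  - by rewrite nrmZ// cr /r divfK// gt_eqF.
  - move=> g Wg; have Lg : L2on setT g by exact: (subsp_L2 clW).
    rewrite ipZr// conjR cnormM cr.
    apply: (@le_trans _ _ (r * (t * nrm setT g))); first by rewrite ler_pM2l//; exact: H.
    rewrite mulrA; apply: ler_piMl => //.
    by rewrite /r mulrAC ler_pdivrMr// mul1r ltW.
apply: (@sokal u) => [n|n|f Lf].
- by have [h _ _] := Hu n; exact: (subsp_L2 clV).
- by have [_ h _] := Hu n.
- have [g Wg Hg] := direct_ip Lf; exists (nrm setT g) => n.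
  by have [Vu _ hu] := Hu n; rewrite Hg//; exact: hu.
Qed.

End UniformBound.

End Hilbert.

(** * Fibers of translation-invariant systems *)

Section Fibers.
Context {R : realType}.
Local Notation C := (R[i]).
Local Notation mu := (@lebesgue_measure R).
Local Notation D := (@D01 R).
Implicit Types (f g h u v w p : R -> C) (c d : int -> C) (s t : seq int).

Let mT : @measurable _ (measurableTypeR R) [set: R] := measurableT.

(** Closes the approximation arguments: k collects the coefficients of an error linear in e. *)
Lemma le_of_eps (x y k : R) : 0 <= k -> (forall e, 0 < e -> x <= y + k * e) -> x <= y.
Proof.
move=> k0 H; apply/ler_addgt0Pr => e e0.
have k1 : 0 < k + 1 by lra.
apply: le_trans (H (e / (k + 1)) (divr_gt0 e0 k1)) _; rewrite lerD2l.
by rewrite mulrA ler_pdivrMr// mulrC ler_pM2l//; lra.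
Qed.

(* Passage from trigonometric polynomials to indicators of sets, by density. *)
Lemma ae_le_of_trig v w (M : R) : 0 <= M -> cmeas D v -> cmeas D w ->
  {ae mu, forall x, D x -> nsq (v x) <= M} ->
  {ae mu, forall x, D x -> nsq (w x) <= M} ->
  (forall p, trig p -> nrm D (fun x => v x * p x) <= nrm D (fun x => w x * p x)) ->
  {ae mu, forall x, D x -> nsq (v x) <= nsq (w x)}.
Proof.
move=> M0 mv mw bv bw H.
have ext f : L2on D f -> nrm D (fun x => v x * f x) <= nrm D (fun x => w x * f x).
  move=> Lf; apply: (le_of_eps (k := 2 * Num.sqrt M)) => [|e e0].
    by rewrite mulr_ge0 ?sqrtr_ge0.
  have [p tp_ Hp] := L2_trig_dense Lf e0; have Lp := trig_L2 tp_.
  have Lfp := L2onB mD01 Lf Lp.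
  have [Lvf _] := L2onM_ae M0 mv bv Lf; have [Lvp _] := L2onM_ae M0 mv bv Lp.
  have [Lwf _] := L2onM_ae M0 mw bw Lf; have [Lwp _] := L2onM_ae M0 mw bw Lp.
  have [_ h1] := L2onM_ae M0 mv bv Lfp; have [_ h2] := L2onM_ae M0 mw bw Lfp.
  have e1 : (fun x => v x * (f \- p) x) = (fun x => v x * f x) \- (fun x => v x * p x).
    by apply/funext => x /=; rewrite mulrBr.
  have e2 : (fun x => w x * (f \- p) x) = (fun x => w x * f x) \- (fun x => w x * p x).
    by apply/funext => x /=; rewrite mulrBr.
  rewrite e1 in h1; rewrite e2 [X in X <= _]nrmBC in h2.
  have k1 := nrm_le_add mD01 Lvf Lvp; have k2 := nrm_le_add mD01 Lwp Lwf.
  have k3 := H p tp_.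
  have k4 : Num.sqrt M * nrm D (f \- p) <= Num.sqrt M * e.
    by apply: ler_wpM2l => //; exact: sqrtr_ge0.
  lra.
(* The set where the claim fails. Testing with its indicator gives a nonnegative function whose
   integral is at most 0. *)
pose A : set R := D `&` [set x | nsq (w x) < nsq (v x)].
have mA : measurable A.
  have := measurable_fun_ltr (cmeas_nsq mw) (cmeas_nsq mv).
  move=> /(_ mD01 [set true] Logic.I); exact.
have L1 := ind_L2 mA.
have h0 := ext _ L1.
have [Lv _] := L2onM_ae M0 mv bv L1; have [Lw _] := L2onM_ae M0 mw bw L1.
have h : nrm2 D (fun x => v x * ind A x) <= nrm2 D (fun x => w x * ind A x).
  by rewrite -!nrm_sq lerXn2r ?nnegrE.
have e x : nsq (v x * ind A x) - nsq (w x * ind A x) = (\1_A x : R) * (nsq (v x) - nsq (w x)).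
  by rewrite !nsqM /ind nsqR indicE; case: (x \in A) => /=; rewrite ?expr1n ?expr0n/=; ring.
have pos x : 0 <= nsq (v x * ind A x) - nsq (w x * ind A x).
  rewrite e indicE; case: (boolP (x \in A)) => [|_]; last by rewrite mul0r.
  by rewrite inE mul1r subr_ge0 => -[_ /ltW].
(* A square root of that function, so that [nrm2_eq0_ae] shows it to vanish almost everywhere. *)
pose k x : C := (Num.sqrt (nsq (v x * ind A x) - nsq (w x * ind A x)))%:C.
have nk x : nsq (k x) = nsq (v x * ind A x) - nsq (w x * ind A x) by rewrite nsqR sqr_sqrtr.
have ik : rint D (fun x => nsq (v x * ind A x) - nsq (w x * ind A x)).
  by apply: rintB => //; [exact: Lv.2|exact: Lw.2].
have Lk : L2on D k.
  split; last by under eq_fun do rewrite nk.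
  apply: cmeasR; apply: measurable_sqrt => //; exact: rint_meas ik.
have k0 : nrm2 D k = 0.
  apply/eqP; rewrite eq_le nrm2_ge0 andbT /nrm2.
  under eq_Rintegral do rewrite nk.
  by rewrite RintegralB ?subr_le0//; [exact: Lv.2|exact: Lw.2].
apply: ae_mono (nrm2_eq0_ae mD01 Lk k0) => x kx Dx.
rewrite leNgt; apply/negP => lt.
have := nk x; rewrite kx// nsq0 e indicE mem_set//= mul1r; lra.
Qed.

(** Both sides are continuous in f for the L^2 norm, w being bounded. It allows test symbols that
    are quotients of brackets rather than polynomials. *)
Lemma ip_le_of_trig u w (M K : R) : 0 <= M -> 0 <= K -> L2on D u -> cmeas D w ->
  {ae mu, forall x, D x -> nsq (w x) <= M} ->
  (forall p, trig p -> cnorm (ip D u p) <= K * nrm D (fun x => w x * p x)) ->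
  forall f, L2on D f -> cnorm (ip D u f) <= K * nrm D (fun x => w x * f x).
Proof.
move=> M0 K0 Lu mw bw H f Lf.
apply: (le_of_eps (k := nrm D u + K * Num.sqrt M)) => [|e e0].
  by rewrite addr_ge0// mulr_ge0// sqrtr_ge0.
have [p tp_ Hp] := L2_trig_dense Lf e0; have Lp := trig_L2 tp_.
have Lfp := L2onB mD01 Lf Lp.
have [Lwf _] := L2onM_ae M0 mw bw Lf; have [Lwp _] := L2onM_ae M0 mw bw Lp.
have [_ h2] := L2onM_ae M0 mw bw Lfp.
have e2 : (fun x => w x * (f \- p) x) = (fun x => w x * f x) \- (fun x => w x * p x).
  by apply/funext => x /=; rewrite mulrBr.
rewrite e2 [X in X <= _]nrmBC in h2.
have k2 := nrm_le_add mD01 Lwp Lwf; have k3 := H p tp_.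
have k4 : Num.sqrt M * nrm D (f \- p) <= Num.sqrt M * e.
  by apply: ler_wpM2l => //; exact: sqrtr_ge0.
have k5 : cnorm (ip D u (f \- p)) <= nrm D u * e.
  by apply: le_trans (CS mD01 Lu Lfp) _; exact: ler_wpM2l.
have e3 : ip D u f = ip D u (f \- p) - (- ip D u p) by rewrite ipBr//; ring.
have k6 := cnormB (ip D u (f \- p)) (- ip D u p).
have e4 : cnorm (- ip D u p) = cnorm (ip D u p) by rewrite !cnormE nsqN.
rewrite -e3 e4 in k6.
have k7 : K * nrm D (fun x => w x * p x) <=
    K * (nrm D (fun x => w x * f x) + Num.sqrt M * e).
  by apply: ler_wpM2l => //; lra.
lra.
Qed.

Lemma cintbleM_bounded f g (M : R) : cintble D f -> cmeas D g ->
  (forall x, nsq (g x) <= M) -> cintble D (fun x => g x * f x).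
Proof.
move=> /(cintble_normP mD01)[mf nf] mg bg; apply/(cintble_normP mD01); split; first exact: cmeasM.
apply: (rint_le mD01 (v := fun x => Num.sqrt M * cnorm (f x))).
- by apply: cmeas_cnorm => //; exact: cmeasM.
- move=> x _; rewrite ger0_norm// cnormM; apply: ler_wpM2r => //.
  by rewrite cnormE; exact: ler_wsqrtr.
- exact: rintZ.
Qed.

Lemma cintble_sum (I : Type) (r : seq I) (F : I -> R -> C) : (forall k, cintble D (F k)) ->
  cintble D (fun x => \sum_(k <- r) F k x) /\
  cint D (fun x => \sum_(k <- r) F k x) = \sum_(k <- r) cint D (F k).
Proof.
move=> iF; elim: r => [|k r [IH1 IH2]].
  have -> : (fun x : R => \sum_(k <- [::]) F k x) = fun=> 0 by apply/funext => x; rewrite big_nil.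
  split; last by have := ip0l mD01 (fun=> 0); rewrite big_nil /ip => {2}<-; congr cint; apply/funext => x; rewrite mul0r.
  by have := cintble_mul mD01 (L2on0 D) (L2on0 D); congr cintble; apply/funext => x; rewrite mul0r.
have e : (fun x : R => \sum_(j <- (k :: r)) F j x) = F k \+ (fun x => \sum_(k <- r) F k x).
  by apply/funext => x; rewrite big_cons.
by rewrite e big_cons; split; [exact: cintbleD|rewrite cintD// IH2].
Qed.

Lemma translates_L2 f k : L2on setT f -> L2on setT (translates f k).
Proof. by move=> Lf; rewrite /translates /translate -mulrNz; exact: L2on_shift. Qed.

Lemma ip_comb s c t d f g : L2on setT f -> L2on setT g ->
  ip setT (comb s c (translates f)) (comb t d (translates g)) =
  cint D (fun x => tp s c x * cj (tp t d x) * brk (fourier f) (fourier g) x).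
Proof.
move=> Lf Lg.
have LT h k : L2on setT h -> L2on setT (translates h k) by exact: translates_L2.
have ib := brk_int (fourier_L2 Lf) (fourier_L2 Lg).
pose K k j x := E k x * cj (E j x) * brk (fourier f) (fourier g) x.
have iK k j : cintble D (K k j).
  apply: (cintbleM_bounded (M := 1)) => //; last by move=> x; rewrite nsqM nsqJ !nsqE mulr1.
  by apply: cmeasM => //; [exact: cmeasE|apply: cmeasJ => //; exact: cmeasE].
rewrite ip_combl//; last 2 first.
- by move=> k; exact: LT.
- by apply: comb_L2 => k; exact: LT.
pose G k x := \sum_(j <- t) (c k * cj (d j)) * K k j x.
have iG k : cintble D (G k) /\ cint D (G k) = \sum_(j <- t) (c k * cj (d j)) * cint D (K k j).
  have [|i1 i2] := @cintble_sum _ t (fun j x => (c k * cj (d j)) * K k j x).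
    by move=> j; exact: cintbleZ.
  by split => //; rewrite i2; apply: eq_bigr => j _; rewrite cintZ.
have -> : (fun x => tp s c x * cj (tp t d x) * brk (fourier f) (fourier g) x) =
    fun x => \sum_(k <- s) G k x.
  apply/funext => x; rewrite /tp /G /K conj_sum !mulr_suml; apply: eq_bigr => k _.
  rewrite mulr_sumr mulr_suml; apply: eq_bigr => j _; rewrite conjM; ring.
have [|_ ->] := @cintble_sum _ s G; first by move=> k; exact: (iG k).1.
apply: eq_bigr => k _; rewrite (iG k).2 ip_combr//; [|by move=> j; exact: LT|exact: LT].
rewrite mulr_sumr; apply: eq_bigr => j _.
by rewrite mulrA; congr (_ * _); exact: ip_translates.
Qed.

(** Infinite values become 0; for f in L^2 they occur on a null subset of D only. *)
Definition rPhi f (x : R) : R := fine (PhiE (fourier f) x).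
Definition sqrtPhi f (x : R) : C := (Num.sqrt (rPhi f x))%:C.

Lemma rPhi_ge0 f x : 0 <= rPhi f x.
Proof. by rewrite fine_ge0// PhiE_ge0. Qed.

Lemma nsq_sqrtPhi f x : nsq (sqrtPhi f x) = rPhi f x.
Proof. by rewrite nsqR sqr_sqrtr// rPhi_ge0. Qed.

Lemma rPhi_meas f : L2on setT f -> measurable_fun D (rPhi f).
Proof. by move=> Lf; apply: rint_meas; apply: PhiE_int; exact: fourier_L2. Qed.

Lemma sqrtPhi_L2 f : L2on setT f -> L2on D (sqrtPhi f).
Proof.
move=> Lf; split.
  by apply: cmeasR; apply: measurable_sqrt => //; exact: rPhi_meas.
by under eq_fun do rewrite nsq_sqrtPhi; exact: PhiE_int (fourier_L2 Lf).
Qed.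

Lemma sqrtPhi_trig_L2 f p : L2on setT f -> trig p -> L2on D (fun x => sqrtPhi f x * p x).
Proof.
move=> Lf tp_; have [M _ bM] := trig_bounded tp_.
under eq_fun do rewrite mulrC.
by apply: (L2onM_bounded _ (M := M)) => //; [exact: trig_meas|exact: sqrtPhi_L2].
Qed.

Lemma nrm_comb s c f : L2on setT f ->
  nrm setT (comb s c (translates f)) = nrm D (fun x => sqrtPhi f x * tp s c x).
Proof.
move=> Lf; congr Num.sqrt; rewrite nrm2E// ip_comb//.
rewrite /cint /nrm2 /=; apply: eq_Rintegral => x _.
rewrite brk_self mulJ_nsq -realCM /= nsqM nsq_sqrtPhi mulrC; exact/esym.
Qed.

Lemma nrm_combB s c t d f : uniq s -> uniq t -> L2on setT f ->
  nrm setT (comb s c (translates f) \- comb t d (translates f)) =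
  nrm D (fun x => sqrtPhi f x * (tp s c x - tp t d x)).
Proof.
move=> us ut Lf.
have uu := undup_uniq (s ++ t).
have ss := @sub_undupl s t; have st := @sub_undupr s t.
rewrite (comb_widen c _ us uu ss) (comb_widen d _ ut uu st) combB nrm_comb//.
congr nrm; apply/funext => x; congr (_ * _).
rewrite -[tp s c]/(comb s c (@E R)) -[tp t d]/(comb t d (@E R)).
rewrite (comb_widen c _ us uu ss) (comb_widen d _ ut uu st).
by rewrite -[LHS]/(comb _ _ (@E R) x) -combB.
Qed.

(** Frame coefficients of a combination are Fourier coefficients of its symbol times the bracket, so
    Bessel and Parseval on D apply to frame sums. *)
Lemma coef_comb s c f g k : L2on setT f -> L2on setT g ->
  ip setT (comb s c (translates f)) (translates g k) =
  coef (fun x => tp s c x * brk (fourier f) (fourier g) x) k.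
Proof.
move=> Lf Lg.
have -> : translates g k = comb [:: k] (fun=> 1) (translates g).
  by apply/funext => x; rewrite /comb big_seq1 mul1r.
rewrite ip_comb// /coef /ip; congr cint; apply/funext => x.
by rewrite {2}/tp big_seq1 mul1r; ring.
Qed.

Lemma rPhi_le_of_synth f (b : R) : 0 <= b -> L2on setT f ->
  (forall s c, uniq s ->
    nrm2 setT (comb s c (translates f)) <= b * \sum_(k <- s) nsq (c k)) ->
  {ae mu, forall x, D x -> rPhi f x <= b}.
Proof.
move=> b0 Lf H.
(* Capping at b + 1 supplies the bounded weight that [ae_le_of_trig] requires; a minimum that is at
   most b cannot be attained by b + 1. *)
pose v x : C := (Num.sqrt (Num.min (rPhi f x) (b + 1)))%:C.
have m0 x : 0 <= Num.min (rPhi f x) (b + 1) by rewrite le_min rPhi_ge0/=; lra.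
have nv x : nsq (v x) = Num.min (rPhi f x) (b + 1) by rewrite nsqR sqr_sqrtr.
have mv : cmeas D v.
  apply: cmeasR; apply: measurable_sqrt => //; apply: measurable_minr => //.
  exact: rPhi_meas.
have mw : cmeas D (fun=> (Num.sqrt b)%:C : C) by exact: cmeas_cst.
have : {ae mu, forall x, D x -> nsq (v x) <= nsq ((Num.sqrt b)%:C : C)}.
  apply: (ae_le_of_trig (M := b + 1)) => //; first lra.
  - by apply: aeW => x _; rewrite nv ge_min lexx orbT.
  - by apply: aeW => x _; rewrite nsqR sqr_sqrtr//; lra.
  move=> p /trig_uniq[s [c [us ->]]].
  apply: (@le_trans _ _ (nrm D (fun x => sqrtPhi f x * tp s c x))).
    apply: nrm_mono.
    - by apply: cmeasM => //; apply: trig_meas => //; exact: trig_tp.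
    - exact: sqrtPhi_trig_L2 (trig_tp s c).
    - by apply: aeW => x _; rewrite !nsqM nv nsq_sqrtPhi ler_wpM2r// ge_min lexx.
  rewrite -nrm_comb//; apply: ler_wsqrtr; apply: le_trans (H s c us) _.
  rewrite nrm2Z//; last by apply: trig_L2; exact: trig_tp.
  by rewrite nsqR sqr_sqrtr// nrm2_tp.
apply: ae_mono => x h Dx; have := h Dx; rewrite nv nsqR sqr_sqrtr//.
by rewrite ge_min => /orP[//|]; lra.
Qed.

Lemma comb_le f (b : R) : 0 <= b -> L2on setT f -> {ae mu, forall x, D x -> rPhi f x <= b} ->
  forall s c, uniq s ->
    nrm2 setT (comb s c (translates f)) <= b * \sum_(k <- s) nsq (c k).
Proof.
move=> b0 Lf H s c us.
rewrite -nrm_sq nrm_comb// nrm_sq -nrm2_tp//.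
apply: nrm2M_le => //; first by apply: trig_L2; exact: trig_tp.
  exact: L2on_meas (sqrtPhi_L2 Lf).
by apply: ae_mono H => x H Dx; rewrite nsq_sqrtPhi; exact: H.
Qed.

(** With Bessel's inequality on D, the lower frame inequality for symbols p bounds a times the
    integral of |p|^2 Phi by that of |p|^2 Phi^2. Hence a Phi <= Phi^2 almost everywhere, which is
    the stated alternative. *)
Lemma rPhi_ge_of_lower f (a b : R) : 0 <= a -> 0 <= b -> L2on setT f ->
  {ae mu, forall x, D x -> rPhi f x <= b} ->
  (forall s c (e : R), uniq s -> 0 < e -> exists2 t, uniq t &
    a * nrm2 setT (comb s c (translates f)) - e <=
    \sum_(k <- t) nsq (ip setT (comb s c (translates f)) (translates f k))) ->
  {ae mu, forall x, D x -> rPhi f x = 0 \/ a <= rPhi f x}.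
Proof.
move=> a0 b0 Lf bP H.
pose v x : C := (Num.sqrt a)%:C * sqrtPhi f x.
pose w x : C := (rPhi f x)%:C.
have mv : cmeas D v.
  by apply: cmeasM => //; exact: L2on_meas (sqrtPhi_L2 Lf).
have mw : cmeas D w by apply: cmeasR; exact: rPhi_meas.
have nv x : nsq (v x) = a * rPhi f x by rewrite nsqM nsqR sqr_sqrtr// nsq_sqrtPhi.
have nw x : nsq (w x) = rPhi f x ^+ 2 by rewrite nsqR.
have M0 : 0 <= a * b + b ^+ 2 by rewrite addr_ge0 ?mulr_ge0 ?sqr_ge0.
have bw : {ae mu, forall x, D x -> nsq (w x) <= a * b + b ^+ 2}.
  apply: ae_mono bP => x h Dx; rewrite nw.
  have := h Dx; have := rPhi_ge0 f x; have := mulr_ge0 a0 b0; nra.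
have : {ae mu, forall x, D x -> nsq (v x) <= nsq (w x)}.
  apply: (ae_le_of_trig M0 mv mw) => //.
    apply: ae_mono bP => x h Dx; rewrite nv.
    have := ler_wpM2l a0 (h Dx); have := sqr_ge0 b; lra.
  move=> p /trig_uniq[s [c [us ->]]].
  have Lp : L2on D (tp s c) by apply: trig_L2; exact: trig_tp.
  have [Lwp _] := L2onM_ae M0 mw bw Lp.
  apply: ler_wsqrtr.
  have -> : nrm2 D (fun x => v x * tp s c x) = a * nrm2 setT (comb s c (translates f)).
    rewrite -[nrm2 setT _]nrm_sq nrm_comb// nrm_sq -[a in RHS]sqr_sqrtr// -nsqR -nrm2Z//.
      by congr nrm2; apply/funext => x; rewrite mulrA.
    exact: sqrtPhi_trig_L2 (trig_tp s c).
  apply/ler_addgt0Pr => e e0; have [t ut Ht] := H s c e us e0.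
  have h : \sum_(k <- t) nsq (ip setT (comb s c (translates f)) (translates f k)) <=
      nrm2 D (fun x => w x * tp s c x).
    under eq_bigr do rewrite coef_comb//.
    have -> : (fun x => tp s c x * brk (fourier f) (fourier f) x) = (fun x => w x * tp s c x).
      by apply/funext => x; rewrite brk_self mulrC.
    exact: bessel.
  lra.
apply: ae_mono => x h Dx; have := h Dx; rewrite nv nw => h1.
have := rPhi_ge0 f x; rewrite le_eqVlt => /orP[/eqP <-|p0]; [by left|right].
by rewrite -(ler_pM2r p0) -expr2.
Qed.

Lemma brk_le f g : L2on setT f -> L2on setT g ->
  {ae mu, forall x, D x -> nsq (brk (fourier f) (fourier g) x) <= rPhi f x * rPhi g x}.
Proof.
move=> Lf Lg; apply: ae_mono2 (PhiE_fin (fourier_L2 Lf)) (PhiE_fin (fourier_L2 Lg)).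
by move=> x h1 h2 Dx; apply: brk_CS; [exact: h1|exact: h2].
Qed.

End Fibers.

(** * Pointwise consequences of the hypotheses *)

Section Oblique.
Context {R : realType}.
Local Notation C := (R[i]).
Local Notation mu := (@lebesgue_measure R).
Local Notation D := (@D01 R).
Implicit Types (f g h u v w : R -> C) (c d : int -> C) (s t : seq int) (W V : set (R -> C)).

Let mT : @measurable _ (measurableTypeR R) [set: R] := measurableT.

Lemma cnormN (z : C) : cnorm (- z) = cnorm z.
Proof. by rewrite !cnormE nsqN. Qed.

(** All that is needed at one point, with a = Phi, b = Phi1, B the bracket, and al, be the bounds on
    Phi. In order: the upper frame bound of the dual system, its lower bound, boundedness of conj(H)
    B, and the error estimate. The constant 4 bounds (1 + eps)^2. *)
Lemma fiber_bounds (a b al be eps k : R) (B H : C) :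
  0 < al -> 0 <= eps -> eps < 1 -> 0 <= a -> a <= be -> (a = 0 \/ al <= a) -> 0 <= b ->
  nsq B <= a * b -> b <= k ^+ 2 * (nsq B / a) ->
  (a <> 0 -> cnorm (cj H * B - 1) <= eps * (cnorm B / Num.sqrt (a * b))) ->
  [/\ nsq H * b <= 4 * k ^+ 2 / al,
      (1 - eps) ^+ 2 / be * b <= nsq H * b ^+ 2,
      nsq (cj H * B) <= 4 &
      a * nsq (1 - cj H * B) <= eps ^+ 2 * (nsq B / b)].
Proof.
move=> al0 e0 e1 a0 abe aal b0 Bab bk Hb.
have k20 : 0 <= k ^+ 2 by exact: sqr_ge0.
(* Where a = 0, Cauchy-Schwarz forces B = 0, and the upper bound on b then forces b = 0. *)
have [az|/eqP az] := eqVneq a 0.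
  have B0 : B = 0.
    by apply: nsq_eq0; apply/eqP; rewrite eq_le nsq_ge0 andbT; move: Bab; rewrite az mul0r.
  have bz : b = 0.
    by apply/eqP; rewrite eq_le b0 andbT; move: bk; rewrite az B0 nsq0 mul0r mulr0.
  rewrite az bz B0 !mulr0 nsq0 !mul0r expr0n !mulr0; split => //.
  by apply: divr_ge0; [exact: mulr_ge0|exact: ltW].
have {}aal : al <= a by case: aal.
have ap : 0 < a by exact: lt_le_trans aal.
have bep : 0 < be by exact: lt_le_trans abe.
have ab0 : 0 <= a * b by exact: mulr_ge0.
(* By Cauchy-Schwarz; the hypothesis thus puts conj(H) B within eps of 1. *)
have ratio : cnorm B / Num.sqrt (a * b) <= 1.
  have [->|sp] := eqVneq (Num.sqrt (a * b)) 0; first by rewrite invr0 mulr0.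
  rewrite ler_pdivrMr ?lt_def ?sp ?sqrtr_ge0// mul1r cnormE.
  exact: ler_wsqrtr.
have Z1 : cnorm (cj H * B - 1) <= eps.
  by apply: le_trans (Hb az) _; rewrite ler_piMr.
have n1 : cnorm (1 : C) = 1 by rewrite cnormE (nsqR 1) expr1n sqrtr1.
have up : cnorm (cj H * B) <= 1 + eps.
  have -> : cj H * B = (cj H * B - 1) - - 1 by ring.
  by apply: le_trans (cnormB _ _) _; rewrite cnormN n1; lra.
have lo : 1 - eps <= cnorm (cj H * B).
  have := cnormB (cj H * B) (cj H * B - 1).
  have -> : cj H * B - (cj H * B - 1) = 1 by ring.
  rewrite n1; lra.
have Zle : nsq (cj H * B) <= 4.
  rewrite -cnorm_sq; have := cnorm_ge0 (cj H * B); nra.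
have Zge : (1 - eps) ^+ 2 <= nsq (cj H * B).
  by rewrite -cnorm_sq lerXn2r ?nnegrE//; lra.
have Ze : nsq (cj H * B) = nsq H * nsq B by rewrite nsqM nsqJ.
have z0 := nsq_ge0 B; have h0 := nsq_ge0 H.
have p0 : 0 < (1 - eps) ^+ 2 by rewrite exprn_gt0//; lra.
have bp : 0 < b.
  rewrite lt_def b0 andbT; apply/eqP => bz.
  have : nsq B = 0 by apply/eqP; rewrite eq_le z0 andbT; move: Bab; rewrite bz mulr0.
  by move=> zz; move: Zge; rewrite Ze zz mulr0; lra.
split => //.
- apply: (@le_trans _ _ (nsq H * (k ^+ 2 * (nsq B / a)))); first by rewrite ler_wpM2l.
  have -> : nsq H * (k ^+ 2 * (nsq B / a)) = (nsq H * nsq B * k ^+ 2) / a by rewrite mulrA [in RHS]mulrAC; ring.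
  rewrite -Ze; apply: ler_pM => //.
  + by rewrite mulr_ge0.
  + by rewrite invr_ge0.
  + by rewrite ler_wpM2r.
  + by rewrite lef_pV2.
- rewrite expr2 mulrA ler_wpM2r// ler_pdivrMr//.
  apply: le_trans Zge _; rewrite Ze -mulrA ler_wpM2l// mulrC.
  by apply: le_trans Bab _; rewrite ler_wpM2r.
- have -> : nsq (1 - cj H * B) = nsq (cj H * B - 1) by rewrite -nsqN opprB.
  have h1 : nsq (cj H * B - 1) <= eps ^+ 2 * (nsq B / (a * b)).
    rewrite -!cnorm_sq.
    have -> : eps ^+ 2 * (cnorm B ^+ 2 / (a * b)) = (eps * (cnorm B / Num.sqrt (a * b))) ^+ 2.
      by rewrite !exprMn exprVn sqr_sqrtr.
    rewrite lerXn2r ?nnegrE// ?mulr_ge0// ?invr_ge0 ?sqrtr_ge0//.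
    exact: Hb.
  apply: (@le_trans _ _ (a * (eps ^+ 2 * (nsq B / (a * b))))); first by rewrite ler_wpM2l.
  have -> : a * (eps ^+ 2 * (nsq B / (a * b))) = eps ^+ 2 * (nsq B / b).
    have an : a != 0 by exact: lt0r_neq0.
    have bn : b != 0 by exact: lt0r_neq0.
    by field; rewrite an bn.
  exact: lexx.
Qed.

Lemma bracketE f g x : bracket f g x = brk (fourier f) (fourier g) x.
Proof. by rewrite /bracket /brk; congr zsum; apply/funext => k; congr (_ * _); case: (fourier g _). Qed.

Lemma Phi_PhiE f x : Phi f x = PhiE (fourier f) x.
Proof. by rewrite /Phi /PhiE /esumZ; apply: eq_esum => k _; rewrite cnorm_sq. Qed.

Lemma periodic_int (H : R -> C) : (forall x, H (x + 1) = H x) ->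
  forall x (k : int), H (x + k%:~R) = H x.
Proof.
move=> per x.
have nat x' (n : nat) : H (x' + n%:R) = H x'.
  by elim: n => [|n IH]; rewrite ?addr0// -natr1 addrA per.
case=> n; first exact: nat.
by rewrite NegzE mulrNz -[RHS](nat _ n.+1) -[LHS](nat _ n.+1) addrNK nat.
Qed.

(** A countable intersection of translated full sets. The identity for the transform of [phit] is
    needed along whole orbits x + Z. *)
Lemma ae_int (Q : R -> Prop) : {ae mu, forall x, Q x} ->
  {ae mu, forall x, forall k : int, Q (x + k%:~R)}.
Proof.
move=> H.
have : {ae mu, forall x, forall n : nat, Q (x + (int_of n)%:~R)}.
  by apply: ae_foralln => n; exact: (ae_shift (int_of n)%:~R H).
apply: ae_mono => x h k.
have [n _ <-] : exists2 n, [set: nat] n & int_of n = k by have [_ _ /(_ k)] := int_of_bij; apply.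
exact: h.
Qed.

Lemma ae_fiber_mul phi1 phit (H : R -> C) : L2on setT phi1 ->
  (forall x, H (x + 1) = H x) ->
  {ae mu, forall x, fourier phit x = H x * fourier phi1 x} ->
  {ae mu, forall x, D x -> rPhi phit x = nsq (H x) * rPhi phi1 x} /\
  forall f, L2on setT f -> {ae mu, forall x, D x ->
    brk (fourier f) (fourier phit) x = cj (H x) * brk (fourier f) (fourier phi1) x}.
Proof.
move=> L1 per /ae_int Hae; have pi_ := periodic_int per; split.
- apply: ae_mono2 Hae (PhiE_fin (fourier_L2 L1)) => x h1 h2 Dx.
  rewrite /rPhi /PhiE.
  have -> : (fun k : int => nsq (fourier phit (x + k%:~R))) =
      (fun k : int => nsq (H x) * nsq (fourier phi1 (x + k%:~R))).
    by apply/funext => k; rewrite h1 pi_ nsqM.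
  by rewrite esumZZ// fineM//; exact: esumZ_fin (h2 Dx).
- move=> f Lf.
  apply: ae_mono2 (ae_mono2 _ Hae (PhiE_fin (fourier_L2 L1))) (PhiE_fin (fourier_L2 Lf)).
    2: by move=> x; exact: conj.
  move=> x [h1 h2] h3 Dx.
  rewrite /brk -zsumZ; last by apply: csum_mul; [exact: h3|exact: h2].
  by congr zsum; apply/funext => k; rewrite h1 pi_ conjM; ring.
Qed.

Lemma orth_ip V : closed_subspace V -> forall f g, L2on setT f -> L2on setT g ->
  orth V (f \- g) -> forall v, V v -> ip setT f v = ip setT g v.
Proof.
move=> clV f g Lf Lg [_ O] v Vv; have := O v Vv.
rewrite innerE ipBl//; last exact: (subsp_L2 clV).
by move/eqP; rewrite subr_eq0 => /eqP.
Qed.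

(** * Lower bound of the bracket on the fibres *)

Section CrossFiber.
Variables (W V : set (R -> C)) (phi phi1 : R -> C) (a b b1 k : R).
Hypotheses (clW : closed_subspace W) (clV : closed_subspace V).
Hypotheses (Lphi : L2on setT phi) (Lphi1 : L2on setT phi1).
Hypotheses (WF : forall j, W (translates phi j)) (VF : forall j, V (translates phi1 j)).
Hypotheses (a0 : 0 < a) (b0 : 0 < b) (k0 : 0 < k).
Hypotheses (hb : bessel_on W (translates phi) b) (ha : lower_on W (translates phi) a).
Hypothesis Pb1 : {ae mu, forall x, D x -> rPhi phi1 x <= b1}.
Hypothesis hk : forall v (t : R), V v -> 0 <= t ->
  (forall g, W g -> cnorm (ip setT g v) <= t * nrm setT g) -> nrm setT v <= k * t.

Local Notation B := (brk (fourier phi) (fourier phi1)).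

Lemma brk_meas f g : L2on setT f -> L2on setT g -> cmeas D (brk (fourier f) (fourier g)).
Proof. by move=> Lf Lg; apply: cintble_meas => //; exact: brk_int (fourier_L2 Lf) (fourier_L2 Lg). Qed.

Lemma measurable_inv (v : R -> R) : (forall x, 0 <= v x) -> measurable_fun D v ->
  measurable_fun D (fun x => (v x)^-1).
Proof.
move=> v0 mv; under eq_fun do rewrite -powR_inv1//.
exact: (measurableT_comp (measurable_powR (-1)) mv).
Qed.

(** With w = conj(B) / sqrt Phi, the inner product of the combinations with symbols p and q is that
    of sqrt(Phi) p and w q on D. So the second one, as a functional on W, has norm at most |w q|,
    and [hk] gives |sqrt(Phi1) q| <= k |w q| for every polynomial q. Where Phi = 0 the conclusion
    says that Phi1 = 0. *)
Lemma cross_fiber :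
  {ae mu, forall x, D x -> rPhi phi1 x <= k ^+ 2 * (nsq (B x) / rPhi phi x)}.
Proof.
have LF j : L2on setT (translates phi j) by exact: translates_L2.
have LF1 j : L2on setT (translates phi1 j) by exact: translates_L2.
pose w x : C := ((Num.sqrt (rPhi phi x))^-1)%:C * cj (B x).
have mB := brk_meas Lphi Lphi1.
have mw : cmeas D w.
  apply: cmeasM => //; last exact: cmeasJ.
  by apply: cmeasR; apply: measurable_inv => //; apply: measurable_sqrt => //; exact: rPhi_meas.
have nw x : nsq (w x) = nsq (B x) / rPhi phi x.
  by rewrite nsqM nsqR nsqJ exprVn sqr_sqrtr ?rPhi_ge0// mulrC.
have w_le : {ae mu, forall x, D x -> nsq (w x) <= rPhi phi1 x}.
  apply: ae_mono (brk_le Lphi Lphi1) => x h Dx; rewrite nw.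
  have := rPhi_ge0 phi x; rewrite le_eqVlt => /orP[/eqP <-|p0].
    by rewrite invr0 mulr0 rPhi_ge0.
  by rewrite ler_pdivrMr// mulrC; exact: h.
have b1' : {ae mu, forall x, D x -> nsq (sqrtPhi phi1 x) <= `|b1|}.
  by apply: ae_mono Pb1 => x h Dx; rewrite nsq_sqrtPhi; apply: le_trans (h Dx) (ler_norm _).
have wb : {ae mu, forall x, D x -> nsq (w x) <= `|b1|}.
  by apply: ae_mono2 w_le Pb1 => x h1 h2 Dx; apply: le_trans (h1 Dx) _; apply: le_trans (h2 Dx) (ler_norm _).
have key t d : uniq t -> nrm D (fun x => sqrtPhi phi1 x * tp t d x) <= k * nrm D (fun x => w x * tp t d x).
  move=> ut.
  have Lp : L2on D (tp t d) by apply: trig_L2; exact: trig_tp.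
  have [Lwp _] := L2onM_ae (normr_ge0 b1) mw wb Lp.
  pose v := comb t d (translates phi1).
  have Vv : V v by apply: subsp_comb.
  have Lv : L2on setT v by exact: (subsp_L2 clV Vv).
  set T := nrm D (fun x => w x * tp t d x).
  have T0 : 0 <= T by exact: nrm_ge0.
  rewrite -nrm_comb//; apply: hk => // g Wg.
  have Lg : L2on setT g by exact: (subsp_L2 clW Wg).
  apply: (le_of_eps (k := nrm setT v + T)) => [|e e0]; first by rewrite addr_ge0.
  have [s us [c Hc]] := frame_dense clW WF a0 b0 hb ha Wg e0.
  set u := comb s c (translates phi) in Hc.
  have Lu : L2on setT u by exact: comb_L2.
  have Lgu := L2onB mT Lg Lu.
  have h1 : cnorm (ip setT (g \- u) v) <= e * nrm setT v.
    by apply: le_trans (CS mT Lgu Lv) _; apply: ler_wpM2r.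
  have h2 : cnorm (ip setT u v) <= nrm setT u * T.
    have Lsp := sqrtPhi_trig_L2 Lphi (trig_tp s c).
    have -> : ip setT u v = ip D (fun x => sqrtPhi phi x * tp s c x) (fun x => w x * tp t d x).
      rewrite ip_comb//; apply: ae_eq_cint => //.
      - apply: cmeasM => //; apply: cmeasM => //; first by apply: trig_meas => //; exact: trig_tp.
        by apply: cmeasJ => //; apply: trig_meas => //; exact: trig_tp.
      - by apply: cmeasM => //; [exact: L2on_meas Lsp|apply: cmeasJ => //; exact: L2on_meas Lwp].
      apply: ae_mono (brk_le Lphi Lphi1) => x h Dx.
      rewrite /w !conjM conjK conjR /sqrtPhi.
      (* Where Phi = 0 the two square roots do not cancel, but the bracket vanishes by
         Cauchy-Schwarz. *)
      have := rPhi_ge0 phi x; rewrite le_eqVlt => /orP[/eqP p0|p0].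
        have -> : B x = 0.
          by apply: nsq_eq0; apply/eqP; rewrite eq_le nsq_ge0 andbT; move: (h Dx); rewrite -p0 mul0r.
        by rewrite !(mulr0, mul0r).
      have sq : (Num.sqrt (rPhi phi x))%:C * ((Num.sqrt (rPhi phi x))^-1)%:C = 1 :> C.
        by rewrite -realCM divff// gt_eqF// sqrtr_gt0.
      transitivity (tp s c x * cj (tp t d x) * B x * ((Num.sqrt (rPhi phi x))%:C * ((Num.sqrt (rPhi phi x))^-1)%:C)); last by ring.
      by rewrite sq mulr1.
    by rewrite /u nrm_comb//; exact: CS.
  have h3 : nrm setT u <= nrm setT g + e.
    by have := nrm_le_add mT Lu Lg; rewrite nrmBC; lra.
  have h4 : cnorm (ip setT g v) <= cnorm (ip setT (g \- u) v) + cnorm (ip setT u v).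
    have -> : ip setT g v = ip setT (g \- u) v - - ip setT u v by rewrite ipBl//; ring.
    by rewrite -[X in _ <= _ + X]cnormN; exact: cnormB.
  have h5 : nrm setT u * T <= (nrm setT g + e) * T by rewrite ler_wpM2r.
  lra.
have kw : {ae mu, forall x, D x -> nsq (k%:C * w x) <= k ^+ 2 * `|b1|}.
  by apply: ae_mono wb => x h Dx; rewrite nsqM nsqR ler_wpM2l ?sqr_ge0//; exact: h.
have M0 : 0 <= `|b1| + k ^+ 2 * `|b1| by rewrite addr_ge0// mulr_ge0// sqr_ge0.
have : {ae mu, forall x, D x -> nsq (sqrtPhi phi1 x) <= nsq (k%:C * w x)}.
  apply: (ae_le_of_trig M0).
  - exact: L2on_meas (sqrtPhi_L2 Lphi1).
  - by apply: cmeasM => //; exact: cmeas_cst.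
  - by apply: ae_mono b1' => x h Dx; apply: le_trans (h Dx) _; rewrite lerDl mulr_ge0// sqr_ge0.
  - by apply: ae_mono kw => x h Dx; apply: le_trans (h Dx) _; rewrite lerDr.
  move=> p /trig_uniq[t [d [ut ->]]]; apply: le_trans (key t d ut) _.
  have Lp : L2on D (tp t d) by apply: trig_L2; exact: trig_tp.
  have [Lwp _] := L2onM_ae (normr_ge0 b1) mw wb Lp.
  have -> : (fun x => k%:C * w x * tp t d x) = (fun x => k%:C * (w x * tp t d x)).
    by apply/funext => x; rewrite mulrA.
  by rewrite nrmZ// cnormE nsqR sqrtr_sqr ger0_norm// ltW.
apply: ae_mono => x h Dx; have := h Dx.
by rewrite nsq_sqrtPhi nsqM nsqR nw.
Qed.

End CrossFiber.

End Oblique.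

(** * The dual system *)

Section Dual.
Context {R : realType}.
Local Notation C := (R[i]).
Local Notation mu := (@lebesgue_measure R).
Local Notation D := (@D01 R).
Implicit Types (f g h u v w : R -> C) (c d : int -> C) (s t : seq int).

Let mT : @measurable _ (measurableTypeR R) [set: R] := measurableT.

Variables (W V : set (R -> C)) (phi phi1 phit H : R -> C) (eps a b a1 b1 M m : R).
Hypotheses (clW : closed_subspace W) (clV : closed_subspace V).
Hypotheses (Lphi : L2on setT phi) (Lphi1 : L2on setT phi1).
Hypotheses (WF : forall j, W (translates phi j)) (VF : forall j, V (translates phi1 j)).
Hypotheses (a0 : 0 < a) (b0 : 0 < b) (a10 : 0 < a1) (b10 : 0 < b1).
Hypotheses (hb : bessel_on W (translates phi) b) (ha : lower_on W (translates phi) a).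
Hypotheses (hb1 : bessel_on V (translates phi1) b1) (ha1 : lower_on V (translates phi1) a1).
Hypotheses (Vt : V phit) (mH : cmeas D H).
Hypotheses (Pb : {ae mu, forall x, D x -> rPhi phi x <= b}).
Hypotheses (Pb1 : {ae mu, forall x, D x -> rPhi phi1 x <= b1}).
Hypotheses (Pa1 : {ae mu, forall x, D x -> rPhi phi1 x = 0 \/ a1 <= rPhi phi1 x}).
Hypotheses (Pt : {ae mu, forall x, D x -> rPhi phit x = nsq (H x) * rPhi phi1 x}).
Hypotheses (Bt : forall f, L2on setT f -> {ae mu, forall x, D x ->
    brk (fourier f) (fourier phit) x = cj (H x) * brk (fourier f) (fourier phi1) x}).

Local Notation B := (brk (fourier phi) (fourier phi1)).

(** The four pointwise bounds of [fiber_bounds], with the upper and lower constants M and m kept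
    abstract. *)
Hypotheses (m0 : 0 < m) (M0 : 0 <= M) (eps0 : 0 <= eps).
Hypotheses (fM : {ae mu, forall x, D x -> nsq (H x) * rPhi phi1 x <= M})
  (fm : {ae mu, forall x, D x -> m * rPhi phi1 x <= nsq (H x) * rPhi phi1 x ^+ 2})
  (f4 : {ae mu, forall x, D x -> nsq (cj (H x) * B x) <= 4})
  (fe : {ae mu, forall x, D x ->
    rPhi phi x * nsq (1 - cj (H x) * B x) <= eps ^+ 2 * (nsq (B x) / rPhi phi1 x)}).

Let Lt : L2on setT phit := subsp_L2 clV Vt.
Let LF j : L2on setT (translates phi j) := translates_L2 j Lphi.
Let LF1 j : L2on setT (translates phi1 j) := translates_L2 j Lphi1.
Let LG j : L2on setT (translates phit j) := translates_L2 j Lt.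
Let mB : cmeas D B := brk_meas Lphi Lphi1.

Let Ltp s c : L2on D (tp s c).
Proof. by apply: trig_L2; exact: trig_tp. Qed.

(** V is translation invariant: [phit] is a limit of combinations of the translates of [phi1], and
    shifting such a combination only relabels the translates. *)
Lemma translates_mem j : V (translates phit j).
Proof.
apply: subsp_approx => // e e0.
have [s us [c Hc]] := frame_dense clV VF a10 b10 hb1 ha1 Vt e0.
exists (comb s c (fun k => translates phi1 (k + j))).
  by apply: subsp_comb => // k; exact: VF.
rewrite nrmBC.
have -> : translates phit j \- comb s c (fun k => translates phi1 (k + j)) =
    fun x => (phit \- comb s c (translates phi1)) (x + (- j)%:~R).
  apply/funext => x; rewrite /translates /translate /comb /= mulrNz; congr (_ - _).
  by apply: eq_bigr => k _; congr (_ * phi1 _); rewrite mulrzDr; ring.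
rewrite /nrm nrm2_shift//; apply: L2on_meas; apply: L2onB => //; exact: comb_L2.
Qed.

(** Phi of [phit] is |H|^2 Phi1 <= M, which bounds synthesis and, by duality, analysis. It holds on
    all of L^2, as the synthesis of the analysis of an arbitrary f requires. *)
Lemma dual_bessel f s : L2on setT f -> uniq s ->
  \sum_(k <- s) nsq (ip setT f (translates phit k)) <= M * nrm2 setT f.
Proof.
move=> Lf us; apply: bessel_of_synth_le => //.
apply: comb_le => //.
by apply: ae_mono2 Pt fM => x h1 h2 Dx; rewrite h1//; exact: h2.
Qed.

(** The coefficients of the combination with symbol p are the Fourier coefficients of conj(H) Phi1
    p. Parseval gives the integral of |H|^2 Phi1^2 |p|^2, which [fm] bounds below by m times that of
    Phi1 |p|^2. *)
Lemma dual_lower_comb s c (e : R) : uniq s -> 0 < e -> exists2 t, uniq t &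
  m * nrm2 setT (comb s c (translates phi1)) - e <=
  \sum_(k <- t) nsq (ip setT (comb s c (translates phi1)) (translates phit k)).
Proof.
move=> us e0.
pose X x : C := cj (H x) * (rPhi phi1 x)%:C.
have mX : cmeas D X.
  by apply: cmeasM => //; [exact: cmeasJ|apply: cmeasR; exact: rPhi_meas].
have nX x : nsq (X x) = nsq (H x) * rPhi phi1 x ^+ 2 by rewrite nsqM nsqJ nsqR.
have bX : {ae mu, forall x, D x -> nsq (X x) <= M * b1}.
  apply: ae_mono2 fM Pb1 => x h1 h2 Dx; rewrite nX expr2 mulrA.
  by apply: ler_pM; [apply: mulr_ge0 => //; exact: rPhi_ge0|exact: rPhi_ge0|exact: h1|exact: h2].
have Mb : 0 <= M * b1 by rewrite mulr_ge0// ltW.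
have [LX _] := L2onM_ae Mb mX bX (Ltp s c).
have mE k : cmeas D (fun x => cj (E k x)) by apply: cmeasJ => //; exact: cmeasE.
have cE k : ip setT (comb s c (translates phi1)) (translates phit k) =
    coef (fun x => X x * tp s c x) k.
  rewrite coef_comb//; apply: ae_eq_cint => //.
  - have m1 := brk_meas Lphi1 Lt; have m2 := L2on_meas (Ltp s c).
    exact: (cmeasM (cmeasM m2 m1) (mE k)).
  - have m1 := L2on_meas LX; exact: (cmeasM m1 (mE k)).
  apply: ae_mono (Bt Lphi1) => x h Dx; rewrite h// brk_self -/(rPhi phi1 x) /X; ring.
apply: esum_adherent => //.
under eq_esum do rewrite cE.
rewrite parseval// lee_fin -nrm_sq nrm_comb// nrm_sq.
have -> : m * nrm2 D (fun x => sqrtPhi phi1 x * tp s c x) =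
    nrm2 D (fun x => (Num.sqrt m)%:C * (sqrtPhi phi1 x * tp s c x)).
  rewrite nrm2Z ?nsqR ?sqr_sqrtr//; last exact: sqrtPhi_trig_L2 (trig_tp s c).
  exact: ltW.
apply: (nrm2_mono _ LX _).2.
  by apply: cmeasM => //; exact: L2on_meas (sqrtPhi_trig_L2 Lphi1 (trig_tp s c)).
apply: ae_mono fm => x h Dx.
have -> : nsq ((Num.sqrt m)%:C * (sqrtPhi phi1 x * tp s c x)) = m * rPhi phi1 x * nsq (tp s c x).
  by rewrite nsqM (nsqR (Num.sqrt m)) sqr_sqrtr ?(ltW m0)// nsqM nsq_sqrtPhi mulrA.
rewrite nsqM nX; apply: ler_wpM2r => //; exact: h.
Qed.

Lemma dual_lower : lower_on V (translates phit) (m / 8).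
Proof.
move=> f e Vf e0; have Lf : L2on setT f := subsp_L2 clV Vf.
have mM : 0 < m + M by rewrite ltr_wpDr.
have [n0|npos] := leP (nrm2 setT f) 0.
  exists [::] => //; rewrite big_nil.
  have -> : nrm2 setT f = 0 by apply/eqP; rewrite eq_le n0 nrm2_ge0.
  by rewrite mulr0; lra.
(* From |f|^2 <= 2 |u|^2 + 2 |f - u|^2 and the same splitting of the coefficients, 4 S >= (m - 2 m
   tau - 4 M tau) |f|^2 - 2 e. With (m + M) tau = m / 8 at most half of m is lost, which leaves m /
   8. *)
pose tau := m / (8 * (m + M)).
have tau0 : 0 < tau by rewrite divr_gt0// mulr_gt0.
have tauE : (m + M) * tau = m / 8 by rewrite /tau; field; exact: lt0r_neq0.
have d0 : 0 < Num.sqrt (tau * nrm2 setT f) by rewrite sqrtr_gt0 mulr_gt0.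
have [s us [c Hc]] := frame_dense clV VF a10 b10 hb1 ha1 Vf d0.
set u := comb s c (translates phi1) in Hc.
have Lu : L2on setT u by exact: comb_L2.
have Lfu : L2on setT (f \- u) by exact: L2onB.
have {}Hc : nrm2 setT (f \- u) <= tau * nrm2 setT f.
  have tn : 0 <= tau * nrm2 setT f by rewrite mulr_ge0// ltW.
  by rewrite -nrm_sq -(sqr_sqrtr tn) lerXn2r ?nnegrE ?sqrtr_ge0.
have [t ut Ht] := dual_lower_comb c us e0; rewrite -/u in Ht.
exists t => //.
set S := \sum_(k <- t) nsq (ip setT f _).
have h1 : \sum_(k <- t) nsq (ip setT u (translates phit k)) <=
    2 * S + 2 * (M * nrm2 setT (f \- u)).
  apply: (@le_trans _ _ (2 * S + 2 * \sum_(k <- t) nsq (ip setT (f \- u) (translates phit k)))).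
    rewrite !mulr_sumr -big_split; apply: ler_sum => k _.
    have -> : ip setT u (translates phit k) =
        ip setT f (translates phit k) + - ip setT (f \- u) (translates phit k).
      by rewrite ipBl//; ring.
    by apply: le_trans (nsqD_le _ _) _; rewrite nsqN.
  by rewrite lerD2l ler_pM2l//; exact: dual_bessel.
have h2 : nrm2 setT f <= 2 * nrm2 setT u + 2 * nrm2 setT (f \- u).
  have := nrm_le_add mT Lf Lu; rewrite -!nrm_sq.
  move=> h2.
  have : nrm setT f ^+ 2 <= (nrm setT u + nrm setT (f \- u)) ^+ 2.
    by rewrite lerXn2r ?nnegrE ?addr_ge0.
  have := sqr_ge0 (nrm setT u - nrm setT (f \- u)).
  by rewrite sqrrB sqrrD; lra.
have h3 : M * nrm2 setT (f \- u) <= M * (tau * nrm2 setT f) by exact: ler_wpM2l.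
have h4 : m * nrm2 setT f <= m * (2 * nrm2 setT u + 2 * (tau * nrm2 setT f)).
  by apply: ler_wpM2l; [exact: ltW|lra].
have h5 : m / 8 * nrm2 setT f = m * (tau * nrm2 setT f) + M * (tau * nrm2 setT f).
  by rewrite -tauE; ring.
have h6 : 0 <= M * (tau * nrm2 setT f) by apply: mulr_ge0 => //; apply: mulr_ge0 => //; exact: ltW.
have h8 : 0 <= m * (tau * nrm2 setT f).
  by apply: mulr_ge0 => //; [exact: ltW|apply: mulr_ge0 => //; exact: ltW].
have h7 : 0 < m / 8 * nrm2 setT f by rewrite mulr_gt0// divr_gt0.
lra.
Qed.

Lemma dual_frame : is_frame V (translates phit).
Proof.
apply: (frameI (a := m / 8) (b := M) clV translates_mem); first by rewrite divr_gt0.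
- by move=> f s Vf us; apply: dual_bessel => //; exact: (subsp_L2 clV).
- exact: dual_lower.
Qed.

(** The weight of the final estimate. It is 0 where Phi1 vanishes, and Cauchy-Schwarz bounds |w|^2
    by Phi <= b. *)
Let w x : C := ((Num.sqrt (rPhi phi1 x))^-1)%:C * B x.

Let nw x : nsq (w x) = nsq (B x) / rPhi phi1 x.
Proof. by rewrite nsqM nsqR exprVn sqr_sqrtr ?rPhi_ge0// mulrC. Qed.

Let mw : cmeas D w.
Proof.
apply: cmeasM => //; apply: cmeasR; apply: measurable_inv => //.
by apply: measurable_sqrt => //; exact: rPhi_meas.
Qed.

Let bw : {ae mu, forall x, D x -> nsq (w x) <= b}.
Proof.
apply: ae_mono2 (brk_le Lphi Lphi1) Pb => x h1 h2 Dx; rewrite nw.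
have := rPhi_ge0 phi1 x; rewrite le_eqVlt => /orP[/eqP <-|p0].
  by rewrite invr0 mulr0; exact: ltW.
by rewrite ler_pdivrMr//; apply: le_trans (h1 Dx) _; rewrite ler_pM2r//; exact: h2.
Qed.

(* Tests the combination against those of the translates of phi1, whose symbols
   may be taken in L^2 by density; the optimal symbol is tp s c * B / rPhi phi1. *)
Lemma symbol_le s c f g : L2on setT f -> L2on setT g ->
  (forall v, V v -> ip setT f v = ip setT g v) ->
  nrm D (fun x => w x * tp s c x) <=
  nrm setT (g \- comb s c (translates phi)) + nrm setT f.
Proof.
move=> Lf Lg fg.
set gp := comb s c _; set K := _ + _.
have Lgp : L2on setT gp by exact: comb_L2.
have Lgd : L2on setT (g \- gp) by exact: L2onB.
have K0 : 0 <= K by exact: addr_ge0.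
have bB : {ae mu, forall x, D x -> nsq (B x) <= b * b1}.
  apply: ae_mono2 (ae_mono2 _ (brk_le Lphi Lphi1) Pb) Pb1; last by move=> x; exact: conj.
  move=> x [h1 h2] h3 Dx; apply: le_trans (h1 Dx) _.
  by apply: ler_pM; [exact: rPhi_ge0|exact: rPhi_ge0|exact: h2|exact: h3].
have bb : 0 <= b * b1 by rewrite mulr_ge0// ltW.
have [LBp _] := L2onM_ae bb mB bB (Ltp s c).
have [Lwp _] := L2onM_ae (ltW b0) mw bw (Ltp s c).
have b1' : {ae mu, forall x, D x -> nsq (sqrtPhi phi1 x) <= b1}.
  by apply: ae_mono Pb1 => x h Dx; rewrite nsq_sqrtPhi; exact: h.
have ext := ip_le_of_trig (ltW b10) K0 LBp (L2on_meas (sqrtPhi_L2 Lphi1)) b1'.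
have {}ext : forall r, L2on D r -> cnorm (ip D (fun x => B x * tp s c x) r) <=
    K * nrm D (fun x => sqrtPhi phi1 x * r x).
  apply: ext => p /trig_uniq[t [d [ut ->]]].
  pose v := comb t d (translates phi1).
  have Vv : V v by exact: subsp_comb.
  have Lv : L2on setT v by exact: comb_L2.
  have -> : ip D (fun x => B x * tp s c x) (tp t d) = ip setT gp v.
    by rewrite ip_comb// /ip; congr cint; apply/funext => x; ring.
  rewrite -nrm_comb// -/v.
  have -> : ip setT gp v = ip setT f v - ip setT (g \- gp) v.
    by rewrite fg// ipBl//; ring.
  apply: le_trans (cnormB _ _) _; rewrite /K mulrDl addrC.
  by apply: lerD; exact: CS.
pose r x : C := ((rPhi phi1 x)^-1)%:C * B x * tp s c x.
have mr : cmeas D (fun x => ((rPhi phi1 x)^-1)%:C * B x).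
  apply: cmeasM => //; apply: cmeasR; apply: measurable_inv; last exact: rPhi_meas.
  by move=> x; exact: rPhi_ge0.
have Lr : L2on D r.
  (* |B|^2 / Phi1^2 = |w|^2 / Phi1, where either Phi1 = 0 and the quotient is 0, or Phi1 >= a1. *)
  apply: (L2onM_ae (M := b / a1) _ mr _ (Ltp s c)).1; first by rewrite divr_ge0// ltW.
  apply: ae_mono2 bw Pa1 => x h1 h2 Dx; rewrite nsqM nsqR.
  have [->|pa] := h2 Dx; first by rewrite invr0 expr0n mul0r divr_ge0// ltW.
  have p0 : 0 < rPhi phi1 x by exact: lt_le_trans pa.
  have -> : (rPhi phi1 x)^-1 ^+ 2 * nsq (B x) = nsq (w x) / rPhi phi1 x.
    by rewrite nw; field; exact: lt0r_neq0.
  by apply: ler_pM; rewrite ?invr_ge0 ?rPhi_ge0 ?lef_pV2//; exact: h1.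
(* For this r the pairing equals |w p|^2 and the norm of sqrt(Phi1) r equals |w p|, with p =
   [tp s c]; cancelling one factor leaves the claim. *)
have := ext r Lr.
have e1 : ip D (fun x => B x * tp s c x) r = (nrm2 D (fun x => w x * tp s c x))%:C.
  transitivity (ip D (fun x => w x * tp s c x) (fun x => w x * tp s c x)); last exact: ipff.
  apply: (congr1 (cint D)); apply/funext => x; rewrite /r /w !conjM !conjR.
  have -> : (rPhi phi1 x)^-1 = (Num.sqrt (rPhi phi1 x))^-1 * (Num.sqrt (rPhi phi1 x))^-1.
    by rewrite -invfM -expr2 sqr_sqrtr// rPhi_ge0.
  by rewrite realCM; ring.
have e2 : nrm D (fun x => sqrtPhi phi1 x * r x) = nrm D (fun x => w x * tp s c x).
  congr Num.sqrt; apply: eq_Rintegral => x _; rewrite /r [in LHS]nsqM nsq_sqrtPhi [in RHS]nsqM nw.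
  rewrite 2!nsqM nsqR mulrA.
  have [->|p0] := eqVneq (rPhi phi1 x) 0; first by rewrite invr0 mulr0 !mul0r.
  by congr (_ * _); field.
rewrite e1 e2 cnormE nsqR sqrtr_sqr ger0_norm// -nrm_sq expr2.
set Q := nrm D _; have : 0 <= Q by exact: nrm_ge0.
rewrite le_eqVlt => /orP[/eqP <- //|Q0].
by rewrite ler_pM2r.
Qed.

(** The path from g to h goes through gp (a combination with symbol p), hp (a finite part of the
    synthesis of its analysis) and ht (the same finite part for f). Only the step from gp to hp
    carries the factor eps; the others are small. *)
Lemma oblique_error f g h : L2on setT f -> W g ->
  (forall v, V v -> ip setT f v = ip setT g v) ->
  is_synthesis (translates phi) (analysis (translates phit) f) h ->
  nrm setT (g \- h) <= eps * nrm setT f.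
Proof.
move=> Lf Wg fg /(synthesisP LF)[Lh Hh].
have Lg : L2on setT g := subsp_L2 clW Wg.
(* e from g to gp, (eps + sqrt b) e from gp to hp, sqrt b sqrt M e from hp to ht, and e from ht to
   h. *)
apply: (le_of_eps (k := 2 + eps + Num.sqrt b + Num.sqrt b * Num.sqrt M)) => [|e e0].
  by rewrite !addr_ge0 ?mulr_ge0 ?sqrtr_ge0.
have [s us [c Hc]] := frame_dense clW WF a0 b0 hb ha Wg e0.
set gp := comb s c _ in Hc.
have Lgp : L2on setT gp by exact: comb_L2.
have Lgd : L2on setT (gp \- g) by exact: L2onB.
pose Z x : C := cj (H x) * B x.
have mZ : cmeas D Z by apply: cmeasM => //; exact: cmeasJ.
have [|LZp _] := L2onM_ae _ mZ f4 (Ltp s c); first by [].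
set Y := (fun x => _) in LZp.
have mE k : cmeas D (fun x => cj (E k x)) by apply: cmeasJ => //; exact: cmeasE.
have cE k : ip setT gp (translates phit k) = coef Y k.
  rewrite coef_comb//; apply: ae_eq_cint => //.
  - have m1 := brk_meas Lphi Lt; have m2 := L2on_meas (Ltp s c).
    exact: (cmeasM (cmeasM m2 m1) (mE k)).
  - have m1 := L2on_meas LZp; exact: (cmeasM m1 (mE k)).
  by apply: ae_mono (Bt Lphi) => x hB Dx; rewrite hB// /Y /Z; ring.
have e20 : 0 < e ^+ 2 by rewrite exprn_gt0.
have [s1 us1 Hs1] := coef_approx LZp e20.
have [s2 us2 Hs2] := Hh e e0.
(* One list on which both the Fourier sum of Y and the synthesis of f are accurate. *)
pose t := undup (s1 ++ s2).
have ut : uniq t by exact: undup_uniq.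
have {}Hs1 : nrm D (Y \- tp t (coef Y)) <= e.
  rewrite -(@ler_pXn2r _ 2) ?nnegrE//; last exact: ltW.
  by rewrite nrm_sq; apply: Hs1 => //; exact: sub_undupl.
have {}Hs2 : nrm setT (h \- comb t (analysis (translates phit) f) (translates phi)) <= e.
  by apply: Hs2 => //; exact: sub_undupr.
set ht := comb t (analysis _ _) _ in Hs2.
pose hp := comb t (coef Y) (translates phi).
have Lht : L2on setT ht by exact: comb_L2.
have Lhp : L2on setT hp by exact: comb_L2.
have T3 : nrm setT (hp \- ht) <= Num.sqrt b * Num.sqrt M * e.
  rewrite /hp /ht combB -(@ler_pXn2r _ 2) ?nnegrE//; last first.
    by rewrite !mulr_ge0 ?sqrtr_ge0// ltW.
  rewrite nrm_sq !exprMn !sqr_sqrtr//; last exact: ltW.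
  apply: le_trans (comb_le (ltW b0) Lphi Pb _ ut) _.
  rewrite -mulrA ler_pM2l//.
  (* The coefficients of f and g agree because the translates of [phit] lie in V, so hp - ht is
     synthesized from the coefficients of gp - g. *)
  have -> : \sum_(k <- t) nsq (coef Y k - analysis (translates phit) f k) =
      \sum_(k <- t) nsq (ip setT (gp \- g) (translates phit k)).
    apply: eq_bigr => k _; rewrite /analysis innerE fg; last exact: translates_mem.
    by rewrite ipBl// cE.
  apply: le_trans (dual_bessel Lgd ut) _; apply: ler_wpM2l => //.
  by rewrite -nrm_sq lerXn2r ?nnegrE ?(ltW e0)// nrmBC.
have bs : {ae mu, forall x, D x -> nsq (sqrtPhi phi x) <= b}.
  by apply: ae_mono Pb => x hx Dx; rewrite nsq_sqrtPhi; exact: hx.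
have ms : cmeas D (sqrtPhi phi) := L2on_meas (sqrtPhi_L2 Lphi).
have T2 : nrm setT (gp \- hp) <= eps * (e + nrm setT f) + Num.sqrt b * e.
  rewrite /gp /hp nrm_combB//.
  have Lpy : L2on D (tp s c \- Y) by exact: L2onB.
  have Lyt : L2on D (Y \- tp t (coef Y)) by exact: L2onB.
  have [L1 _] := L2onM_ae (ltW b0) ms bs Lpy.
  have [L2_ h2] := L2onM_ae (ltW b0) ms bs Lyt.
  (* The true error p - Y = p (1 - conj(H) B), controlled by [fe], plus the truncation of the
     Fourier series of Y. *)
  have -> : (fun x => sqrtPhi phi x * (tp s c x - tp t (coef Y) x)) =
      (fun x => sqrtPhi phi x * (tp s c \- Y) x) \+ (fun x => sqrtPhi phi x * (Y \- tp t (coef Y)) x).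
    by apply/funext => x /=; ring.
  apply: le_trans (nrm_triangle mD01 L1 L2_) _; apply: lerD; last first.
    by apply: le_trans h2 _; apply: ler_wpM2l => //; exact: sqrtr_ge0.
  have [Lwp _] := L2onM_ae (ltW b0) mw bw (Ltp s c).
  apply: (@le_trans _ _ (nrm D (fun x => eps%:C * (w x * tp s c x)))).
    apply: nrm_mono; [exact: L2on_meas L1|exact: L2onZ|].
    apply: ae_mono fe => x hx Dx; rewrite nsqM nsq_sqrtPhi.
    have -> : nsq (eps%:C * (w x * tp s c x)) = eps ^+ 2 * (nsq (B x) / rPhi phi1 x) * nsq (tp s c x).
      by rewrite nsqM (nsqR eps) nsqM nw mulrA.
    have -> : nsq ((tp s c \- Y) x) = nsq (1 - Z x) * nsq (tp s c x).
      by rewrite -nsqM; congr nsq; rewrite /Y /=; ring.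
    rewrite mulrA; apply: ler_wpM2r; first exact: nsq_ge0.
    exact: hx.
  rewrite nrmZ// cnormE nsqR sqrtr_sqr ger0_norm//; apply: ler_wpM2l => //.
  by apply: le_trans (symbol_le s c Lf Lg fg) _; rewrite lerD2r.
have k1 : nrm setT (g \- h) <= nrm setT (g \- gp) + nrm setT (gp \- h).
  exact: nrm_triangleB.
have k2 : nrm setT (gp \- h) <= nrm setT (gp \- hp) + nrm setT (hp \- h).
  exact: nrm_triangleB.
have k3 : nrm setT (hp \- h) <= nrm setT (hp \- ht) + nrm setT (ht \- h).
  exact: nrm_triangleB.
rewrite [X in _ <= _ + X]nrmBC in k3.
apply: le_trans k1 _.
apply: le_trans (lerD Hc (le_trans k2 (lerD T2 (le_trans k3 (lerD T3 Hs2))))) _.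
by rewrite le_eqVlt; apply/orP; left; apply/eqP; ring.
Qed.

Lemma dual_synthesis_exists f : L2on setT f ->
  exists h, is_synthesis (translates phi) (analysis (translates phit) f) h.
Proof.
move=> Lf; apply: (synthesis_exists LF (ltW b0) (comb_le (ltW b0) Lphi Pb) (S := M * nrm2 setT f)).
move=> s us; apply: le_trans (dual_bessel Lf us); apply: ler_sum => k _.
  by rewrite /analysis innerE.
Qed.

End Dual.

Theorem theorem8p4 (R : realType) (W V : set (R -> R[i]))
    (phi phi1 phit H : R -> R[i]) (eps : R)
    (hW : closed_subspace W) (hV : closed_subspace V)
    (hWV : direct_sum W (orth V))
    (hphi : L2 phi) (hphi1 : L2 phi1)
    (hF : is_frame W (translates phi))
    (hF1 : is_frame V (translates phi1))
    (heps0 : 0 <= eps) (heps1 : eps < 1)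
    (hphit : V phit)
    (hH : Cper 2%:E H)
    (hphitE : {ae lebesgue_measure, forall gamma : R,
        fourier phit gamma = H gamma * fourier phi1 gamma})
    (hbound : {ae lebesgue_measure, forall gamma : R,
        (~` zeros (Phi phi)) gamma ->
        cnorm ((H gamma)^* * bracket phi phi1 gamma - 1)
        <= eps * (cnorm (bracket phi phi1 gamma)
             / Num.sqrt (fine (Phi phi gamma) * fine (Phi phi1 gamma)))}) :
  approx_oblique_dual W V eps (translates phi) (translates phit).
Proof.
have Lphi : L2on setT phi by exact/L2P.
have Lphi1 : L2on setT phi1 by exact/L2P.
have [per /Lp2P[mH _]] := hH.
have [WF [a [b [a0 b0 hb ha]]]] := frameP hW hF.
have [VF [a1 [b1 [a10 b10 hb1 ha1]]]] := frameP hV hF1.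
have [k k0 hk] := oblique_dual_norm hW hV hWV.
have Pb := rPhi_le_of_synth (ltW b0) Lphi (frame_synth_le hW WF b0 hb).
have Pb1 := rPhi_le_of_synth (ltW b10) Lphi1 (frame_synth_le hV VF b10 hb1).
have Pa := rPhi_ge_of_lower (ltW a0) (ltW b0) Lphi Pb
  (fun s c e us e0 => ha _ e (subsp_comb hW s c WF) e0).
have Pa1 := rPhi_ge_of_lower (ltW a10) (ltW b10) Lphi1 Pb1
  (fun s c e us e0 => ha1 _ e (subsp_comb hV s c VF) e0).
have cross := cross_fiber hW hV Lphi Lphi1 WF VF a0 b0 k0 hb ha Pb1 hk.
have [Pt Bt] := ae_fiber_mul Lphi1 per hphitE.
have facts : {ae lebesgue_measure, forall x : R, D01 x ->
   [/\ nsq (H x) * rPhi phi1 x <= 4 * k ^+ 2 / a,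
      (1 - eps) ^+ 2 / b * rPhi phi1 x <= nsq (H x) * rPhi phi1 x ^+ 2,
      nsq (cj (H x) * brk (fourier phi) (fourier phi1) x) <= 4 &
      rPhi phi x * nsq (1 - cj (H x) * brk (fourier phi) (fourier phi1) x) <=
      eps ^+ 2 * (nsq (brk (fourier phi) (fourier phi1) x) / rPhi phi1 x)]}.
  have c1 := ae_mono2 (fun x => @conj _ _) Pb Pa.
  have c2 := ae_mono2 (fun x => @conj _ _) (brk_le Lphi Lphi1) cross.
  apply: ae_mono2 (ae_mono2 (fun x => @conj _ _) c2 hbound) c1.
  move=> x [[h3 h4] h5] [h1 h2] Dx.
  apply: (fiber_bounds a0 heps0 heps1 (rPhi_ge0 _ _) (h1 Dx) (h2 Dx) (rPhi_ge0 _ _) (h3 Dx) (h4 Dx)).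
  move=> P0; move: h5; rewrite bracketE !Phi_PhiE => h5.
  have -> : cj (H x) = (H x)^* by case: (H x).
  (* A nonzero [rPhi] excludes Phi = 0, so the point lies outside [zeros] and the hypothesis
     applies. *)
  by apply: h5; rewrite /zeros /= Phi_PhiE => z; apply: P0; rewrite /rPhi z.
have m0 : 0 < (1 - eps) ^+ 2 / b by rewrite divr_gt0// exprn_gt0// subr_gt0.
have M0 : 0 <= 4 * k ^+ 2 / a.
  by apply: divr_ge0; [apply: mulr_ge0 => //; exact: sqr_ge0|exact: ltW].
have fM := ae_mono (fun x h Dx => let: And4 c _ _ _ := h Dx in c) facts.
have fm := ae_mono (fun x h Dx => let: And4 _ c _ _ := h Dx in c) facts.
have f4 := ae_mono (fun x h Dx => let: And4 _ _ c _ := h Dx in c) facts.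
have fe := ae_mono (fun x h Dx => let: And4 _ _ _ c := h Dx in c) facts.
split; first exact: hF.
- exact: (dual_frame hV Lphi1 VF a10 b10 hb1 ha1 hphit mH Pb1 Pt Bt m0 M0 fM fm).
apply: ge_ereal_sup => _ [f [/L2P Lf f1] <-] /=.
set g := oblique_proj W (orth V) f.
(* [oblique_proj] is a choice; the direct sum supplies a witness, and any representative satisfies
   the two properties used. *)
have [Wg Og] : W g /\ orth V (f \- g).
  have [g' [h' [Wg' Oh' fE]]] := hWV.1 f ((L2P f).2 Lf).
  apply: (@xgetPex _ (fun _ => 0) [set g | W g /\ orth V (f \- g)]); exists g'; split => //.
  by have -> : f \- g' = h' by apply/funext => x; rewrite fE /=; ring.
have Lg := subsp_L2 hW Wg.
have fg v : V v -> ip setT f v = ip setT g v by exact: (orth_ip hV Lf Lg Og).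
have [h' Hh'] := dual_synthesis_exists hV Lphi b0 hphit Pb Pt M0 fM Lf.
set h := synthesis _ _.
have Hh : is_synthesis (translates phi) (analysis (translates phit) f) h.
  by apply: (@xgetPex _ (fun _ => 0) (is_synthesis _ _)); exists h'.
have Lh : L2on setT h by apply/L2P; exact: Hh.1.
rewrite norm2E; last exact: L2onB.
rewrite lee_fin.
have := oblique_error hW hV Lphi Lphi1 WF VF a0 b0 a10 b10 hb ha hb1 ha1 hphit mH Pb Pb1 Pa1 Pt Bt M0 heps0 fM f4 fe Lf Wg fg Hh.
move=> /le_trans; apply.
move: f1; rewrite norm2E// lee_fin => f1.
by rewrite -[leRHS]mulr1; exact: ler_wpM2l.
Qed.
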